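(* Let $d=1$, $\gamma>1$, and let $(\rho,u)$ be an eternal flow surrounded by vacuum, occupying the domain $\Omega=\{(x,t): t\in\mathbb R,\ a(t)<x<b(t)\}$, where $\Omega(0)=(a(0),b(0))$ is a bounded interval. Assume that the flow is admissible (in the sense defined in the context) and that $\rho,u$ are smooth (shock-free) in $\Omega$. Set $$p_\pm:=\lim_{t\to\pm\infty}a'(t),\qquad q_\pm:=\lim_{t\to\pm\infty}b'(t).$$ Then $p_+=q_-$ and $p_-=q_+$.
   Context: The one-dimensional isentropic Euler system is $$\partial_t\rho+\partial_x(\rho u)=0,\qquad \partial_t(\rho u)+\partial_x(\rho u^2+p(\rho))=0,\qquad p(\rho)=A\rho^\gamma,\ A>0,\ \gamma>1.$$ The sound speed is $c=\sqrt{p'(\rho)}=\sqrt{\gamma A}\,\rho^\kappa$ with $\kappa=\frac{\gamma-1}2$, and the internal energy $e$ is given by $\rho e=\frac{p}{\gamma-1}$. The energy inequality is $$\partial_t\left(\tfrac12\rho u^2+\rho e\right)+\partial_x\left(\left(\tfrac12\rho u^2+\rho e+p\right)u\right)\le 0$$ in the distributional sense. The total mass and the total energy are finite. ''Eternal'' means defined for all $t\in\mathbb R$. The gas occupies at time $t$ the bounded interval $\Omega(t)=(a(t),b(t))$, where $\rho(\cdot,t)>0$; outside is vacuum. The left and right boundaries are $\Gamma_\ell=\{(a(t),t)\}$ and $\Gamma_r=\{(b(t),t)\}$; they move at the fluid velocity: $a'(t)=u(a(t),t)$, $b'(t)=u(b(t),t)$. A $1$-characteristic (respectively $2$-characteristic)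 is an integral curve in $\Omega$ of $\frac{dX}{dt}=(u-c)(X,t)$ (respectively $\frac{dX}{dt}=(u+c)(X,t)$), oriented by increasing time. An admissible flow surrounded by vacuum is a measurable bounded field $(\rho\ge0,u)$ such that: 1. the domain $\Omega$ is bounded at left and right by two curves $t\mapsto a(t)$, $t\mapsto b(t)$, with $-a$ and $b$ convex; 2. the flow is a distributional solution of the Euler system in $\Omega$; 3. it satisfies the energy inequality; 4. for almost every boundary point $P\in\partial\Omega$, $\lim_{(x,t)\to P}\rho(x,t)=0$; 5. if a $2$-characteristic reaches $\Gamma_r$ at some point $P$, then $P$ is its terminal point, and if it reaches $\Gamma_\ell$ at some point $Q$, then $Q$ is its initial point; symmetrically, if a $1$-characteristic reaches $\Gamma_r$ at some point $P$, then $P$ is its initial point, and if it reaches $\Gamma_\ell$ at some point $Q$, then $Q$ is its terminal point. By convexity of $-a$ and $b$, the derivatives $a',b'$ (defined outside an at most countable set of times) are monotone, so the limits $p_\pm,q_\pm$ exist. *)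

(* Defs.v *)
From HB Require Import structures.
From mathcomp Require Import all_boot all_order all_algebra.
From mathcomp Require Import all_classical all_reals all_analysis.

Set Implicit Arguments.
Unset Strict Implicit.
Unset Printing Implicit Defensive.

Import Order.TTheory GRing.Theory Num.Theory.
Import numFieldNormedType.Exports.

Local Open Scope classical_set_scope.
Local Open Scope ring_scope.

(* A point of the space-time plane is a pair p = (x, t): p.1 is the position
   and p.2 the time. *)

Definition partial_x (R : realType) (f : R * R -> R) : R * R -> R :=
  'D_((1, 0) : R * R) f.

Definition partial_t (R : realType) (f : R * R -> R) : R * R -> R :=
  'D_((0, 1) : R * R) f.

(* C^n on the open set U *)
Fixpoint Cn_on (R : realType) (n : nat) (U : set (R * R)) (f : R * R -> R)
    : Prop :=
  match n with
  | 0%N => forall p, U p -> {for p, continuous f}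
  | m.+1 => [/\ forall p, U p -> differentiable f p,
                Cn_on m U (partial_x f) & Cn_on m U (partial_t f)]
  end.

Definition smooth_on (R : realType) (U : set (R * R)) (f : R * R -> R) : Prop :=
  forall n, Cn_on n U f.

(* D(U): C^oo on the plane, with compact support contained in U *)
Definition test_function (R : realType) (U : set (R * R)) (phi : R * R -> R)
    : Prop :=
  smooth_on setT phi /\
  exists K : set (R * R),
    [/\ compact K, K `<=` U & forall p, ~ K p -> phi p = 0].

(* the pairing of - (d_t f + d_x g) with phi *)
Definition weak_pairing (R : realType) (U : set (R * R))
    (f g phi : R * R -> R) : R :=
  Rintegral (@lebesgue_measure R \x @lebesgue_measure R)%E U
    (fun p => f p * partial_t phi p + g p * partial_x phi p).

(* d_t f + d_x g = 0 in D'(U) *)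
Definition weak_conservation_law (R : realType) (U : set (R * R))
    (f g : R * R -> R) : Prop :=
  forall phi, test_function U phi -> weak_pairing U f g phi = 0.

(* d_t f + d_x g <= 0 in D'(U) *)
Definition weak_dissipation (R : realType) (U : set (R * R))
    (f g : R * R -> R) : Prop :=
  forall phi, test_function U phi -> (forall p, 0 <= phi p) ->
    0 <= weak_pairing U f g phi.

Definition pressure (R : realType) (A gamma r : R) : R := A * r `^ gamma.

Definition sound_speed (R : realType) (A gamma r : R) : R :=
  Num.sqrt (gamma * A) * r `^ ((gamma - 1) / 2).

(* rho e, where e is the internal energy per unit mass *)
Definition internal_energy (R : realType) (A gamma r : R) : R :=
  pressure A gamma r / (gamma - 1).

Definition energy_density (R : realType) (A gamma : R) (rho u : R * R -> R)
    (p : R * R) : R :=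
  rho p * u p ^+ 2 / 2 + internal_energy A gamma (rho p).

Definition momentum_flux (R : realType) (A gamma : R) (rho u : R * R -> R)
    (p : R * R) : R :=
  rho p * u p ^+ 2 + pressure A gamma (rho p).

Definition energy_flux (R : realType) (A gamma : R) (rho u : R * R -> R)
    (p : R * R) : R :=
  (energy_density A gamma rho u p + pressure A gamma (rho p)) * u p.

Definition lambda1 (R : realType) (A gamma : R) (rho u : R * R -> R)
    (p : R * R) : R :=
  u p - sound_speed A gamma (rho p).

Definition lambda2 (R : realType) (A gamma : R) (rho u : R * R -> R)
    (p : R * R) : R :=
  u p + sound_speed A gamma (rho p).

Definition flow_domain (R : realType) (a b : R -> R) : set (R * R) :=
  [set p | a p.2 < p.1 < b p.2].

(* X is an integral curve of dX/dt = lambda(X, t) staying in U for the times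
   in the open interval I *)
Definition integral_curve (R : realType) (U : set (R * R))
    (lambda : R * R -> R) (I : set R) (X : R -> R) : Prop :=
  [/\ is_interval I, open I &
      forall t, I t -> U (X t, t) /\ is_derive t 1 X (lambda (X t, t))].

(* The curve X, defined on I, reaches the boundary curve {(c t, t)} at the
   point (c T, T). *)
Definition reaches (R : realType) (I : set R) (X c : R -> R) (T : R) : Prop :=
  closure I T /\ X t @[t --> within I (nbhs T)] --> c T.

Definition initial_time (R : realType) (I : set R) (T : R) : Prop :=
  forall t, I t -> T <= t.

Definition terminal_time (R : realType) (I : set R) (T : R) : Prop :=
  forall t, I t -> t <= T.

(* Gas filling exactly the intervals ]a t, b t[, for all t in R, whose boundary
   moves with the gas.  The equalities a'(t) = u(a(t), t), b'(t) = u(b(t), t)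
   are about the trace of u on the boundary: the values of u outside the gas
   are meaningless, so the trace is the limit from the inside.  Almost
   every time, rather than every time, because a and b may have corners. *)
Record eternal_vacuum_flow (R : realType) (A gamma : R) (a b : R -> R)
    (rho u : R * R -> R) : Prop := EternalVacuumFlow {
  evf_nonempty : forall t, a t < b t ;
  evf_gas : forall p, flow_domain a b p -> 0 < rho p ;
  evf_vacuum : forall p, ~ flow_domain a b p -> rho p = 0 ;
  evf_left : {ae @lebesgue_measure R, forall t, derivable a t 1 /\
    u p @[p --> within (flow_domain a b) (nbhs (a t, t))] --> derive1 a t} ;
  evf_right : {ae @lebesgue_measure R, forall t, derivable b t 1 /\
    u p @[p --> within (flow_domain a b) (nbhs (b t, t))] --> derive1 b t} ;
  evf_mass : forall t,
    (\int[@lebesgue_measure R]_(x in `]a t, b t[) (rho (x, t))%:E < +oo)%E ;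
  evf_energy : forall t,
    (\int[@lebesgue_measure R]_(x in `]a t, b t[)
       (energy_density A gamma rho u (x, t))%:E < +oo)%E
}.

Record admissible (R : realType) (A gamma : R) (a b : R -> R)
    (rho u : R * R -> R) : Prop := Admissible {
  adm_measurable_rho : measurable_fun (flow_domain a b) rho ;
  adm_measurable_u : measurable_fun (flow_domain a b) u ;
  adm_bounded : exists M : R, forall p, flow_domain a b p ->
    `|rho p| <= M /\ `|u p| <= M ;
  adm_rho_ge0 : forall p, 0 <= rho p ;
  adm_left_convex : convex_function setT ((fun t => - a t) : R -> R^o) ;
  adm_right_convex : convex_function setT (b : R -> R^o) ;
  adm_mass : weak_conservation_law (flow_domain a b)
    rho (fun p => rho p * u p) ;
  adm_momentum : weak_conservation_law (flow_domain a b)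
    (fun p => rho p * u p) (momentum_flux A gamma rho u) ;
  adm_energy : weak_dissipation (flow_domain a b)
    (energy_density A gamma rho u) (energy_flux A gamma rho u) ;
  (* The boundary of the domain consists of the graphs of a and b, which are
     locally Lipschitz: almost every boundary point means almost every t. *)
  adm_vacuum_left : {ae @lebesgue_measure R, forall t,
    rho p @[p --> (a t, t)] --> (0 : R)} ;
  adm_vacuum_right : {ae @lebesgue_measure R, forall t,
    rho p @[p --> (b t, t)] --> (0 : R)} ;
  adm_char2_right : forall I X T,
    integral_curve (flow_domain a b) (lambda2 A gamma rho u) I X ->
    reaches I X b T -> terminal_time I T ;
  adm_char2_left : forall I X T,
    integral_curve (flow_domain a b) (lambda2 A gamma rho u) I X ->
    reaches I X a T -> initial_time I T ;
  adm_char1_right : forall I X T,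
    integral_curve (flow_domain a b) (lambda1 A gamma rho u) I X ->
    reaches I X b T -> initial_time I T ;
  adm_char1_left : forall I X T,
    integral_curve (flow_domain a b) (lambda1 A gamma rho u) I X ->
    reaches I X a T -> terminal_time I T
}.

(* l is the limit of f' along F.  The total function derive1 f has no meaning
   where f is not derivable, so such times are left out. *)
Definition velocity_limit (R : realType) (f : R -> R) (F : set_system R) (l : R)
    : Prop :=
  derive1 f t @[t --> within [set t | derivable f t 1] F] --> l.

(* Main.v *)
Require Import Defs.
From mathcomp Require Import all_boot all_order all_algebra.
From mathcomp Require Import all_classical all_reals all_analysis.
From mathcomp Require Import measurable_realfun ring lra.

Set Implicit Arguments.
Unset Strict Implicit.
Unset Printing Implicit Defensive.

Import Order.TTheory GRing.Theory Num.Theory.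
Import numFieldNormedType.Exports.
Local Open Scope classical_set_scope.
Local Open Scope ring_scope.

(** The proof compares the flow with self-similar ones, and never follows a
    characteristic or a Riemann invariant along its way.

    In the variables u and v = c / kappa, whose sum and difference are the
    Riemann invariants, the system has the entropies rho P_k(u, v), where P_k is
    the k-th moment of u + v s for a symmetric weight on s in [-1, 1]; both P_k
    and its companion S_k obey a two-term recursion.  They remain usable in a
    moving frame: let alpha = (alpha0 + s0 x) / (1 + s0 t) be an affine solution
    of the Burgers equation and zeta = (1 + s0 t)^beta with
    beta = min (1, kappa).  For even k the density
    zeta^k rho P_k(u - alpha, v) satisfies a balance law whose source has the
    sign of - s0 and vanishes when s0 = 0 ([entropy_balance]).  Density and flux
    are O(rho), hence vanish at almost every point of the edges, and the edges
    are Lipschitz; so nothing crosses them, and the total over the gas is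
    monotone in time ([near_decay_between_vacuum_edges], [entropy_decay]).
    Letting k tend to infinity turns these totals into suprema: a bound on
    zeta (|u - alpha| + v) at one time propagates to zeta |u - alpha| and, up to
    a constant, to zeta v at later times if s0 >= 0 and at earlier times if
    s0 <= 0 ([sup_principle]).

    Two choices of alpha are used.

    With s0 = 1 or -1, the principle started at time 0 gives dispersion:
    u - x / (t + 1) and v tend to 0 uniformly as t tends to +oo, and
    u - x / (t - 1) and v do so as t tends to -oo ([late_velocity]).  The edges
    lie on one side of their tangents, so x / t is confined asymptotically to
    [p_+, q_+] in the future and to [q_-, p_-] in the past; u is confined to the
    same intervals in these limits.

    With s0 = 0 and alpha a large constant of either sign, the principle holds
    in both time directions and says that the limiting range of u, at the times
    where v is small, contains the values of u at all times
    ([velocity_range]).  Hence p_+ <= u <= q_+ and q_- <= u <= p_- everywhere.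
    The edge velocities are traces of u, so they obey both pairs of bounds.
    Taking their limits, a' >= q_- gives p_+ >= q_-, b' >= p_+ gives
    q_- >= p_+, and the other equality is obtained in the same way.

    The equations are given in the sense of distributions.  They hold pointwise
    in the gas, by testing them with products of bumps of the form e^(-1/x)
    ([pointwise_of_weak_dissipation]). *)

(** * Moments of the kinetic entropy kernel *)

Section entropy_moments.
Variables (R : realType) (kappa : R).
Hypothesis kappa_gt0 : 0 < kappa.

(** For the weight [(1 - s^2)^lambda] on [[-1, 1]], with
[lambda = (1 - kappa) / (2 kappa)], let P_k and S_k be the integrals of
[(U + v s)^k] and [s (U + v s)^k], divided by that of 1.  Integrating by parts
in s gives [S_{k+1} = moment_ratio k * (v P_k + U S_k)]; this recursion and the
obvious one for P_{k+1} are all that is used of the integrals, so they serve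
as the definition. *)
Definition moment_ratio (k : nat) : R :=
  kappa * k.+1%:R / (1 + kappa * k.+2%:R).

Fixpoint moments (k : nat) (U v : R) : R * R :=
  if k is j.+1 then
    let PS := moments j U v in
    (U * PS.1 + v * PS.2, moment_ratio j * (v * PS.1 + U * PS.2))
  else (1, 0).

Definition moment k U v := (moments k U v).1.
Definition tilted_moment k U v := (moments k U v).2.

Lemma moment0 U v : moment 0 U v = 1. Proof. by []. Qed.
Lemma tilted_moment0 U v : tilted_moment 0 U v = 0. Proof. by []. Qed.
Lemma momentS k U v : moment k.+1 U v = U * moment k U v + v * tilted_moment k U v.
Proof. by []. Qed.
Lemma tilted_momentS k U v :
  tilted_moment k.+1 U v = moment_ratio k * (v * moment k U v + U * tilted_moment k U v).
Proof. by []. Qed.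

Lemma moment_den_gt0 k : 0 < 1 + kappa * k%:R :> R.
Proof. by rewrite ltr_wpDr// mulr_ge0// ltW. Qed.

Lemma moment_ratio_gt0 k : 0 < moment_ratio k.
Proof. by rewrite divr_gt0 ?moment_den_gt0// mulr_gt0. Qed.

Lemma moment_ratio_le1 k : moment_ratio k <= 1.
Proof.
rewrite ler_pdivrMr ?moment_den_gt0// mul1r (natrD _ 1 k.+1) mulrDr.
have := kappa_gt0; nra.
Qed.

Lemma moment_ratio_ge k : kappa / (1 + 2 * kappa) <= moment_ratio k.
Proof.
have k2 : 0 < 1 + 2 * kappa by have := kappa_gt0; lra.
rewrite ler_pdivrMr// mulrAC ler_pdivlMr ?moment_den_gt0//.
have h : 0 <= k%:R :> R by [].
rewrite -[k.+2]addn2 -[k.+1]addn1 !natrD.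
have := kappa_gt0; nra.
Qed.

(** Chain rule for the moments along a curve.  The derivative of P_k in v is
k S_{k-1} and that of S_k involves S_k / v, because of the
Euler-Poisson-Darboux equation satisfied by the kernel.  Each formula at rank
k + 1 uses both at rank k. *)
Lemma is_derive_moments k (U v : R -> R) (s dU dv : R) :
    0 < v s -> is_derive s 1 U dU -> is_derive s 1 v dv ->
  is_derive s 1 (fun y => moment k.+1 (U y) (v y))
    (k.+1%:R * (moment k (U s) (v s) * dU + tilted_moment k (U s) (v s) * dv)) /\
  is_derive s 1 (fun y => tilted_moment k.+1 (U y) (v y))
    (k.+1%:R * (tilted_moment k (U s) (v s) * dU + moment k (U s) (v s) * dv)
      - (1 + kappa) / kappa * (tilted_moment k.+1 (U s) (v s) / v s) * dv).
Proof.
move=> vs dU_ dv_.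
have vs0 : v s != 0 by rewrite gt_eqF.
have k0 : kappa != 0 by rewrite gt_eqF.
elim: k => [|k [IP IS]].
  have n0 := lt0r_neq0 (moment_den_gt0 2).
  split.
    under eq_fun do rewrite momentS moment0 tilted_moment0.
    apply: is_derive_eq.
    by rewrite moment0 tilted_moment0 /GRing.scale/=; ring.
  under eq_fun do rewrite tilted_momentS moment0 tilted_moment0.
  apply: is_derive_eq.
  rewrite tilted_momentS moment0 tilted_moment0 /moment_ratio /GRing.scale/=; field.
  by rewrite vs0 k0 n0.
have n0 := lt0r_neq0 (moment_den_gt0 k.+3).
have n1 := lt0r_neq0 (moment_den_gt0 k.+2).
have -> : (fun y => moment k.+2 (U y) (v y)) =
    (fun y => U y * moment k.+1 (U y) (v y) + v y * tilted_moment k.+1 (U y) (v y)).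
  by apply/funext => y; rewrite momentS.
have -> : (fun y => tilted_moment k.+2 (U y) (v y)) =
    (fun y => moment_ratio k.+1 *
      (v y * moment k.+1 (U y) (v y) + U y * tilted_moment k.+1 (U y) (v y))).
  by apply/funext => y; rewrite tilted_momentS.
split; apply: is_derive_eq; rewrite /GRing.scale/=.
  rewrite !(momentS, tilted_momentS) /moment_ratio.
  move: (moment k _ _) (tilted_moment k _ _) => P S.
  rewrite -![k.+3]addn3 -[k.+2]addn2 -[k.+1]addn1 !natrD in n0 n1 *.
  by field; rewrite vs0 k0 n1.
rewrite !(tilted_momentS, momentS) /moment_ratio.
move: (moment k _ _) (tilted_moment k _ _) => P S.
rewrite -![k.+3]addn3 -[k.+2]addn2 -[k.+1]addn1 !natrD in n0 n1 *.
by field; rewrite vs0 k0 n1 n0.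
Qed.

Lemma ler_norm_moments k U v : 0 <= v ->
  `|moment k U v| <= (`|U| + v) ^+ k /\ `|tilted_moment k U v| <= (`|U| + v) ^+ k.
Proof.
move=> v0; elim: k => [|k [IP IS]]; first by rewrite moment0 tilted_moment0 normr1 normr0.
have h a b : `|a| <= (`|U| + v) ^+ k -> `|b| <= (`|U| + v) ^+ k ->
    `|U * a + v * b| <= (`|U| + v) ^+ k.+1.
  move=> ha hb; rewrite exprS mulrDl (le_trans (ler_normD _ _))// !normrM.
  by rewrite (ger0_norm v0) lerD// ler_wpM2l.
split; first by rewrite momentS h.
rewrite tilted_momentS normrM gtr0_norm ?moment_ratio_gt0// addrC.
by rewrite (le_trans _ (h _ _ IS IP))// ler_piMl// moment_ratio_le1.
Qed.

Lemma momentsN k U v :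
  moment k (- U) v = (-1) ^+ k * moment k U v /\
  tilted_moment k (- U) v = - (-1) ^+ k * tilted_moment k U v.
Proof.
elim: k => [|k [IP IS]]; first by rewrite moment0 tilted_moment0 expr0 mulr1 mulr0.
by rewrite !momentS !tilted_momentS IP IS exprS; split; ring.
Qed.

Lemma moments_ge0 k U v : 0 <= U -> 0 <= v ->
  0 <= moment k U v /\ 0 <= tilted_moment k U v.
Proof.
move=> U0 v0; elim: k => [|k [IP IS]]; first by rewrite moment0 tilted_moment0.
rewrite momentS tilted_momentS; split; first by rewrite addr_ge0 ?mulr_ge0.
by rewrite mulr_ge0 ?(ltW (moment_ratio_gt0 _))// addr_ge0 ?mulr_ge0.
Qed.

(** For even k the integrand [(U + v s)^k] is nonnegative; on the recursion this
is seen by reducing to [0 <= U] with the parity rule [momentsN]. *)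
Lemma moment_ge0 k U v : ~~ odd k -> 0 <= v -> 0 <= moment k U v.
Proof.
move=> ke v0; have [U0|U0] := leP 0 U; first by case: (moments_ge0 k U0 v0).
rewrite -(opprK U) (momentsN k (- U) v).1 -signr_odd (negbTE ke) mul1r.
by apply: (moments_ge0 _ _ v0).1; rewrite oppr_ge0 ltW.
Qed.

Lemma tilted_moment_ge0 k U v : odd k -> 0 <= v -> 0 <= tilted_moment k U v.
Proof.
move=> ke v0; have [U0|U0] := leP 0 U; first by case: (moments_ge0 k U0 v0).
rewrite -(opprK U) (momentsN k (- U) v).2 -signr_odd ke expr1 opprK mul1r.
by apply: (moments_ge0 _ _ v0).2; rewrite oppr_ge0 ltW.
Qed.

Lemma moment_mull_ge0 k U v : odd k -> 0 <= v -> 0 <= U * moment k U v.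
Proof.
move=> ke v0; have [U0|U0] := leP 0 U.
  by rewrite mulr_ge0//; case: (moments_ge0 k U0 v0).
rewrite -(opprK U) (momentsN k (- U) v).1 -signr_odd ke expr1 mulN1r mulrNN.
apply: mulr_ge0; first by rewrite oppr_ge0 ltW.
by apply: (moments_ge0 _ _ v0).1; rewrite oppr_ge0 ltW.
Qed.

(** Jensen's inequality for the convex function [(U + v s)^k] of s, the weight
having mean 0. *)
Lemma moment_ge_velocity k (U v : R) : ~~ odd k -> 0 <= v -> U ^+ k <= moment k U v.
Proof.
have h (j : nat) (W : R) : 0 <= W -> 0 <= v -> W ^+ j <= moment j W v.
  move=> W0 v0; elim: j => [|j IH]; first by rewrite moment0.
  rewrite momentS exprS ler_wpDr ?ler_wpM2l// mulr_ge0//.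
  by case: (moments_ge0 j W0 v0).
move=> ke v0; have [U0|U0] := leP 0 U; first exact: h.
have sk : (-1) ^+ k = 1 :> R by rewrite -signr_odd (negbTE ke).
rewrite -(opprK U) (momentsN k (- U) v).1 (exprNn (- U)) sk !mul1r.
by apply: h; [rewrite oppr_ge0 ltW|].
Qed.

Lemma tilted_moment_mull_ge0 k U v : ~~ odd k -> 0 <= v -> 0 <= U * tilted_moment k U v.
Proof.
move=> ke v0; have [U0|U0] := leP 0 U.
  by rewrite mulr_ge0//; case: (moments_ge0 k U0 v0).
rewrite -(opprK U) (momentsN k (- U) v).2 -signr_odd (negbTE ke) expr0.
rewrite mulN1r mulrNN mulr_ge0 ?oppr_ge0 ?(ltW U0)//.
by apply: (moments_ge0 _ _ v0).2; rewrite oppr_ge0 ltW.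
Qed.

(** The moment of order 2m dominates its value at U = 0, where the recursion
multiplies by at least the infimum of the moment ratios times [v ^+ 2] every
second step. *)
Lemma moment_ge_sound m U v : 0 <= v ->
  (kappa / (1 + 2 * kappa) * v ^+ 2) ^+ m <= moment m.*2 U v.
Proof.
move=> v0; have r0 : 0 <= kappa / (1 + 2 * kappa).
  by rewrite divr_ge0 ?ltW// ltr_wpDr// mulr_ge0// ltW.
have := fun k => moment_ratio_ge k.
move: (kappa / _) r0 => r r0 r_le.
elim: m => [|m IH]; first by rewrite expr0 moment0.
have e : ~~ odd m.*2 by rewrite odd_double.
rewrite exprS doubleS momentS ler_wpDl ?moment_mull_ge0 ?oddS//.
apply: (le_trans (ler_wpM2l (mulr_ge0 r0 (sqr_ge0 v)) IH)); rewrite tilted_momentS.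
have P0 := moment_ge0 U e v0.
move: (moment m.*2 U v) (tilted_moment_mull_ge0 U e v0) P0 => P; move: (U * _) => T T0 P0.
have -> : r * v ^+ 2 * P = v * (r * (v * P)) by ring.
rewrite ler_wpM2l//.
apply: (@le_trans _ _ (moment_ratio m.*2 * (v * P))).
  by rewrite ler_wpM2r ?mulr_ge0.
by rewrite ler_wpM2l ?(ltW (moment_ratio_gt0 _))// ler_wpDr.
Qed.

End entropy_moments.

(** * Integrals over intervals with moving ends *)

Section growth_control.
Context {R : realType}.
Notation mu := (@lebesgue_measure R).

(** A Dini-type criterion: it suffices to control the increments of f up to a
slope d > 0 near every time, where the size of the neighbourhood may depend on
d.  The supremum of the times up to which the desired bound holds cannot be
smaller than t2. *)
Lemma le_of_locally_nonincreasing (f : R -> R) (t1 t2 : R) : t1 <= t2 ->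
  (forall t, t1 <= t <= t2 -> forall d, 0 < d -> exists2 h, 0 < h &
    forall s s', t1 <= s -> s <= s' -> s' <= t2 -> `|s - t| < h ->
      `|s' - t| < h -> f s' <= f s + d * (s' - s)) ->
  f t2 <= f t1.
Proof.
move=> t12 floc; apply/ler_addgt0Pr => e e0.
have den : 0 < t2 - t1 + 1 by lra.
pose d := e / (t2 - t1 + 1); have d0 : 0 < d by rewrite divr_gt0.
suff h : f t2 <= f t1 + d * (t2 - t1).
  rewrite (le_trans h)// lerD2l /d mulrAC ler_pdivrMr// ler_wpM2l ?(ltW e0)//; lra.
pose S := [set s | t1 <= s <= t2 /\ f s <= f t1 + d * (s - t1)].
have St1 : S t1 by split; rewrite ?lexx ?t12//; lra.
have hS : has_sup S by split; [exists t1 | exists t2 => s [/andP[]]].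
have [st1 st2] : t1 <= sup S /\ sup S <= t2.
  split; first exact: (sup_upper_bound hS).
  by apply: ge_sup; [exists t1 | move=> s [/andP[]]].
have [h h0 fh] := floc (sup S) (introT andP (conj st1 st2)) d d0.
have [s [/andP[t1s st2'] fs] sh] := sup_adherent h0 hS.
have ss : s <= sup S by apply: (sup_upper_bound hS); split=> //; rewrite t1s.
(* A candidate m for S, strictly beyond sup S unless sup S = t2. *)
have [m [m1 m2 m3 m4]] : exists m, [/\ sup S <= m, m <= t2, `|m - sup S| < h &
    sup S < t2 -> sup S < m].
  have [lt|] := ltP (sup S) t2; last first.
    by move=> ge; exists (sup S); rewrite subrr normr0; split.
  exists (Num.min t2 (sup S + h / 2)); split.
  - rewrite le_min st2/=; lra.
  - by rewrite ge_min lexx.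
  - have a1 : Num.min t2 (sup S + h / 2) <= sup S + h / 2 by rewrite ge_min lexx orbT.
    have a2 : sup S <= Num.min t2 (sup S + h / 2) by rewrite le_min st2/=; lra.
    rewrite ger0_norm; lra.
  - rewrite lt_min => _; rewrite lt/=; lra.
have Sm : S m.
  split; first by rewrite m2 (le_trans st1).
  have := fh s m t1s (le_trans ss m1) m2 _ m3.
  rewrite ler0_norm ?subr_le0// => /(_ ltac:(lra)); lra.
have mE : m = sup S by apply/eqP; rewrite eq_le m1 (sup_upper_bound hS).
have /le_lt_trans : t2 <= sup S by rewrite leNgt; apply/negP => /m4; rewrite mE ltxx.
have -> : t2 = m by apply/eqP; rewrite eq_le m2 mE andbT leNgt; apply/negP => /m4; rewrite mE ltxx.
by move=> _; case: Sm.
Qed.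

Lemma Rintegral_itv_bounds (f : R -> R) (p l m q K : R) :
    p <= l -> l <= m -> m <= q -> {within `[p, q], continuous f} ->
    (forall x, p <= x <= l \/ m <= x <= q -> `|f x| <= K) ->
  `|\int[mu]_(x in `[p, q]) f x - \int[mu]_(x in `[l, m]) f x|
    <= K * (l - p + (q - m)).
Proof.
move=> pl lm mq cf fK.
have ipq : mu.-integrable `[p, q] (EFin \o f).
  by apply: continuous_compact_integrable => //; exact: segment_compact.
have isub c d : p <= c -> d <= q -> mu.-integrable `[c, d] (EFin \o f).
  move=> pc dq; apply: integrableS ipq => //.
  by apply: subset_itv; rewrite bnd_simp.
have split1 c d e : p <= c -> c <= d -> d <= e -> e <= q ->
    \int[mu]_(x in `[c, e]) f x =
    \int[mu]_(x in `[c, d]) f x + \int[mu]_(x in `[d, e]) f x.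
  move=> pc cd de eq; have := @Rintegral_itvB _ f (BLeft c) (BRight e) d (isub _ _ pc eq).
  rewrite !bnd_simp => /(_ cd de); rewrite Rintegral_itv_obnd_cbnd => [<-|].
    by rewrite addrC subrK.
  apply: integrableS (isub _ _ (le_trans pc cd) eq) => //.
  by apply: subset_itvr; rewrite bnd_simp.
have bnd c d : p <= c -> c <= d -> d <= q -> (forall x, c <= x <= d -> `|f x| <= K) ->
    `|\int[mu]_(x in `[c, d]) f x| <= K * (d - c).
  move=> pc cd dq cK; apply: (le_trans (le_normr_Rintegral _ (isub _ _ pc dq))) => //.
  have -> : K * (d - c) = \int[mu]_(x in `[c, d]) K.
    rewrite Rintegral_cst//= lebesgue_measure_itv/= lte_fin.
    have [cd'|] := ltP c d; first by rewrite -EFinB.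
    by move=> dc; have -> : d = c by [apply/eqP; rewrite eq_le cd dc]; rewrite subrr mulr0.
  apply: le_Rintegral => //.
  - by have := integrable_norm (isub _ _ pc dq).
  - apply: continuous_compact_integrable; first exact: segment_compact.
    by apply: continuous_subspaceT => x; exact: cvg_cst.
rewrite (split1 p l q) ?(le_trans lm)// (split1 l m q)//.
have -> : forall A B C : R, A + (B + C) - B = A + C by move=> *; ring.
rewrite mulrDr (le_trans (ler_normD _ _))// lerD//.
  by apply: bnd => // [|x xl]; [rewrite (le_trans lm)|apply: fK; left].
by apply: bnd => // [|x xl]; [rewrite (le_trans pl)|apply: fK; right].
Qed.

End growth_control.

Section slices.
Context {R : realType}.
Notation mu := (@lebesgue_measure R).

Lemma le_normr_of_dist (y z d : R) : `|y - z| < d -> `|y| <= `|z| + d.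
Proof. by move=> yz; rewrite -lerBlDl (le_trans (lerB_dist _ _))// ltW. Qed.

Lemma nbhs_pairP (P : set (R * R)) (p : R * R) : nbhs p P ->
  exists2 e, 0 < e & forall x t, `|x - p.1| < e -> `|t - p.2| < e -> P (x, t).
Proof.
move=> /nbhs_ballP[e /= e0 eP]; exists e => // x t xp tp.
by apply: eP; split => /=; rewrite /ball/= distrC.
Qed.

Lemma continuous_pairP (f : R * R -> R) (p : R * R) (d : R) : 0 < d ->
    {for p, continuous f} ->
  exists2 e, 0 < e & forall x t, `|x - p.1| < e -> `|t - p.2| < e ->
    `|f (x, t) - f p| < d.
Proof.
move=> d0 /cvgrPdist_lt/(_ d d0)/nbhs_pairP[e e0 eP]; exists e => // x t xe te.
by rewrite distrC; exact: (eP _ _ xe te).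
Qed.

Lemma continuous_slice_x (f : R * R -> R) (x t : R) :
  {for (x, t), continuous f} -> {for x, continuous (fun y => f (y, t))}.
Proof.
move=> cf; have h : {for x, continuous (fun y : R => (y, t))}.
  exact: (cvg_pair (@cvg_id _ (nbhs x)) (cvg_cst t)).
exact: (@continuous_comp _ _ _ (fun y : R => (y, t)) f x h cf).
Qed.

Lemma continuous_slice_t (f : R * R -> R) (x t : R) :
  {for (x, t), continuous f} -> {for t, continuous (fun s => f (x, s))}.
Proof.
move=> cf; have h : {for t, continuous (fun s : R => (x, s))}.
  exact: (cvg_pair (cvg_cst x) (@cvg_id _ (nbhs t))).
exact: (@continuous_comp _ _ _ (fun s : R => (x, s)) f t h cf).
Qed.

Lemma continuous_at_within (f : R -> R) (l m : R) :
  (forall x, l <= x <= m -> {for x, continuous f}) ->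
  {within `[l, m], continuous f}.
Proof.
move=> cf; apply/subspace_continuousP => x /=; rewrite in_itv/= => xlm.
by apply: cvg_within_filter; exact: cf.
Qed.

Lemma is_derive_continuous (f : R -> R) (x d : R) :
  is_derive x 1 f d -> {for x, continuous f}.
Proof.
move=> fd; apply/differentiable_continuous/derivable1_diffP.
exact: (@ex_derive _ _ _ _ _ _ _ fd).
Qed.

Lemma Rintegral_derive (f F : R -> R) (l m : R) : l < m ->
    (forall x, l <= x <= m -> {for x, continuous f}) ->
    (forall x, l <= x <= m -> is_derive x 1 F (f x)) ->
  \int[mu]_(x in `[l, m]) f x = F m - F l.
Proof.
move=> lm cf dF; rewrite /Rintegral (@continuous_FTC2 _ f F l m)//.
- exact: continuous_at_within.
- have cF x : l <= x <= m -> {for x, continuous F}.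
    by move=> /dF; exact: is_derive_continuous.
  split.
  + move=> x; rewrite in_itv/= => /andP[lx xm].
    by apply: (@ex_derive _ _ _ _ _ _ _ (dF x _)); rewrite !ltW.
  + by apply: cvg_at_right_filter; apply: cF; rewrite lexx ltW.
  + by apply: cvg_at_left_filter; apply: cF; rewrite lexx ltW.
- move=> x; rewrite in_itv/= => /andP[lx xm].
  by rewrite derive1E; apply: (@derive_val _ _ _ _ _ _ _ (dF x _)); rewrite !ltW.
Qed.

Lemma integrable_continuous_at (f : R -> R) (l m : R) :
  (forall x, l <= x <= m -> {for x, continuous f}) ->
  mu.-integrable `[l, m] (EFin \o f).
Proof.
move=> cf; apply: continuous_compact_integrable; first exact: segment_compact.
exact: continuous_at_within.
Qed.

(** A tube lemma: by compactness of the segment, continuity of g along it is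
uniform on a whole neighbourhood of it. *)
Lemma uniform_near_segment (U : set (R * R)) (g : R * R -> R) (l m t d : R) :
    open U -> 0 < d -> l <= m ->
    (forall x, l <= x <= m -> U (x, t)) ->
    (forall p, U p -> {for p, continuous g}) ->
  exists2 h, 0 < h & forall x s, l - h <= x <= m + h -> `|s - t| <= h ->
    U (x, s) /\ `|g (x, s) - g (x, t)| <= d.
Proof.
move=> oU d0 lm segU cg.
have cov : near_covering `[l, m] by apply/compact_near_coveringP/segment_compact.
pose P (h x : R) := forall y s, `|y - x| <= h -> `|s - t| <= h ->
  U (y, s) /\ `|g (y, s) - g (y, t)| <= d.
have /(_ _) := cov R (0^'+) P _.
have hP x : `[l, m]%classic x -> \forall x' \near x & h \near 0^'+, P h x'.
  rewrite /= in_itv/= => xlm.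
  have Uxt := segU _ xlm.
  have [e1 e10 U1] := nbhs_pairP (open_nbhs_nbhs (conj oU Uxt)).
  have [e2 e20 g2] := continuous_pairP (divr_gt0 d0 (ltr0Sn R 1)) (cg _ Uxt).
  pose e := Num.min e1 e2.
  have e0 : 0 < e by rewrite lt_min e10.
  exists (ball x (e / 2), [set h | h < e / 2]) => /=.
    split; first by apply: nbhsx_ballx; rewrite divr_gt0.
    by apply: nbhs_right_lt; rewrite divr_gt0.
  move=> [x' h]/= [xx' he] y s yx' st.
  rewrite /ball/= in xx'.
  have yx : `|y - x| < e.
    have -> : y - x = (y - x') + (x' - x) by ring.
    by rewrite (le_lt_trans (ler_normD _ _))// (distrC x' x); lra.
  have se : `|s - t| < e by lra.
  have [] : e <= e1 /\ e <= e2 by rewrite !ge_min !lexx orbT.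
  move=> ee1 ee2; split; first by apply: U1 => /=; lra.
  have A := g2 y s (lt_le_trans yx ee2) (lt_le_trans se ee2).
  have B := g2 y t (lt_le_trans yx ee2).
  rewrite subrr normr0 in B; move: {B}(B e20) A => /= B A.
  have -> : g (y, s) - g (y, t) = (g (y, s) - g (x, t)) - (g (y, t) - g (x, t)) by ring.
  rewrite (le_trans (ler_normB _ _))//; lra.
move=> /(_ hP) ch; near (0:R)^'+ => h; exists h; first by near: h; exact: nbhs_right_gt.
have Ph : `[l, m] `<=` P h by near: h.
have h0 : 0 < h by near: h; exact: nbhs_right_gt.
move=> x s /andP[lx xm] st.
pose x' := Num.max l (Num.min x m).
have x'lm : l <= x' <= m by rewrite /x' le_max lexx/= ge_max lm ge_min lexx orbT.
have xx' : `|x - x'| <= h.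
  rewrite /x'; case: (lerP x m) => xm'; case: (lerP l _) => lx';
  rewrite ler_norml; lra.
by apply: (Ph x') => //=; rewrite in_itv.
Unshelve. all: by end_near. Qed.

End slices.

Section moving_curves.
Context {R : realType}.
Notation mu := (@lebesgue_measure R).

(** Comparing integrals over two neighbouring intervals goes through their
intersection [[l, m]]; the last bound measures what is left out of both. *)
Lemma common_part_of_intervals (a0 b0 a1 b1 at_ bt k w : R) :
    at_ - k < a0 < at_ + k -> at_ - k < a1 < at_ + k ->
    bt - k < b0 < bt + k -> bt - k < b1 < bt + k -> k <= (bt - at_) / 2 ->
    `|a0 - a1| <= w -> `|b0 - b1| <= w ->
  exists l m, [/\ l < m, at_ - k < l < at_ + k, bt - k < m < bt + k,
    [/\ a0 <= l, a1 <= l, m <= b0 & m <= b1] &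
    (l - a0 + (b0 - m)) + (l - a1 + (b1 - m)) <= 2 * w].
Proof.
rewrite !ler_norml => a0k a1k b0k b1k kab aw bw.
exists (Num.max a0 a1), (Num.min b0 b1).
case: (leP a0 a1) => a01; case: (leP b0 b1) => b01; split;
  try (split; rewrite ?lexx ?a01 ?b01 ?(ltW a01) ?(ltW b01)//); lra.
Qed.

(** Green's formula as an infinitesimal inequality.  Between the times s and s'
the integrals over the common part of the two slices differ by at most the
flux through the sides; each of the pieces left out has length at most
Lam (s' - s), because the curves al and be are Lipschitz, and eta on them is
close to its value at the end points.  Only Lipschitz curves are asked for, as
convex edges can have corners. *)
Lemma growth_between_curves (U : set (R * R)) (eta H etat Hx : R * R -> R)
    (al be : R -> R) (t1 t2 Lam t d : R) :
    open U ->
    (forall p, U p -> {for p, continuous eta}) ->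
    (forall p, U p -> {for p, continuous Hx}) ->
    (forall p, U p -> is_derive p.2 1 (fun s => eta (p.1, s)) (etat p)) ->
    (forall p, U p -> is_derive p.1 1 (fun x => H (x, p.2)) (Hx p)) ->
    (forall p, U p -> etat p + Hx p <= 0) ->
    0 <= Lam ->
    (forall s s', t1 <= s <= t2 -> t1 <= s' <= t2 ->
      `|al s - al s'| <= Lam * `|s - s'| /\ `|be s - be s'| <= Lam * `|s - s'|) ->
    t1 <= t <= t2 -> al t < be t ->
    (forall x, al t <= x <= be t -> U (x, t)) ->
    0 < d ->
  exists2 h, 0 < h & forall s s', t1 <= s -> s <= s' -> s' <= t2 ->
    `|s - t| < h -> `|s' - t| < h ->
    \int[mu]_(x in `[al s', be s']) eta (x, s') <=
    \int[mu]_(x in `[al s, be s]) eta (x, s) +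
    (`|H (al t, t)| + `|H (be t, t)| +
      2 * Lam * (`|eta (al t, t)| + `|eta (be t, t)|) + d) * (s' - s).
Proof.
move=> oU ceta cHx deta dH pde Lam0 lip tt12 abt segU d0.
have L1 : 0 < Lam + 1 by rewrite ltr_wpDl.
have [W [W0 WE]] : exists W, 0 < W /\ W = be t - al t + 1.
  by exists (be t - al t + 1); split => //; move: abt; clear; lra.
have [d1 d10 d1E] : exists2 d1, 0 < d1 & 2 * (Lam + 1) * d1 = d / 2.
  by exists (d / (4 * (Lam + 1))); [rewrite divr_gt0// mulr_gt0|field; rewrite gt_eqF].
have [d2 d20 d2E] : exists2 d2, 0 < d2 & W * d2 = d / 2.
  by exists (d / (2 * W)); [rewrite divr_gt0// mulr_gt0|field; rewrite gt_eqF].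
have [h1 h10 tube] := uniform_near_segment oU d20 (ltW abt) segU cHx.
have Ua : U (al t, t) by apply: segU; rewrite lexx ltW.
have Ub : U (be t, t) by apply: segU; rewrite lexx ltW.
have [ea ea0 eta_a] := continuous_pairP d10 (ceta _ Ua).
have [eb eb0 eta_b] := continuous_pairP d10 (ceta _ Ub).
have near_H p : U p -> exists2 e, 0 < e & forall x, `|x - p.1| < e ->
    `|H (x, p.2) - H p| < d1.
  case: p => x0 t0 Up.
  have /cvgrPdist_lt/(_ d1 d10)/nbhs_ballP[e /= e0 eP] := is_derive_continuous (dH _ Up).
  by exists e => // x xe; rewrite distrC; apply: eP; rewrite /ball/= distrC.
have [fa fa0 H_a] := near_H _ Ua.
have [fb fb0 H_b] := near_H _ Ub.
have [k [k0 [kh1 kea keb [kfa kfb kab k12]]]] : exists k, 0 < k /\ [/\ k <= h1, k <= ea,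
    k <= eb & [/\ k <= fa, k <= fb, k <= (be t - al t) / 2 & k <= 1 / 2]].
  exists (Num.min (Num.min h1 (Num.min ea eb))
    (Num.min (Num.min fa fb) (Num.min ((be t - al t) / 2) (1 / 2)))).
  split; first by rewrite !lt_min h10 ea0 eb0 fa0 fb0 !divr_gt0// subr_gt0.
  by split; [..|split]; rewrite !ge_min lexx ?orbT.
have [h h0 [hk Lh]] : exists2 h, 0 < h & h <= k /\ forall x, x < h -> Lam * x < k.
  exists (k / (Lam + 1)); first by rewrite divr_gt0.
  have Lk := mulr_ge0 (ltW k0) Lam0; split.
    by rewrite ler_pdivrMr// mulrDr mulr1 lerDr.
  move=> x xh; apply: (@le_lt_trans _ _ (Lam * (k / (Lam + 1)))).
    by rewrite ler_wpM2l// ltW.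
  by rewrite mulrA ltr_pdivrMr// mulrDr mulr1 mulrC ltrDl.
exists h => // s s' t1s ss' s't2 sh s'h.
have s12 : t1 <= s <= t2 by rewrite t1s (le_trans ss').
have s'12 : t1 <= s' <= t2 by rewrite s't2 (le_trans t1s).
have [lla llb] := lip _ _ s'12 s12.
rewrite (ger0_norm (_ : 0 <= s' - s)) ?subr_ge0// in lla llb.
have near_t r : t1 <= r <= t2 -> `|r - t| < h ->
    (al t - k < al r < al t + k) /\ (be t - k < be r < be t + k).
  move=> r12 rh; have [la lb] := lip _ _ r12 tt12.
  split; rewrite -ltr_distl; [exact: le_lt_trans la (Lh _ rh)|].
  exact: le_lt_trans lb (Lh _ rh).
have [als bes] := near_t s s12 sh.
have [als' bes'] := near_t s' s'12 s'h.
have [l [m [lm lk mk [sl s'l ms ms'] lmsum]]] :=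
  common_part_of_intervals als' als bes' bes kab lla llb.
have tube' x r : al t - k < x -> x < be t + k -> `|r - t| < h ->
    U (x, r) /\ `|Hx (x, r) - Hx (x, t)| <= d2.
  move=> x1 x2 rh; apply: tube; first by apply/andP; split; move: x1 x2 kh1; clear; lra.
  by rewrite ltW// (lt_le_trans rh)// (le_trans hk).
have ceta' x r : al t - k < x -> x < be t + k -> `|r - t| < h ->
    {for x, continuous (fun y => eta (y, r))}.
  by move=> x1 x2 rh; apply: continuous_slice_x; apply: ceta; exact: (tube' _ _ x1 x2 rh).1.
have lmk x : l <= x <= m -> al t - k < x /\ x < be t + k.
  by move: lk mk; clear; lra.
have th : `|t - t| < h by rewrite subrr normr0.
pose K := `|eta (al t, t)| + `|eta (be t, t)| + d1.
have etaK x r : `|x - al t| < k \/ `|x - be t| < k -> `|r - t| < h -> `|eta (x, r)| <= K.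
  move=> xx rh; rewrite /K; case: xx => xk.
    have /le_normr_of_dist/= := eta_a x r (lt_le_trans xk kea) (lt_le_trans rh (le_trans hk kea)).
    by move/le_trans; apply; rewrite lerD2r lerDl.
  have /le_normr_of_dist/= := eta_b x r (lt_le_trans xk keb) (lt_le_trans rh (le_trans hk keb)).
  by move/le_trans; apply; rewrite lerD2r lerDr.
have K0 : 0 <= K by rewrite /K !addr_ge0// ltW.
have Kbound r : `|r - t| < h -> al t - k < al r < al t + k -> al r <= l -> m <= be r ->
    be t - k < be r < be t + k ->
  `|\int[mu]_(x in `[al r, be r]) eta (x, r) - \int[mu]_(x in `[l, m]) eta (x, r)|
    <= K * (l - al r + (be r - m)).
  move=> rh ar arl mbr brk; apply: Rintegral_itv_bounds => //; first exact: ltW.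
    apply: continuous_at_within => x xx; apply: ceta' => //; move: xx ar brk; clear; lra.
  move=> x xx; apply: etaK => //; rewrite !ltr_norml; move: xx ar brk arl mbr lk mk; clear.
  by move=> [|] ? *; [left|right]; lra.
(* B' and B: the pieces left out at the times s' and s. *)
have B' := Kbound s' s'h als' sl ms bes'.
have B := Kbound s sh als s'l ms' bes.
have KK := ler_wpM2l K0 lmsum.
(* On the common part, the mean value theorem in time and the balance law. *)
have pt x : l <= x <= m -> eta (x, s') <= eta (x, s) + (s' - s) * (d2 - Hx (x, t)).
  move=> /lmk[x1 x2].
  have rh r : s <= r <= s' -> `|r - t| < h.
    by move: sh s'h; rewrite !ltr_norml; clear; lra.
  have Uxr r : s <= r <= s' -> U (x, r) /\ `|Hx (x, r) - Hx (x, t)| <= d2.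
    by move=> /rh rr; exact: tube'.
  rewrite -lerBlDl.
  have [||c cs ->] := @MVT_segment R (fun r => eta (x, r)) (fun r => etat (x, r)) s s' ss'.
  - move=> r; rewrite in_itv/= => /andP[r1 r2].
    by have := deta (x, r) (Uxr r _).1; apply; rewrite !ltW.
  - apply: continuous_at_within => r r12; apply: continuous_slice_t; apply: ceta.
    exact: (Uxr r r12).1.
  rewrite in_itv/= in cs; have [Uc] := Uxr c cs.
  have := pde _ Uc; rewrite ler_norml mulrC => pc dc.
  by rewrite ler_wpM2l ?subr_ge0//=; move: pc dc; clear; lra.
have M : \int[mu]_(x in `[l, m]) eta (x, s') <= \int[mu]_(x in `[l, m]) eta (x, s)
   + (s' - s) * (d2 * (m - l) - (H (m, t) - H (l, t))).
  have cHx' x : l <= x <= m -> {for x, continuous (fun y => Hx (y, t))}.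
    move=> /lmk[x1 x2]; apply: continuous_slice_x; apply: cHx.
    exact: (tube' x t x1 x2 th).1.
  have cg x : l <= x <= m -> {for x, continuous (fun y => (s' - s) * (d2 - Hx (y, t)))}.
    move=> xlm; apply: cvgM; first exact: cvg_cst.
    by apply: cvgB; [exact: cvg_cst|exact: cHx'].
  have <- : \int[mu]_(x in `[l, m]) ((s' - s) * (d2 - Hx (x, t))) =
     (s' - s) * (d2 * (m - l) - (H (m, t) - H (l, t))).
    have dF x : l <= x <= m ->
        is_derive x 1 (fun y => (s' - s) * (d2 * y - H (y, t))) ((s' - s) * (d2 - Hx (x, t))).
      move=> /lmk[x1 x2].
      have ? : is_derive x 1 (fun y => H (y, t)) (Hx (x, t)).
        exact: (dH (x, t) (tube' x t x1 x2 th).1).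
      by apply: is_derive_eq; rewrite /GRing.scale/=; ring.
    by rewrite (Rintegral_derive lm cg dF); ring.
  have ce r x : `|r - t| < h -> l <= x <= m -> {for x, continuous (fun y => eta (y, r))}.
    by move=> rh /lmk[x1 x2]; exact: ceta'.
  have i1 : mu.-integrable `[l, m] (EFin \o (fun x => eta (x, s))).
    by apply: integrable_continuous_at => x; exact: ce.
  have i2 := integrable_continuous_at cg.
  rewrite -(RintegralD _ i1 i2)//; apply: le_Rintegral => //.
  - by apply: integrable_continuous_at => x; exact: ce.
  - apply: integrable_continuous_at => x xlm; apply: cvgD; [exact: ce|exact: cg].
have Hl : `|H (l, t)| <= `|H (al t, t)| + d1.
  by apply/le_normr_of_dist/H_a; rewrite (lt_le_trans _ kfa)// ltr_distl.
have Hm : `|H (m, t)| <= `|H (be t, t)| + d1.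
  by apply/le_normr_of_dist/H_b; rewrite (lt_le_trans _ kfb)// ltr_distl.
have N : (s' - s) * (d2 * (m - l) - (H (m, t) - H (l, t))) <=
    (s' - s) * (`|H (al t, t)| + `|H (be t, t)| + 2 * d1 + d / 2).
  rewrite ler_wpM2l ?subr_ge0//.
  have : d2 * (m - l) <= d / 2.
    rewrite -d2E mulrC ler_wpM2r ?(ltW d20)// WE; move: lk mk k12; clear; lra.
  have := ler_norm (H (l, t)); have := ler_norm (- H (m, t)); rewrite normrN.
  by move: Hl Hm; clear; lra.
have {}B' := le_trans (ler_norm _) B'.
rewrite distrC in B; have {}B := le_trans (ler_norm _) B.
have dd : (2 * (Lam + 1) * d1) * (s' - s) = d / 2 * (s' - s) by rewrite d1E.
move: M N B B' KK dd; rewrite /K; clear; lra.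
Qed.

End moving_curves.

Section vacuum_edges.
Context {R : realType}.
Notation mu := (@lebesgue_measure R).

Lemma le_add_Rintegral_rate (F r : R -> R) (t1 t2 : R) : t1 <= t2 ->
    (forall t, t1 <= t <= t2 -> {for t, continuous r}) ->
    (forall t, t1 <= t <= t2 -> forall d, 0 < d -> exists2 h, 0 < h &
      forall s s', t1 <= s -> s <= s' -> s' <= t2 -> `|s - t| < h ->
        `|s' - t| < h -> F s' <= F s + (r t + d) * (s' - s)) ->
  F t2 <= F t1 + \int[mu]_(x in `[t1, t2]) r x.
Proof.
move=> t12 cr Floc.
pose I s := \int[mu]_(x in `[t1, s]) r x.
have ir s : s <= t2 -> mu.-integrable `[t1, s] (EFin \o r).
  move=> st2; apply: integrable_continuous_at => x /andP[x1 x2].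
  by apply: cr; rewrite x1 (le_trans x2).
suff : F t2 - I t2 <= F t1 - I t1.
  by rewrite /I set_itv1 Rintegral_set1; lra.
apply: (@le_of_locally_nonincreasing _ (fun s => F s - I s)) => // t t12' d d0.
have d20 : 0 < d / 2 by lra.
have [h h0 Fh] := Floc t t12' _ d20.
have /cvgrPdist_lt/(_ _ d20)/nbhs_ballP[k /= k0 rk] := cr t t12'.
exists (Num.min h k); first by rewrite lt_min h0.
move=> s s' t1s ss' s't2; rewrite !lt_min => /andP[sh sk] /andP[s'h s'k].
have := Fh s s' t1s ss' s't2 sh s'h.
suff : (r t - d / 2) * (s' - s) <= I s' - I s by lra.
have := @Rintegral_itvB _ r (BLeft t1) (BRight s') s (ir _ s't2).
rewrite !bnd_simp => /(_ t1s ss'); rewrite /I => ->.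
have isub : mu.-integrable `]s, s'] (EFin \o r).
  by apply: integrableS (ir _ s't2) => //; apply: subset_itv; rewrite bnd_simp.
have -> : (r t - d / 2) * (s' - s) = \int[mu]_(x in `]s, s']) (r t - d / 2).
  rewrite Rintegral_cst//= lebesgue_measure_itv/= lte_fin.
  case: (ltP s s') => [_|s's]; first by rewrite -EFinB.
  by have -> : s' = s by [apply/eqP; rewrite eq_le s's ss']; rewrite subrr.
apply: le_Rintegral => //.
  have : mu.-integrable `[s, s'] (EFin \o cst (r t - d / 2)).
    by apply: integrable_continuous_at => x _; exact: cvg_cst.
  by move=> i; apply: integrableS i => //; apply: subset_itvr; rewrite bnd_simp.
move=> x /=; rewrite in_itv/= => /andP[sx xs'].
have : `|r t - r x| < d / 2.
  apply: rk; move: sk s'k; rewrite /ball/= !ltr_norml => /andP[? ?] /andP[? ?]; lra.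
by rewrite ltr_norml => /andP[? ?]; lra.
Qed.

(** The total of an entropy dominated by rho cannot increase, because nothing
flows through a vacuum edge.  The hypotheses give no information at the edge
itself for exceptional times, so the total is taken at a distance e from both
edges: there the flux is at most a multiple of rho, bounded, and tends to 0
for almost every t as e tends to 0.  By dominated convergence its time
integral falls below d for some small e. *)
Lemma near_decay_between_vacuum_edges (a b : R -> R) (rho eta H etat Hx : R * R -> R)
    (t1 t2 Lam C M : R) (U : set (R * R)) :
    open U -> (forall x t, t1 <= t <= t2 -> a t < x < b t -> U (x, t)) ->
    continuous a -> continuous b -> (forall t, a t < b t) ->
    (forall p, U p -> {for p, continuous rho}) ->
    (forall p, U p -> 0 <= rho p <= M) ->
    {ae mu, forall t, rho p @[p --> (a t, t)] --> (0 : R)} ->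
    {ae mu, forall t, rho p @[p --> (b t, t)] --> (0 : R)} ->
    (forall p, U p -> {for p, continuous eta}) ->
    (forall p, U p -> {for p, continuous Hx}) ->
    (forall p, U p -> is_derive p.2 1 (fun s => eta (p.1, s)) (etat p)) ->
    (forall p, U p -> is_derive p.1 1 (fun x => H (x, p.2)) (Hx p)) ->
    (forall p, U p -> etat p + Hx p <= 0) ->
    0 <= Lam -> 0 <= C ->
    (forall s s', t1 <= s <= t2 -> t1 <= s' <= t2 ->
      `|a s - a s'| <= Lam * `|s - s'| /\ `|b s - b s'| <= Lam * `|s - s'|) ->
    (forall p, U p -> t1 <= p.2 <= t2 -> `|eta p| <= C * rho p /\ `|H p| <= C * rho p) ->
    t1 <= t2 ->
  forall d k, 0 < d -> 0 < k -> exists e, [/\ 0 < e, e < k &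
    \int[mu]_(x in `[a t2 + e, b t2 - e]) eta (x, t2) <=
    \int[mu]_(x in `[a t1 + e, b t1 - e]) eta (x, t1) + d].
Proof.
move=> oU slabU ca cb ab crho rhoM aea aeb ceta cHx deta dH pde Lam0 C0 lip bound t12 d k d0 k0.
have [w w0 wab] : exists2 w, 0 < w & forall t, t1 <= t <= t2 -> w <= b t - a t.
  have [|c c12 cmin] := @EVT_min R (fun t => b t - a t) t1 t2 t12.
    by apply: continuous_at_within => x _; apply: cvgB; [exact: cb|exact: ca].
  exists (b c - a c); first by rewrite subr_gt0.
  by move=> t tt; apply: cmin; rewrite in_itv.
(* The distances e n = 1 / (n + N + 1) stay below k and below half the width of the gas. *)
pose N := Num.truncn (2 / w + 1 / k).
have N1 : 2 / w + 1 / k < N.+1%:R by rewrite truncnS_gt.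
have [wN kN] : 2 / w < N.+1%:R /\ 1 / k < N.+1%:R.
  by have := divr_gt0 (ltr0Sn R 1) w0; have := divr_gt0 ltr01 k0; lra.
pose e n : R := (n + N).+1%:R^-1.
have e0 n : 0 < e n by rewrite invr_gt0.
have eN n : e n <= N.+1%:R^-1 by rewrite lef_pV2 ?posrE// ler_nat ltnS leq_addl.
have ew n : 2 * e n < w.
  move: wN; rewrite ltr_pdivrMr// => wN; apply: (@le_lt_trans _ _ (2 * N.+1%:R^-1)).
    by rewrite ler_wpM2l.
  by rewrite ltr_pdivrMr// mulrC.
have ek n : e n < k.
  move: kN; rewrite ltr_pdivrMr// => kN; rewrite (le_lt_trans (eN n))//.
  by rewrite -[X in X < _]mul1r ltr_pdivrMr// mulrC.
have Uin n t x : t1 <= t <= t2 -> a t + e n <= x <= b t - e n -> U (x, t).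
  move=> tt xab; apply: slabU => //; move: xab (e0 n); clear; lra.
have Ua n t : t1 <= t <= t2 -> U (a t + e n, t).
  by move=> tt; apply: (Uin n _ _ tt); have := ew n; have := wab _ tt; lra.
have Ub n t : t1 <= t <= t2 -> U (b t - e n, t).
  by move=> tt; apply: (Uin n _ _ tt); have := ew n; have := wab _ tt; lra.
pose C' := C + 2 * Lam * C.
have C'0 : 0 <= C' by rewrite addr_ge0// !mulr_ge0.
pose r n t := C' * (rho (a t + e n, t) + rho (b t - e n, t)).
have cr n t : t1 <= t <= t2 -> {for t, continuous (r n)}.
  move=> tt; apply: cvgM; first exact: cvg_cst.
  apply: cvgD.
    have h : {for t, continuous (fun s : R => (a s + e n, s))}.
      exact: (cvg_pair (cvgD (ca t) (cvg_cst (e n))) (@cvg_id _ (nbhs t))).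
    exact: (@continuous_comp _ _ _ _ rho t h (crho _ (Ua n _ tt))).
  have h : {for t, continuous (fun s : R => (b s - e n, s))}.
    exact: (cvg_pair (cvgB (cb t) (cvg_cst (e n))) (@cvg_id _ (nbhs t))).
  exact: (@continuous_comp _ _ _ _ rho t h (crho _ (Ub n _ tt))).
have step n : \int[mu]_(x in `[a t2 + e n, b t2 - e n]) eta (x, t2) <=
    \int[mu]_(x in `[a t1 + e n, b t1 - e n]) eta (x, t1) +
    \int[mu]_(t in `[t1, t2]) r n t.
  apply: (@le_add_Rintegral_rate
    (fun t => \int[mu]_(x in `[a t + e n, b t - e n]) eta (x, t))) => //.
    exact: cr.
  move=> t tt dd dd0.
  have lip' s s' : t1 <= s <= t2 -> t1 <= s' <= t2 ->
      `|(a s + e n) - (a s' + e n)| <= Lam * `|s - s'| /\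
      `|(b s - e n) - (b s' - e n)| <= Lam * `|s - s'|.
    move=> ss ss'; have [] := lip _ _ ss ss'.
    have -> : (a s + e n) - (a s' + e n) = a s - a s' by ring.
    by have -> : (b s - e n) - (b s' - e n) = b s - b s' by ring.
  have abe : a t + e n < b t - e n by have := ew n; have := wab _ tt; lra.
  have [h h0 Fh] := growth_between_curves oU ceta cHx deta dH pde Lam0 lip' tt abe
    (Uin n t ^~ tt) dd0.
  exists h => // s s' t1s ss' s't2 sh s'h.
  apply: (le_trans (Fh s s' t1s ss' s't2 sh s'h)).
  rewrite lerD2l ler_wpM2r ?subr_ge0// lerD2r /r /C'.
  have [ea Ha] := bound _ (Ua n t tt) tt.
  have [eb Hb] := bound _ (Ub n t tt) tt.
  have := mulr_ge0 Lam0 (_ : 0 <= C * rho (a t + e n, t) - `|eta (a t + e n, t)|).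
  have := mulr_ge0 Lam0 (_ : 0 <= C * rho (b t - e n, t) - `|eta (b t - e n, t)|).
  rewrite !subr_ge0 => /(_ eb) A /(_ ea) B; lra.
have lim : (fun n => \int[mu]_(t in `[t1, t2]) (r n t)%:E)%E @ \oo --> 0%E.
  have e_cvg : e n @[n --> \oo] --> (0 : R).
    by rewrite (cvg_shiftn N (@harmonic R)); exact: cvg_harmonic.
  have M0 : 0 <= M.
    have t1t : t1 <= t1 <= t2 by rewrite lexx.
    by have /andP[] := rhoM _ (Ua 0%N _ t1t); exact: le_trans.
  have rM n t : t1 <= t <= t2 -> `|r n t| <= C' * (M + M).
    move=> tt; have /andP[a0 aM] := rhoM _ (Ua n t tt).
    have /andP[b0 bM] := rhoM _ (Ub n t tt).
    rewrite /r ger0_norm; first by apply: ler_wpM2l => //; exact: lerD.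
    by apply: mulr_ge0 => //; exact: addr_ge0.
  have mr n : measurable_fun `[t1, t2] (EFin \o r n).
    apply/measurable_EFinP.
    apply: (@subspace_continuous_measurable_fun _ _ (r n)) => //.
    exact: (continuous_at_within (cr n)).
  have r0 : {ae mu, forall t, `[t1, t2]%classic t -> (EFin \o r n) t @[n --> \oo] --> cst 0%E t}.
    apply: (@filterS2 _ _ (ae_filter_ringOfSetsType mu) _ _ _ _ aea aeb) => t la lb _.
    apply: cvg_EFin; first exact: nearW.
    have -> : (0 : R) = C' * (0 + 0) by rewrite addr0 mulr0.
    apply: cvgM; first exact: cvg_cst.
    apply: cvgD.
      have ae : a t + e n @[n --> \oo] --> a t.
        by rewrite -[X in _ --> X]addr0; apply: cvgD => //; exact: cvg_cst.
      exact: cvg_comp (cvg_pair ae (cvg_cst t)) la.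
    have be : b t - e n @[n --> \oo] --> b t.
      by rewrite -[X in _ --> X]subr0; apply: cvgB => //; exact: cvg_cst.
    exact: cvg_comp (cvg_pair be (cvg_cst t)) lb.
  have iM : mu.-integrable `[t1, t2] (cst (C' * (M + M))%:E).
    by apply: (@integrable_continuous_at R (cst (C' * (M + M)))) => x _; exact: cvg_cst.
  have rM' : {ae mu, forall t n, `[t1, t2]%classic t ->
      (`|(EFin \o r n) t| <= cst (C' * (M + M))%:E t)%E}.
    by apply: aeW => t n; rewrite /= in_itv/= => tt; rewrite lee_fin; exact: rM.
  have [_ _] := @dominated_convergence _ _ R mu `[t1, t2]%classic (measurable_itv _)
    (fun n => EFin \o r n) (cst 0%E) _ mr (measurable_cst _) r0 iM rM'.
  by rewrite integral0.
have /fine_cvg/cvgrPdist_lt/(_ d d0)[n0 _ /(_ n0 (leqnn n0))/= rd] := lim.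
exists (e n0); split => //; apply: (le_trans (step n0)); rewrite lerD2l.
rewrite distrC subr0 in rd.
by rewrite ltW// (le_lt_trans (ler_norm _)).
Unshelve. all: by end_near. Qed.

End vacuum_edges.

(** * Entropies relative to a Burgers field *)

Section relative_entropies.
Context {R : realType}.
Implicit Types (f fx ft : R * R -> R) (U : set (R * R)).

(** Continuity together with continuous derivatives along the two axes: the
integrations by parts below take place on horizontal and vertical segments
only. *)
Record slicewise_C1 U f fx ft : Prop := SlicewiseC1 {
  sc1_cont : forall p, U p -> {for p, continuous f} ;
  sc1_contx : forall p, U p -> {for p, continuous fx} ;
  sc1_contt : forall p, U p -> {for p, continuous ft} ;
  sc1_x : forall p, U p -> is_derive p.1 1 (fun x => f (x, p.2)) (fx p) ;
  sc1_t : forall p, U p -> is_derive p.2 1 (fun t => f (p.1, t)) (ft p)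
}.

(** The Euler system in the unknowns rho, u and v = c / kappa, so that the Riemann
invariants are u - v and u + v.  The last field is the differentiated form of
the state law, which says that v is proportional to [rho `^ kappa]. *)
Record riemann_flow (kappa : R) U
    (rho rhox rhot u ux ut v vx vt : R * R -> R) : Prop := RiemannFlow {
  rf_rho : slicewise_C1 U rho rhox rhot ;
  rf_u : slicewise_C1 U u ux ut ;
  rf_v : slicewise_C1 U v vx vt ;
  rf_rho_gt0 : forall p, U p -> 0 < rho p ;
  rf_v_gt0 : forall p, U p -> 0 < v p ;
  rf_mass : forall p, U p -> rhot p + u p * rhox p + rho p * ux p = 0 ;
  rf_momentum : forall p, U p -> ut p + u p * ux p + kappa * v p * vx p = 0 ;
  rf_sound : forall p, U p -> vt p + u p * vx p + kappa * v p * ux p = 0 ;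
  rf_state : forall p, U p -> kappa * v p * rhox p = rho p * vx p
}.

Section balance.
Variables (kappa beta al0 s0 : R) (U : set (R * R)).
Variables (rho rhox rhot u ux ut v vx vt : R * R -> R).
Hypothesis kappa_gt0 : 0 < kappa.
Hypothesis F : riemann_flow kappa U rho rhox rhot u ux ut v vx vt.

(** The field [burgers] is the solution of the Burgers equation with affine
initial datum al0 + s0 x; it is constant in space and time for s0 = 0, and for
al0 = 0, s0 = 1 it is the self-similar velocity x / (1 + t), regular for
t > -1.  Where the flow is close to it, the gas expands by the factor
[dilation], and the powers of [rescaling] compensate the expected decay of
the relative velocity and of the sound speed. *)
Definition dilation (t : R) : R := 1 + s0 * t.
Definition burgers (p : R * R) : R := (al0 + s0 * p.1) / dilation p.2.
Definition rescaling (t : R) : R := dilation t `^ beta.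
Definition relative_velocity (p : R * R) : R := u p - burgers p.

Definition entropy k (p : R * R) : R :=
  rescaling p.2 ^+ k * rho p * moment kappa k (relative_velocity p) (v p).
Definition entropy_flux k (p : R * R) : R :=
  rescaling p.2 ^+ k * rho p *
    (u p * moment kappa k (relative_velocity p) (v p) +
     kappa * v p * tilted_moment kappa k (relative_velocity p) (v p)).

Definition entropy_t j (p : R * R) : R :=
  let k := j.+1 in
  let sig := s0 / dilation p.2 in
  let P := moment kappa j (relative_velocity p) (v p) in
  let S := tilted_moment kappa j (relative_velocity p) (v p) in
  rescaling p.2 ^+ k *
   ((k%:R * beta * sig * rho p + rhot p) * moment kappa k (relative_velocity p) (v p) +
    rho p * (k%:R * (P * (ut p + sig * burgers p) + S * vt p))).

Definition entropy_flux_x j (p : R * R) : R :=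
  let k := j.+1 in
  let sig := s0 / dilation p.2 in
  let P := moment kappa j (relative_velocity p) (v p) in
  let S := tilted_moment kappa j (relative_velocity p) (v p) in
  let Pk := moment kappa k (relative_velocity p) (v p) in
  let Sk := tilted_moment kappa k (relative_velocity p) (v p) in
  rescaling p.2 ^+ k *
   (rhox p * (u p * Pk + kappa * v p * Sk) +
    rho p * (ux p * Pk + u p * (k%:R * (P * (ux p - sig) + S * vx p)) +
      kappa * vx p * Sk +
      kappa * v p * (k%:R * (S * (ux p - sig) + P * vx p)
        - (1 + kappa) / kappa * (Sk / v p) * vx p))).

Lemma is_derive_burgers_x (x t : R) :
  is_derive x 1 (fun y => burgers (y, t)) (s0 / dilation t).
Proof.
rewrite /burgers/=; apply: is_derive_eq.
by rewrite /GRing.scale/=; ring.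
Qed.

Lemma is_derive_burgers_t (x t : R) : dilation t != 0 ->
  is_derive t 1 (fun s => burgers (x, s)) (- (s0 / dilation t * burgers (x, t))).
Proof.
move=> t0; have d : is_derive t 1 dilation s0.
  by rewrite /dilation; apply: is_derive_eq; rewrite /GRing.scale/=; ring.
rewrite /burgers/=; have := is_deriveV t0 d => dV.
by apply: is_derive_eq; rewrite /GRing.scale/=; field.
Qed.

Lemma is_derive_rescaling (t : R) : 0 < dilation t ->
  is_derive t 1 rescaling (beta * (s0 / dilation t) * rescaling t).
Proof.
move=> t0; have d : is_derive t 1 dilation s0.
  by rewrite /dilation; apply: is_derive_eq; rewrite /GRing.scale/=; ring.
have := is_derive1_powR beta t0 => dp.
apply: (is_derive_eq (is_derive1_comp dp d)).
rewrite powRB ?powRr1 ?(ltW t0)//; last by rewrite (gt_eqF t0) implybT.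
by rewrite /rescaling; field; rewrite gt_eqF.
Qed.

Lemma is_derive_relative_velocity_x p : U p -> is_derive p.1 1 (fun x => relative_velocity (x, p.2))
  (ux p - s0 / dilation p.2).
Proof.
move=> Up; have du := sc1_x (rf_u F) Up.
have db := is_derive_burgers_x p.1 p.2.
by rewrite /relative_velocity; apply: is_derive_eq.
Qed.

Lemma is_derive_relative_velocity_t p : U p -> dilation p.2 != 0 ->
  is_derive p.2 1 (fun t => relative_velocity (p.1, t))
  (ut p + s0 / dilation p.2 * burgers p).
Proof.
move=> Up p0; have du := sc1_t (rf_u F) Up.
have db := is_derive_burgers_t p.1 p0.
by rewrite /relative_velocity; apply: is_derive_eq; rewrite opprK; case: p {Up p0 du db}.
Qed.

Lemma is_derive_entropy_t j p : U p -> 0 < dilation p.2 ->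
  is_derive p.2 1 (fun t => entropy j.+1 (p.1, t)) (entropy_t j p).
Proof.
case: p => x t Up /= t0; have dU := is_derive_relative_velocity_t Up (lt0r_neq0 t0).
have dv := sc1_t (rf_v F) Up; have dr := sc1_t (rf_rho F) Up.
have v0 : 0 < v (x, t) by exact: rf_v_gt0 F _ Up.
have [dP _] := is_derive_moments kappa_gt0 j v0 dU dv.
have := is_deriveX j.+1 (is_derive_rescaling t0); rewrite exprfctE => dz.
rewrite /= in dP dr dz *; rewrite /entropy/=; apply: is_derive_eq.
rewrite /entropy_t/= /GRing.scale/=. rewrite exprS.
by move: (moment _ _ _ _) (moment _ _ _ _) (tilted_moment _ _ _ _) => a1 a2 a3; ring.
Qed.

Lemma is_derive_entropy_flux_x j p : U p -> is_derive p.1 1 (fun x => entropy_flux j.+1 (x, p.2))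
  (entropy_flux_x j p).
Proof.
case: p => x t Up /=; have dU := is_derive_relative_velocity_x Up.
have dv := sc1_x (rf_v F) Up; have dr := sc1_x (rf_rho F) Up.
have du := sc1_x (rf_u F) Up.
have v0 : 0 < v (x, t) by exact: rf_v_gt0 F _ Up.
have [dP dS] := is_derive_moments kappa_gt0 j v0 dU dv.
rewrite /= in dP dS dr du dv *; rewrite /entropy_flux/=; apply: is_derive_eq.
rewrite /entropy_flux_x/= /GRing.scale/=.
by ring.
Qed.

(** Each moment times rho is an entropy of the Euler system, and passing from u to
u - burgers costs only the right-hand side below.  For k = j + 1 even it has
the sign of - s0 as soon as beta is at most 1 and at most kappa, since both
moments in it are then nonnegative.  For s0 = 0 it vanishes. *)
Lemma entropy_balance j p : U p -> 0 < dilation p.2 ->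
  entropy_t j p + entropy_flux_x j p =
  - (s0 / dilation p.2) * (rescaling p.2 ^+ j.+1 * rho p * j.+1%:R *
     ((1 - beta) * (relative_velocity p * moment kappa j (relative_velocity p) (v p)) +
      (kappa - beta) * (v p * tilted_moment kappa j (relative_velocity p) (v p)))).
Proof.
move=> Up p0; rewrite /entropy_t /entropy_flux_x.
have k0 : kappa != 0 by rewrite gt_eqF.
have v0 : v p != 0 by rewrite gt_eqF// (rf_v_gt0 F Up).
have e1 := rf_mass F Up; have e2 := rf_momentum F Up.
have e3 := rf_sound F Up; have e4 := rf_state F Up.
have r1 : rhot p = - (u p * rhox p + rho p * ux p) by lra.
have r2 : ut p = - (u p * ux p + kappa * v p * vx p) by lra.
have r3 : vt p = - (u p * vx p + kappa * v p * ux p) by lra.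
have r4 : rhox p = rho p * vx p / (kappa * v p).
  by rewrite -e4; field; rewrite k0 v0.
have bE : burgers p = u p - relative_velocity p by rewrite /relative_velocity; ring.
rewrite bE r1 r2 r3 r4 momentS.
move: (moment _ _ _ _) (tilted_moment _ _ _ _) (tilted_moment _ j _ _) => a1 a2 a3.
by field; rewrite ?k0 ?v0 ?gt_eqF.
Qed.

End balance.
End relative_entropies.

(** * A maximum principle valid in both time directions *)

Section vacuum_flows.
Context {R : realType}.
Notation mu := (@lebesgue_measure R).

(** What the maximum principle consumes of an admissible shock-free flow.  That
nothing leaves through the edges is encoded by the vanishing of rho there for
almost every time. *)
Record vacuum_flow (kappa : R) (a b : R -> R)
    (rho rhox rhot u ux ut v vx vt : R * R -> R) (M : R) : Prop := VacuumFlow {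
  vf_flow : riemann_flow kappa (flow_domain a b) rho rhox rhot u ux ut v vx vt ;
  vf_cont_left : continuous a ;
  vf_cont_right : continuous b ;
  vf_nonempty : forall t, a t < b t ;
  vf_lipschitz : forall t1 t2, exists2 Lam, 0 <= Lam &
    forall s s', t1 <= s <= t2 -> t1 <= s' <= t2 ->
      `|a s - a s'| <= Lam * `|s - s'| /\ `|b s - b s'| <= Lam * `|s - s'| ;
  vf_bounded : forall p, flow_domain a b p -> [/\ rho p <= M, `|u p| <= M & v p <= M] ;
  vf_vacuum_left : {ae mu, forall t, rho p @[p --> (a t, t)] --> (0 : R)} ;
  vf_vacuum_right : {ae mu, forall t, rho p @[p --> (b t, t)] --> (0 : R)}
}.

Lemma cvg_comp_expr {T} (F : set_system T) {FF : Filter F} (f : T -> R) (x : R) k :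
  f @ F --> x -> (fun z => f z ^+ k) @ F --> x ^+ k.
Proof.
move=> fx; elim: k => [|k IH]; first by under eq_fun do rewrite expr0; exact: cvg_cst.
by under eq_fun do rewrite exprS; rewrite exprS; exact: cvgM.
Qed.

Lemma cvg_moments (kappa : R) {T} (F : set_system T) {FF : Filter F}
    (f g : T -> R) (x y : R) k :
  f @ F --> x -> g @ F --> y ->
  (fun z => moment kappa k (f z) (g z)) @ F --> moment kappa k x y /\
  (fun z => tilted_moment kappa k (f z) (g z)) @ F --> tilted_moment kappa k x y.
Proof.
move=> fx gy; elim: k => [|k [IP IS]].
  by rewrite moment0 tilted_moment0; split; exact: cvg_cst.
rewrite momentS tilted_momentS; split.
  under eq_fun do rewrite momentS.
  by apply: cvgD; exact: cvgM.
under eq_fun do rewrite tilted_momentS.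
by apply: cvgM; [exact: cvg_cst|apply: cvgD; exact: cvgM].
Qed.

Lemma open_flow_domain (a b : R -> R) : continuous a -> continuous b ->
  open (flow_domain a b).
Proof.
move=> ca cb.
have -> : flow_domain a b = [set p | 0 < p.1 - a p.2] `&` [set p | 0 < b p.2 - p.1].
  apply/seteqP; split=> p; rewrite /flow_domain/= !subr_gt0.
    by move=> /andP.
  by move=> /andP.
have c2 (f : R -> R) : continuous f -> continuous (fun p : R * R => f p.2).
  by move=> cf p; apply: continuous_comp; [exact: cvg_snd|exact: cf].
apply: openI; apply: open_comp (@open_gt R 0) => p _.
- by apply: cvgB; [exact: cvg_fst|exact: c2].
- by apply: cvgB; [exact: c2|exact: cvg_fst].
Qed.

(** The constants in front of the powers do not matter in the limit of large k,
which is how bounds on all moments become a bound on the supremum. *)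
Lemma le_of_powers_le (c C x y : R) : 0 < c -> 0 <= x -> 0 <= y ->
  (forall k, c * y ^+ k.+1 <= C * x ^+ k.+1) -> y <= x.
Proof.
move=> c0 x0 y0 h; rewrite leNgt; apply/negP => xy.
have y_gt0 : 0 < y by exact: le_lt_trans xy.
have q1 : `|x / y| < 1 by rewrite ger0_norm ?divr_ge0// ltr_pdivrMr// mul1r.
have : (fun k => C * (x / y) ^+ k) @ \oo --> C * 0.
  by apply: cvgM; [exact: cvg_cst|exact: cvg_expr].
rewrite mulr0 => /cvgrPdist_lt/(_ c c0)[n _ /(_ n.+1 (leqnSn n))/=].
rewrite sub0r normrN; apply/negP; rewrite -leNgt (le_trans _ (ler_norm _))//.
by rewrite expr_div_n mulrA ler_pdivlMr// exprn_gt0.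
Qed.

End vacuum_flows.

Section entropy_regularity.
Context {R : realType}.
Variables (kappa : R) (a b : R -> R).
Variables (rho rhox rhot u ux ut v vx vt : R * R -> R) (M : R).
Hypothesis kappa_gt0 : 0 < kappa.
Hypothesis V : vacuum_flow kappa a b rho rhox rhot u ux ut v vx vt M.
Variables (beta al0 s0 : R).
Hypothesis beta_ge0 : 0 <= beta.

Local Notation dil := (dilation s0).
Local Notation resc := (rescaling beta s0).
Local Notation rel := (relative_velocity al0 s0 u).
Local Notation Omega := (flow_domain a b).
Local Notation entk := (entropy kappa beta al0 s0 rho u v).
Local Notation fluxk := (entropy_flux kappa beta al0 s0 rho u v).
Local Notation F := (vf_flow V).

Lemma continuous_dilation (p : R * R) : dil q.2 @[q --> p] --> dil p.2.
Proof.
by apply: cvgD; [exact: cvg_cst|apply: cvgM; [exact: cvg_cst|exact: cvg_snd]].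
Qed.

Lemma continuous_rescaling (p : R * R) : 0 < dil p.2 ->
  resc q.2 @[q --> p] --> resc p.2.
Proof.
move=> p0; apply: (@continuous_comp _ _ _ snd resc p); first exact: cvg_snd.
exact: is_derive_continuous (is_derive_rescaling beta p0).
Qed.

Lemma continuous_relative_velocity p : Omega p -> 0 < dil p.2 -> {for p, continuous rel}.
Proof.
move=> Op p0; apply: cvgB; first exact: sc1_cont (rf_u F) _ Op.
apply: cvgM; last by apply: cvgV; [rewrite gt_eqF|exact: continuous_dilation].
apply: cvgD; first exact: cvg_cst.
by apply: cvgM; [exact: cvg_cst|exact: cvg_fst].
Qed.

Lemma continuous_moments k p : Omega p -> 0 < dil p.2 ->
  moment kappa k (rel q) (v q) @[q --> p] --> moment kappa k (rel p) (v p) /\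
  tilted_moment kappa k (rel q) (v q) @[q --> p] --> tilted_moment kappa k (rel p) (v p).
Proof.
move=> Op p0; apply: cvg_moments; first exact: continuous_relative_velocity.
exact: sc1_cont (rf_v F) _ Op.
Qed.

Lemma continuous_entropy k p : Omega p -> 0 < dil p.2 -> {for p, continuous (entk k)}.
Proof.
move=> Op p0; have [cP cS] := continuous_moments k Op p0.
apply: cvgM => //; apply: cvgM; last exact: sc1_cont (rf_rho F) _ Op.
by apply: cvg_comp_expr; exact: continuous_rescaling.
Qed.

Lemma continuous_entropy_flux_x j p : Omega p -> 0 < dil p.2 ->
  {for p, continuous (entropy_flux_x kappa beta al0 s0 rho rhox u ux v vx j)}.
Proof.
move=> Op p0; have [cP cS] := continuous_moments j.+1 Op p0.
have [cPj cSj] := continuous_moments j Op p0.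
have cu := sc1_cont (rf_u F) Op; have cv := sc1_cont (rf_v F) Op.
have cr := sc1_cont (rf_rho F) Op; have crx := sc1_contx (rf_rho F) Op.
have cux := sc1_contx (rf_u F) Op; have cvx := sc1_contx (rf_v F) Op.
have cz : (resc q.2 ^+ j.+1) @[q --> p] --> resc p.2 ^+ j.+1.
  by apply: cvg_comp_expr; exact: continuous_rescaling.
have cd : (s0 / dil q.2) @[q --> p] --> s0 / dil p.2.
  apply: cvgM; first exact: cvg_cst.
  by apply: cvgV; [rewrite gt_eqF|exact: continuous_dilation].
have v0 : v p != 0 by rewrite gt_eqF// (rf_v_gt0 F Op).
have civ : (v q)^-1 @[q --> p] --> (v p)^-1 by exact: cvgV.
have pF : Filter (nbhs p) by exact: nbhs_filter.
have cM f g c d := @cvgM R (R * R)%type (nbhs p) pF f g c d.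
have cD f g c d := @cvgD R R^o (R * R)%type (nbhs p) pF f g c d.
have cB f g c d := @cvgB R R^o (R * R)%type (nbhs p) pF f g c d.
have cC (c : R) : (fun _ : R * R => c) @ p --> c by exact: cvg_cst.
have c1 := cM _ _ _ _ crx (cD _ _ _ _ (cM _ _ _ _ cu cP) (cM _ _ _ _ (cM _ _ _ _ (cC kappa) cv) cS)).
have cg := cB _ _ _ _ cux cd.
have c2 := cM _ _ _ _ (cC j.+1%:R) (cD _ _ _ _ (cM _ _ _ _ cPj cg) (cM _ _ _ _ cSj cvx)).
have c3 := cM _ _ _ _ (cC j.+1%:R) (cD _ _ _ _ (cM _ _ _ _ cSj cg) (cM _ _ _ _ cPj cvx)).
have c4 := cM _ _ _ _ (cM _ _ _ _ (cC kappa) cv)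
  (cB _ _ _ _ c3 (cM _ _ _ _ (cM _ _ _ _ (cC ((1 + kappa) / kappa)) (cM _ _ _ _ cS civ)) cvx)).
exact: cM _ _ _ _ cz (cD _ _ _ _ c1 (cM _ _ _ _ cr (cD _ _ _ _ (cD _ _ _ _ (cD _ _ _ _ (cM _ _ _ _ cux cP) (cM _ _ _ _ cu c2))
  (cM _ _ _ _ (cM _ _ _ _ (cC kappa) cvx) cS)) c4))).
Qed.

Lemma dilation_between t1 t2 t : t1 <= t <= t2 ->
  Num.min (dil t1) (dil t2) <= dil t <= Num.max (dil t1) (dil t2).
Proof.
rewrite /dilation ge_min le_max => /andP[t1t tt2].
have [s|/ltW s] := leP 0 s0; apply/andP; split; apply/orP.
- by left; rewrite lerD2l ler_wpM2l.
- by right; rewrite lerD2l ler_wpM2l.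
- by right; rewrite lerD2l ler_wnM2l.
- by left; rewrite lerD2l ler_wnM2l.
Qed.

(** The factor multiplying rho in the entropy and in its flux is bounded on a time
slab where the Burgers field is defined. *)
Lemma entropy_dominated k t1 t2 : 0 < dil t1 -> 0 < dil t2 -> t1 <= t2 ->
  exists2 C, 0 <= C & forall p, Omega p -> t1 <= p.2 <= t2 ->
    `|entk k p| <= C * rho p /\ `|fluxk k p| <= C * rho p.
Proof.
move=> d1 d2 t12; have [Lam Lam0 lip] := vf_lipschitz V t1 t2.
have t1t : t1 <= t1 <= t2 by rewrite lexx.
pose X := `|a t1| + `|b t1| + Lam * (t2 - t1).
have xX p : Omega p -> t1 <= p.2 <= t2 -> `|p.1| <= X.
  move=> /andP[ap pb] p12; have [la lb] := lip _ _ p12 t1t.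
  have tt : `|p.2 - t1| <= t2 - t1.
    by rewrite ger0_norm ?subr_ge0 ?lerD2r; case/andP: p12.
  have {}tt := ler_wpM2l Lam0 tt.
  have := le_trans la tt; have := le_trans lb tt.
  rewrite /X !ler_norml => /andP[b1 b2] /andP[a1 a2].
  have := ler_norm (a t1); have := ler_norm (- a t1); rewrite normrN.
  have := ler_norm (b t1); have := ler_norm (- b t1); rewrite normrN.
  move: b1 b2 a1 a2 ap pb; move: (`|a t1|) (`|b t1|) (Lam * _) (a _) (b _) (a _) (b _).
  by move=> *; lra.
pose m := Num.min (dil t1) (dil t2); pose D := Num.max (dil t1) (dil t2).
have m0 : 0 < m by rewrite lt_min d1.
pose A := (`|al0| + `|s0| * X) / m.
pose Z := (D `^ beta) ^+ k * (M + A + M) ^+ k.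
have M0 : 0 <= M.
  have [c /(vf_bounded V)[_ + _]] : exists p, Omega p.
    exists ((a t1 + b t1) / 2, t1); by rewrite /flow_domain/= !midf_lt// (vf_nonempty V).
  exact: le_trans.
have Zb p : Omega p -> t1 <= p.2 <= t2 ->
    resc p.2 ^+ k * (`|rel p| + v p) ^+ k <= Z /\ 0 <= resc p.2 /\ 0 <= v p.
  move=> Op p12; have /andP[mp pD] := dilation_between p12.
  have p0 := lt_le_trans m0 mp.
  have [rM uM vM] := vf_bounded V Op.
  have v0 : 0 <= v p by rewrite ltW// (rf_v_gt0 F Op).
  split; last by rewrite /rescaling powR_ge0.
  apply: ler_pM; rewrite ?exprn_ge0 ?addr_ge0 ?powR_ge0//.
    rewrite lerXn2r// ?nnegrE ?powR_ge0//.
    by rewrite /rescaling ge0_ler_powR// nnegrE ltW// (lt_le_trans p0).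
  have Ab : `|burgers al0 s0 p| <= A.
    rewrite /burgers /A normrM normfV (gtr0_norm p0).
    apply: ler_pM => //; first by rewrite invr_ge0 ltW.
      rewrite (le_trans (ler_normD _ _))// lerD2l normrM ler_wpM2l//.
      exact: xX.
    by rewrite lef_pV2.
  rewrite lerXn2r ?nnegrE ?addr_ge0//; first by rewrite (le_trans _ Ab).
  by rewrite lerD// (le_trans (ler_normB _ _))// lerD.
have Z0 : 0 <= Z.
  have Op : Omega ((a t1 + b t1) / 2, t1).
    by rewrite /flow_domain/= !midf_lt// (vf_nonempty V).
  have [h [h1 h2]] := Zb _ Op t1t; apply: le_trans h.
  by rewrite mulr_ge0// exprn_ge0// addr_ge0.
exists (Z * (1 + M + kappa * M)).
  by rewrite mulr_ge0// !addr_ge0// mulr_ge0// ltW.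
move=> p Op p12; have [Zp [r0 v0]] := Zb p Op p12.
have [nP nS] := ler_norm_moments kappa_gt0 k (rel p) v0.
have [rM uM vM] := vf_bounded V Op.
have rho0 := ltW (rf_rho_gt0 F Op).
have rk0 : 0 <= resc p.2 ^+ k by rewrite exprn_ge0.
have kM : 0 <= kappa * M by rewrite mulr_ge0// ltW.
have KM : 1 <= 1 + M + kappa * M by rewrite -addrA lerDl addr_ge0.
split.
  rewrite /entropy !normrM (ger0_norm rk0) (ger0_norm rho0) mulrAC ler_wpM2r//.
  rewrite (le_trans (ler_wpM2l rk0 nP))// (le_trans Zp)// ler_peMr//.
rewrite /entropy_flux !normrM (ger0_norm rk0) (ger0_norm rho0) mulrAC ler_wpM2r//.
have nn : `|u p * moment kappa k (rel p) (v p) + kappa * v p * tilted_moment kappa k (rel p) (v p)|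
    <= (M + kappa * M) * (`|rel p| + v p) ^+ k.
  rewrite (le_trans (ler_normD _ _))// !normrM mulrDl lerD// ler_pM//.
  by rewrite (gtr0_norm kappa_gt0) (ger0_norm v0) ler_wpM2l// ltW.
apply: (le_trans (ler_wpM2l rk0 nn)); rewrite mulrCA.
apply: (le_trans (ler_wpM2l (addr_ge0 M0 kM) Zp)).
by rewrite mulrC; apply: ler_wpM2l => //; rewrite -addrA lerDr.
Qed.

End entropy_regularity.

Section total_entropies.
Context {R : realType}.
Notation mu := (@lebesgue_measure R).
Variables (kappa : R) (a b : R -> R).
Variables (rho rhox rhot u ux ut v vx vt : R * R -> R) (M : R).
Hypothesis kappa_gt0 : 0 < kappa.
Hypothesis V : vacuum_flow kappa a b rho rhox rhot u ux ut v vx vt M.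
Variables (beta al0 s0 : R).
Hypotheses (beta_ge0 : 0 <= beta) (beta1 : beta <= 1) (beta_kappa : beta <= kappa).

Local Notation dil := (dilation s0).
Local Notation resc := (rescaling beta s0).
Local Notation rel := (relative_velocity al0 s0 u).
Local Notation Omega := (flow_domain a b).
Local Notation entk := (entropy kappa beta al0 s0 rho u v).
Local Notation fluxk := (entropy_flux kappa beta al0 s0 rho u v).
Local Notation F := (vf_flow V).

(** The sign s makes one statement out of both monotonicities: the entropy
increases in time when s0 <= 0. *)
Lemma signed_entropy_decay (s : R) j t1 t2 : s = 1 \/ s = -1 -> 0 <= s * s0 ->
    0 < dil t1 -> 0 < dil t2 -> odd j -> t1 <= t2 ->
  forall d k, 0 < d -> 0 < k -> exists e, [/\ 0 < e, e < k &
    s * \int[mu]_(x in `[a t2 + e, b t2 - e]) entk j.+1 (x, t2) <=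
    s * \int[mu]_(x in `[a t1 + e, b t1 - e]) entk j.+1 (x, t1) + d].
Proof.
move=> s1 ss0 d1 d2 oddj t12 d k d0 k0.
pose U := Omega `&` [set p | 0 < dil p.2].
have oU : open U.
  apply: openI; first exact: open_flow_domain (vf_cont_left V) (vf_cont_right V).
  apply: open_comp (@open_gt R 0) => p _; exact: continuous_dilation.
have slabU x t : t1 <= t <= t2 -> a t < x < b t -> U (x, t).
  move=> t12' xab; split => //=.
  have /andP[+ _] := dilation_between s0 t12'.
  by apply: lt_le_trans; rewrite lt_min d1.
have [C C0 dom] := entropy_dominated kappa_gt0 V al0 beta_ge0 j.+1 d1 d2 t12.
have [Lam Lam0 lip] := vf_lipschitz V t1 t2.
have ns : `|s| = 1 by case: s1 => ->; rewrite ?normrN normr1.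
have dsm (f : R -> R) (x l : R) : is_derive x 1 f l -> is_derive x 1 (fun y => s * f y) (s * l).
  by move=> fl; apply: is_derive_eq; rewrite /GRing.scale/=; ring.
have rhoM p : U p -> 0 <= rho p <= M.
  move=> [Op _]; rewrite ltW ?(rf_rho_gt0 F Op)//.
  by have [] := vf_bounded V Op.
have balance p : U p ->
    s * entropy_t kappa beta al0 s0 rho rhot u ut v vt j p +
    s * entropy_flux_x kappa beta al0 s0 rho rhox u ux v vx j p <= 0.
  move=> [Op p0]; rewrite -mulrDr (entropy_balance beta al0 kappa_gt0 F j Op p0).
  rewrite mulNr mulrN oppr_le0 mulrA mulr_ge0//.
    by rewrite mulrA mulr_ge0// invr_ge0 ltW.
  have v0 := ltW (rf_v_gt0 F Op).
  rewrite mulr_ge0//.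
    rewrite !mulr_ge0// ?exprn_ge0 ?powR_ge0//.
    exact: ltW (rf_rho_gt0 F Op).
  rewrite addr_ge0// mulr_ge0 ?subr_ge0//; first exact: moment_mull_ge0.
  by rewrite mulr_ge0// tilted_moment_ge0.
have sdom p : U p -> t1 <= p.2 <= t2 ->
    `|s * entk j.+1 p| <= C * rho p /\ `|s * fluxk j.+1 p| <= C * rho p.
  move=> [Op _] p12; have [h1 h2] := dom p Op p12.
  by split; rewrite normrM ns mul1r.
have cent p : U p -> {for p, continuous (fun q => s * entk j.+1 q)}.
  by move=> [Op p0]; apply: cvgM; [exact: cvg_cst|exact: (continuous_entropy V)].
have cflux p : U p -> {for p, continuous (fun q =>
    s * entropy_flux_x kappa beta al0 s0 rho rhox u ux v vx j q)}.
  by move=> [Op p0]; apply: cvgM; [exact: cvg_cst|exact: (continuous_entropy_flux_x V)].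
have dent p : U p -> is_derive p.2 1 (fun t => s * entk j.+1 (p.1, t))
    (s * entropy_t kappa beta al0 s0 rho rhot u ut v vt j p).
  by move=> [Op p0]; apply: dsm; exact: (is_derive_entropy_t _ _ kappa_gt0 F).
have dflux p : U p -> is_derive p.1 1 (fun x => s * fluxk j.+1 (x, p.2))
    (s * entropy_flux_x kappa beta al0 s0 rho rhox u ux v vx j p).
  by move=> [Op p0]; apply: dsm; exact: (is_derive_entropy_flux_x _ _ _ kappa_gt0 F).
have [e [e0 ek]] := @near_decay_between_vacuum_edges R a b rho
  (fun p => s * entk j.+1 p) (fun p => s * fluxk j.+1 p)
  (fun p => s * entropy_t kappa beta al0 s0 rho rhot u ut v vt j p)
  (fun p => s * entropy_flux_x kappa beta al0 s0 rho rhox u ux v vx j p)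
  t1 t2 Lam C M U oU slabU (vf_cont_left V) (vf_cont_right V) (vf_nonempty V)
  (fun p Up => sc1_cont (rf_rho F) Up.1) rhoM (vf_vacuum_left V) (vf_vacuum_right V)
  cent cflux dent dflux
  balance Lam0 C0 lip
  sdom
  t12 d k d0 k0.
have int t : 0 < dil t -> mu.-integrable `[a t + e, b t - e] (EFin \o (fun x => entk j.+1 (x, t))).
  move=> t0; apply: integrable_continuous_at => x /andP[x1 x2].
  apply: continuous_slice_x; apply: (continuous_entropy V) => //.
  by rewrite /flow_domain/= (lt_le_trans _ x1) ?ltrDl// (le_lt_trans x2)// gtrBl.
by rewrite !RintegralZl//; [exists e | exact: int | exact: int].
Qed.

(** Seen from a reference time t', the totals decrease towards the future when
s0 >= 0 and towards the past when s0 <= 0, so they are bounded by their value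
at t'.  For s0 = 0 both directions are allowed: shock-free flows are
reversible. *)
Lemma entropy_decay j t' t B l m : odd j ->
    0 < dil t' -> 0 < dil t -> (t' <= t /\ 0 <= s0) \/ (t <= t' /\ s0 <= 0) ->
    (forall x, a t' < x < b t' -> resc t' * (`|rel (x, t')| + v (x, t')) <= B) ->
    a t < l -> l <= m -> m < b t ->
  \int[mu]_(x in `[l, m]) entk j.+1 (x, t) <= M * (b t' - a t') * B ^+ j.+1.
Proof.
move=> oddj d' d order bB al lm mb.
have w0 : 0 < b t' - a t' by rewrite subr_gt0 (vf_nonempty V).
apply/ler_addgt0Pr => eps eps0.
pose k := Num.min ((b t' - a t') / 2) (Num.min (l - a t) (b t - m)).
have k0 : 0 < k by rewrite !lt_min divr_gt0// !subr_gt0 al.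
have [e [e0 ek dec]] : exists e, [/\ 0 < e, e < k &
    \int[mu]_(x in `[a t + e, b t - e]) entk j.+1 (x, t) <=
    \int[mu]_(x in `[a t' + e, b t' - e]) entk j.+1 (x, t') + eps].
  case: order => -[tt ss].
    have [|e [e0 ek h]] := @signed_entropy_decay 1 j t' t (or_introl erefl) _ d' d oddj tt eps k eps0 k0.
      by rewrite mul1r.
    by exists e; split => //; rewrite !mul1r in h.
  have [|e [e0 ek h]] := @signed_entropy_decay (-1) j t t' (or_intror erefl) _ d d' oddj tt eps k eps0 k0.
    by rewrite mulN1r oppr_ge0.
  by exists e; split => //; rewrite !mulN1r in h; lra.
move: ek; rewrite /k !lt_min => /andP[ew /andP[el em]].
have in_slice s x : a s + e <= x <= b s - e -> Omega (x, s).
  move=> /andP[x1 x2]; rewrite /flow_domain/= (lt_le_trans _ x1) ?ltrDl//.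
  by rewrite (le_lt_trans x2)// gtrBl.
have cent s x : 0 < dil s -> a s + e <= x <= b s - e ->
    {for x, continuous (fun y => entk j.+1 (y, s))}.
  by move=> s1 xs; apply: continuous_slice_x; apply: (continuous_entropy V) => //; exact: in_slice.
have ent0 p : Omega p -> 0 <= entk j.+1 p.
  move=> Op; rewrite /entropy !mulr_ge0// ?exprn_ge0 ?powR_ge0//.
    exact: ltW (rf_rho_gt0 F Op).
  by apply: moment_ge0 => //=; [rewrite oddj|exact: ltW (rf_v_gt0 F Op)].
have sub : \int[mu]_(x in `[l, m]) entk j.+1 (x, t) <=
    \int[mu]_(x in `[a t + e, b t - e]) entk j.+1 (x, t).
  have i1 := integrable_continuous_at (cent t ^~ d).
  rewrite /Rintegral fine_le//.
  - apply: integrable_fin_num => //; apply: integrableS i1 => //.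
    by apply: subset_itv; rewrite bnd_simp; lra.
  - exact: integrable_fin_num.
  - apply: ge0_subset_integral => //=.
    + by case/integrableP: i1.
    + by move=> x; rewrite in_itv/= => xx; rewrite lee_fin ent0//; exact: in_slice.
    + by apply: subset_itv; rewrite bnd_simp; lra.
rewrite (le_trans sub)// (le_trans dec)// lerD2r.
have M0 : 0 <= M.
  have Op : Omega ((a t' + b t') / 2, t').
    by rewrite /flow_domain/= !midf_lt// (vf_nonempty V).
  by have [_ + _] := vf_bounded V Op; exact: le_trans.
have B0 : 0 <= B.
  have Op : a t' < (a t' + b t') / 2 < b t' by rewrite !midf_lt// (vf_nonempty V).
  apply: le_trans (bB _ Op); rewrite mulr_ge0 ?powR_ge0// addr_ge0//.
  exact: ltW (rf_v_gt0 F (Op : Omega (_, _))).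
have entB x : a t' + e <= x <= b t' - e -> entk j.+1 (x, t') <= M * B ^+ j.+1.
  move=> xx; have Op := in_slice _ _ xx; have [rM _ _] := vf_bounded V Op.
  have v0 := ltW (rf_v_gt0 F Op); have r0 := ltW (rf_rho_gt0 F Op).
  have [nP _] := ler_norm_moments kappa_gt0 j.+1 (rel (x, t')) v0.
  rewrite /entropy -mulrA mulrCA; apply: ler_pM => //.
    by rewrite mulr_ge0 ?exprn_ge0 ?powR_ge0// moment_ge0//= oddj.
  apply: (@le_trans _ _ (resc t' ^+ j.+1 * (`|rel (x, t')| + v (x, t')) ^+ j.+1)).
    by rewrite ler_wpM2l ?exprn_ge0 ?powR_ge0// (le_trans (ler_norm _)).
  rewrite -exprMn lerXn2r ?nnegrE//.
    by rewrite mulr_ge0 ?powR_ge0// addr_ge0.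
  by apply: bB; move: Op; rewrite /flow_domain.
have i2 := integrable_continuous_at (cent t' ^~ d').
apply: (@le_trans _ _ (\int[mu]_(x in `[a t' + e, b t' - e]) (M * B ^+ j.+1))).
  apply: le_Rintegral => //.
  - by apply: (@integrable_continuous_at R (cst (M * B ^+ j.+1))) => x _; exact: cvg_cst.
rewrite Rintegral_cst//= lebesgue_measure_itv/= lte_fin ifT; last by lra.
rewrite /= mulrAC; apply: ler_wpM2r; first exact: exprn_ge0.
by apply: ler_wpM2l => //; lra.
Qed.

End total_entropies.

Section maximum_principle.
Context {R : realType}.
Notation mu := (@lebesgue_measure R).
Variables (kappa : R) (a b : R -> R).
Variables (rho rhox rhot u ux ut v vx vt : R * R -> R) (M : R).
Hypothesis kappa_gt0 : 0 < kappa.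
Hypothesis V : vacuum_flow kappa a b rho rhox rhot u ux ut v vx vt M.
Variables (beta al0 s0 : R).
Hypotheses (beta_ge0 : 0 <= beta) (beta1 : beta <= 1) (beta_kappa : beta <= kappa).

Local Notation dil := (dilation s0).
Local Notation resc := (rescaling beta s0).
Local Notation rel := (relative_velocity al0 s0 u).
Local Notation Omega := (flow_domain a b).
Local Notation entk := (entropy kappa beta al0 s0 rho u v).
Local Notation F := (vf_flow V).

(** If g exceeded B^2 at x it would do so with a margin near x, where rho is
bounded below; the moments of order 2k would then grow faster than B^(2k). *)
Lemma le_of_moments (g : R -> R) (C B t x : R) : 0 < dil t -> 0 <= B ->
    a t < x < b t -> {for x, continuous g} ->
    (forall y m, a t < y < b t ->
      0 <= g y /\ rho (y, t) * g y ^+ m <= entk m.*2 (y, t)) ->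
    (forall l m k, a t < l -> l <= m -> m < b t ->
      \int[mu]_(y in `[l, m]) entk k.+1.*2 (y, t) <= C * B ^+ k.+1.*2) ->
  g x <= B ^+ 2.
Proof.
move=> t0 B0 xab cg lower upper; rewrite leNgt; apply/negP => Bg.
pose c := (B ^+ 2 + g x) / 2; have [Bc cgx] : B ^+ 2 < c /\ c < g x by rewrite /c !midf_lt.
have c0 : 0 <= c by rewrite ltW// (le_lt_trans _ Bc)// sqr_ge0.
have rx : 0 < rho (x, t) by exact: rf_rho_gt0 F (x, t) xab.
have cr : {for x, continuous (fun y => rho (y, t))}.
  by apply: continuous_slice_x; exact: sc1_cont (rf_rho F) _ (xab : Omega (x, t)).
have [xa xb] := andP xab.
have : \forall y \near x, [/\ c < g y, rho (x, t) / 2 < rho (y, t), a t < y & y < b t].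
  near=> y; split; near: y.
  - exact: (cvgr_gt (g x)).
  - apply: (cvgr_gt (rho (x, t))) => //.
    by rewrite ltr_pdivrMr// ltr_pMr// ltr1n.
  - exact: lt_nbhsr.
  - exact: lt_nbhsl.
move=> /nbhs_ballP[e /= e0 eP].
pose d := e / 2; have d0 : 0 < d by rewrite divr_gt0.
have nearP y : x - d <= y <= x + d ->
    [/\ c < g y, rho (x, t) / 2 < rho (y, t), a t < y & y < b t].
  by move=> yd; apply: eP; rewrite /ball/= ltr_norml; move: yd; rewrite /d; lra.
have xld : x - d <= x - d <= x + d by lra.
have xrd : x - d <= x + d <= x + d by lra.
have [_ _ la _] := nearP _ xld; have [_ _ _ rb] := nearP _ xrd.
suff : c <= B ^+ 2 by rewrite leNgt Bc.
apply: (@le_of_powers_le _ (rho (x, t) * d) C) => //.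
- exact: mulr_gt0.
- exact: sqr_ge0.
move=> k; rewrite -exprM mul2n.
apply: le_trans (upper (x - d) (x + d) k la _ rb); last by lra.
have ci : mu.-integrable `[x - d, x + d] (EFin \o (fun y => entk k.+1.*2 (y, t))).
  apply: integrable_continuous_at => y /nearP[_ _ ya yb].
  by apply: continuous_slice_x; apply: (continuous_entropy V) => //; rewrite /flow_domain/= ya.
apply: (@le_trans _ _ (\int[mu]_(y in `[x - d, x + d]) (rho (x, t) / 2 * c ^+ k.+1))).
  rewrite Rintegral_cst//= lebesgue_measure_itv/= lte_fin ifT; last by lra.
  rewrite /= le_eqVlt; apply/orP; left; apply/eqP.
  have -> : x + d - (x - d) = 2 * d by ring.
  by field.
apply: le_Rintegral => //.
- by apply: (@integrable_continuous_at R (cst (rho (x, t) / 2 * c ^+ k.+1))) => y _; exact: cvg_cst.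
- move=> y /=; rewrite in_itv/= => /nearP[cy ry ya yb].
  have [gy] := lower y k.+1 (introT andP (conj ya yb)); apply: le_trans.
  apply: ler_pM; [by rewrite divr_ge0// ltW|exact: exprn_ge0|exact: ltW|].
  by rewrite lerXn2r ?nnegrE// ltW.
Unshelve. all: by end_near. Qed.

(** The bounds of [moment_ge_velocity] and [moment_ge_sound] turn the decay of all
the even entropies into pointwise bounds of u - burgers and of v.  A
characteristic argument would give this for each Riemann invariant, but here
the edges, where hyperbolicity degenerates, need no tracking. *)
Lemma sup_principle t' t B :
    0 < dil t' -> 0 < dil t -> (t' <= t /\ 0 <= s0) \/ (t <= t' /\ s0 <= 0) ->
    (forall x, a t' < x < b t' -> resc t' * (`|rel (x, t')| + v (x, t')) <= B) ->
  forall x, a t < x < b t -> resc t * `|rel (x, t)| <= B /\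
    kappa / (1 + 2 * kappa) * (resc t * v (x, t)) ^+ 2 <= B ^+ 2.
Proof.
move=> d' d order bB x xab.
have B0 : 0 <= B.
  have Op : a t' < (a t' + b t') / 2 < b t' by rewrite !midf_lt// (vf_nonempty V).
  apply: le_trans (bB _ Op); rewrite mulr_ge0 ?powR_ge0// addr_ge0//.
  exact: ltW (rf_v_gt0 F (Op : Omega (_, _))).
have upper l m k : a t < l -> l <= m -> m < b t ->
    \int[mu]_(y in `[l, m]) entk k.+1.*2 (y, t) <= M * (b t' - a t') * B ^+ k.+1.*2.
  move=> al lm mb; rewrite doubleS.
  by apply: (entropy_decay kappa_gt0 V) => //=; rewrite odd_double.
have cU : {for x, continuous (fun y => rel (y, t))}.
  by apply: continuous_slice_x; exact: (continuous_relative_velocity V).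
have cv : {for x, continuous (fun y => v (y, t))}.
  by apply: continuous_slice_x; exact: sc1_cont (rf_v F) _ (xab : Omega (x, t)).
have k0 : 0 <= kappa / (1 + 2 * kappa).
  by rewrite divr_ge0 ?addr_ge0 ?mulr_ge0// ltW.
have entE y m : entk m.*2 (y, t) =
    rho (y, t) * ((resc t ^+ 2) ^+ m * moment kappa m.*2 (rel (y, t)) (v (y, t))).
  by rewrite /entropy -exprM mul2n /=; ring.
have z0 m : 0 <= (resc t ^+ 2) ^+ m by rewrite exprn_ge0// sqr_ge0.
split.
  rewrite -ler_sqr ?nnegrE ?mulr_ge0 ?powR_ge0//.
  apply: (@le_of_moments (fun y => (resc t * `|rel (y, t)|) ^+ 2) _ _ t x) upper => //.
    apply: cvg_comp_expr; apply: cvgM; first exact: cvg_cst.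
    exact: cvg_norm.
  move=> y m yab; split; first exact: sqr_ge0.
  have v0 := ltW (rf_v_gt0 F (yab : Omega (y, t))).
  rewrite entE ler_wpM2l//; first exact: ltW (rf_rho_gt0 F (yab : Omega (y, t))).
  rewrite (exprMn 2) real_normK ?num_real// (exprMn m (_ ^+ 2)) ler_wpM2l//.
  rewrite -exprM mul2n.
  by apply: moment_ge_velocity => //; rewrite odd_double.
apply: (@le_of_moments (fun y => kappa / (1 + 2 * kappa) * (resc t * v (y, t)) ^+ 2) _ _ t x) upper => //.
  apply: cvgM; first exact: cvg_cst.
  by apply: cvg_comp_expr; apply: cvgM; [exact: cvg_cst|].
move=> y m yab; split; first by rewrite mulr_ge0// sqr_ge0.
have v0 := ltW (rf_v_gt0 F (yab : Omega (y, t))).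
rewrite entE ler_wpM2l//; first exact: ltW (rf_rho_gt0 F (yab : Omega (y, t))).
rewrite (exprMn 2) mulrCA (exprMn m (_ ^+ 2)) ler_wpM2l//.
exact: moment_ge_sound.
Qed.

End maximum_principle.

(** * Dispersion and the range of the velocity *)

Section dispersion.
Context {R : realType}.
Variables (kappa : R) (a b : R -> R).
Variables (rho rhox rhot u ux ut v vx vt : R * R -> R) (M : R).
Hypothesis kappa_gt0 : 0 < kappa.
Hypothesis V : vacuum_flow kappa a b rho rhox rhot u ux ut v vx vt M.
Local Notation Omega := (flow_domain a b).
Local Notation F := (vf_flow V).

Lemma rescaling0 beta t : rescaling beta (0 : R) t = 1.
Proof. by rewrite /rescaling /dilation mul0r addr0 powR1. Qed.

Lemma relative_velocity0 al0 (p : R * R) : relative_velocity al0 0 u p = u p - al0.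
Proof. by rewrite /relative_velocity /burgers /dilation !mul0r !addr0 divr1. Qed.

(** With s0 = 0 and al0 = M, the distance of u to M is largest where u is smallest,
so the maximum principle transports lower bounds of u from the time t to any
other time, past or future; al0 = - M transports upper bounds.  The sound
speed enters the bound at time t and has to be small there. *)
Lemma velocity_range (lo hi : R) :
    (forall e, 0 < e -> exists t, forall x, a t < x < b t ->
      lo - e <= u (x, t) <= hi + e /\ v (x, t) <= e) ->
  forall p, Omega p -> lo <= u p <= hi.
Proof.
move=> late [x0 t0] Op.
have order t : (t <= t0 /\ 0 <= 0 :> R) \/ (t0 <= t /\ 0 <= 0 :> R).
  by have [|/ltW] := leP t t0; [left|right].
have d0 t : 0 < dilation (0 : R) t by rewrite /dilation mul0r addr0.
have uM p : Omega p -> - M <= u p <= M.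
  by move=> /(vf_bounded V)[_ + _]; rewrite ler_norml.
have sup al0 B t : (forall x, a t < x < b t -> `|u (x, t) - al0| + v (x, t) <= B) ->
    `|u (x0, t0) - al0| <= B.
  move=> tB.
  have [] := @sup_principle R kappa a b rho rhox rhot u ux ut v vx vt M kappa_gt0 V
    0 al0 0 (lexx 0) ler01 (ltW kappa_gt0) t t0 B (d0 t) (d0 t0) (order t) _ x0 Op.
    by move=> x xt; rewrite rescaling0 relative_velocity0 mul1r tB.
  by rewrite rescaling0 relative_velocity0 mul1r.
apply/andP; split.
  apply/ler_addgt0Pr => e e0.
  have e2 : 0 < e / 2 by rewrite divr_gt0.
  have [t tP] := late _ e2.
  have := sup M (M - lo + e) t; have := ler_norm (- (u (x0, t0) - M)); rewrite normrN.
  move=> n1 h; suff : `|u (x0, t0) - M| <= M - lo + e by move: n1; lra.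
  apply: h => x xt; have [ul vl] := tP x xt.
  rewrite ler0_norm; last by have := uM (x, t) xt; lra.
  by move: ul vl; lra.
apply/ler_addgt0Pr => e e0.
have e2 : 0 < e / 2 by rewrite divr_gt0.
have [t tP] := late _ e2.
have := sup (- M) (M + hi + e) t; have := ler_norm (u (x0, t0) - - M).
move=> n1 h; suff : `|u (x0, t0) - - M| <= M + hi + e by move: n1; lra.
apply: h => x xt; have [ul vl] := tP x xt.
rewrite ger0_norm; last by have := uM (x, t) xt; lra.
by move: ul vl; lra.
Qed.

(** Dispersion: with s0 = s = 1 or -1 and al0 = 0, the maximum principle started
at time 0 bounds the relative velocity and the sound speed by a constant over
(1 + s t)^beta, which tends to 0 for s t large.  The exponent
beta = min (1, kappa) is the largest one with a signed entropy production. *)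
Lemma late_velocity (s e : R) : s = 1 \/ s = -1 -> 0 < e ->
  exists T, forall t, 0 <= s * t -> T <= s * t -> forall x, a t < x < b t ->
    `|u (x, t) - s * x / (1 + s * t)| <= e /\ v (x, t) <= e.
Proof.
move=> s1 e0.
pose beta := Num.min 1 kappa.
have beta0 : 0 < beta by rewrite lt_min ltr01.
have beta1 : beta <= 1 by rewrite ge_min lexx.
have betak : beta <= kappa by rewrite ge_min lexx orbT.
(* A bound at time 0 of |u - s x| + v, where x lies between a 0 and b 0. *)
pose B := 2 * M + `|a 0| + `|b 0|.
have ns : `|s| = 1 by case: s1 => ->; rewrite ?normrN normr1.
have B00 x : a 0 < x < b 0 -> rescaling beta s 0 * (`|relative_velocity 0 s u (x, 0)| + v (x, 0)) <= B.
  move=> x0; rewrite /rescaling /relative_velocity /burgers /dilation/= mulr0 addr0 powR1 mul1r.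
  rewrite add0r divr1; have [_ uM vM] := vf_bounded V (x0 : Omega (x, 0)).
  have := ler_normB (u (x, 0)) (s * x); rewrite normrM ns mul1r => n1.
  have n2 : `|x| <= `|a 0| + `|b 0|.
    have := ler_norm (a 0); have := ler_norm (- a 0); rewrite normrN.
    have := ler_norm (b 0); have := ler_norm (- b 0); rewrite normrN.
    by rewrite ler_norml; move: x0; move: (`|a 0|) (`|b 0|) => A C; lra.
  by rewrite /B; move: uM vM n1 n2; move: (`|u _|) (`|x|) (`|_ - _|) => *; lra.
have B0 : 0 <= B.
  have Op : a 0 < (a 0 + b 0) / 2 < b 0 by rewrite !midf_lt// (vf_nonempty V).
  apply: le_trans (B00 _ Op); rewrite mulr_ge0 ?powR_ge0// addr_ge0//.
  exact: ltW (rf_v_gt0 F (Op : Omega (_, _))).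
have r0 : 0 < kappa / (1 + 2 * kappa) by apply: divr_gt0 => //; have := kappa_gt0; lra.
pose r := kappa / (1 + 2 * kappa).
(* Once the rescaling exceeds K, both bounds are below e; the factor 1 + 1/r
   absorbs the square root of r in the bound of v. *)
pose K := B / e * (1 + r^-1).
have ri : 0 < r^-1 by rewrite invr_gt0.
have K0 : 0 <= K.
  by apply: mulr_ge0; [exact: divr_ge0 (ltW e0)|exact: addr_ge0 (ltW ri)].
exists (K `^ beta^-1) => t st0 Tt x xab.
have d0 : 0 < dilation s 0 by rewrite /dilation mulr0 addr0.
have dt : 0 < dilation s t by rewrite /dilation ltr_wpDr.
have order : (0 <= t /\ 0 <= s) \/ (t <= 0 /\ s <= 0).
  case: s1 => sE; rewrite sE in st0 *.
    by left; rewrite mul1r in st0.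
  by right; rewrite mulN1r oppr_ge0 in st0; rewrite oppr_le0.
have [hu hv] := @sup_principle R kappa a b rho rhox rhot u ux ut v vx vt M kappa_gt0 V
  beta 0 s (ltW beta0) beta1 betak 0 t B d0 dt order B00 x xab.
have Kz : K <= rescaling beta s t.
  rewrite /rescaling /dilation.
  have -> : K = (K `^ beta^-1) `^ beta.
    by rewrite -powRrM mulVf ?gt_eqF// powRr1.
  rewrite ge0_ler_powR ?nnegrE ?powR_ge0 ?(ltW beta0)//; first by rewrite ltW.
  by rewrite (le_trans Tt)// lerDr.
have z0 : 0 < rescaling beta s t by rewrite /rescaling powR_gt0.
have Be : B <= rescaling beta s t * e.
  rewrite -ler_pdivrMr//; apply: le_trans Kz.
  by rewrite /K ler_peMr ?divr_ge0 ?(ltW e0)// lerDl ltW.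
split.
  have -> : u (x, t) - s * x / (1 + s * t) = relative_velocity 0 s u (x, t).
    by rewrite /relative_velocity /burgers /dilation/= add0r.
  by rewrite -(ler_pM2l z0) (le_trans hu).
have v0 := ltW (rf_v_gt0 F (xab : Omega (x, t))).
rewrite -(ler_pM2l z0) -ler_sqr ?nnegrE ?mulr_ge0 ?(ltW z0) ?(ltW e0)//.
have h1 : (rescaling beta s t * v (x, t)) ^+ 2 <= r^-1 * B ^+ 2.
  by rewrite ler_pdivlMl.
apply: (le_trans h1).
have h2 : B * (1 + r^-1) <= rescaling beta s t * e.
  by rewrite -ler_pdivrMr// mulrAC.
apply: (@le_trans _ _ ((B * (1 + r^-1)) ^+ 2)).
  rewrite exprMn mulrC ler_wpM2l ?sqr_ge0//.
  by move: ri; move: (r^-1) => y y0; nra.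
rewrite lerXn2r ?nnegrE//; last exact: mulr_ge0 (ltW z0) (ltW e0).
by apply: mulr_ge0 => //; exact: addr_ge0 (ltW ri).
Qed.

End dispersion.

(** * Smooth bumps *)

Section flat.
Context {R : realType}.
Implicit Types (P Q : {poly R}) (x y : R).

(** The functions P(1/x) e^(-1/x), extended by 0 to x <= 0, form a class stable
under differentiation; [flat_deriv] is the action of the derivative on P.
Hence each of them is smooth. *)
Definition flat P x : R := if 0 < x then P.[x^-1] * expR (- x^-1) else 0.

Definition flat_deriv P : {poly R} := 'X^2 * (P - P^`()).

Lemma horner_le_Xn P : exists C n, 0 <= C /\ forall y, 1 <= y -> `|P.[y]| <= C * y ^+ n.
Proof.
elim/poly_ind: P => [|P c [C [n [C0 IH]]]].
  by exists 0, 0%N; split => // y _; rewrite horner0 normr0 mul0r.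
exists (C + `|c|), n.+1; split; first exact: addr_ge0.
move=> y y1; rewrite hornerMXaddC (le_trans (ler_normD _ _))// mulrDl lerD//.
  rewrite normrM exprSr mulrA [`|y|]ger0_norm ?(le_trans ler01)//.
  by rewrite ler_wpM2r ?IH// (le_trans ler01).
by rewrite ler_peMr// exprn_ege1.
Qed.

(** Any power of 1/x is beaten by the exponential; two powers to spare make the
derivative at the origin vanish as well. *)
Lemma flat_le_sqr P : exists2 C, 0 <= C & forall x, `|x| <= 1 -> `|flat P x| <= C * x ^+ 2.
Proof.
have [C [n [C0 CP]]] := horner_le_Xn P.
exists (C * (n.+2)`!%:R); first exact: mulr_ge0.
move=> x; rewrite /flat; case: ifPn => [x0|_ _]; last first.
  by rewrite normr0; apply: mulr_ge0; [exact: mulr_ge0|exact: sqr_ge0].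
rewrite gtr0_norm// => x1.
have [y y1 xE] : exists2 y, 1 <= y & x = y^-1.
  by exists x^-1; rewrite ?invf_ge1 ?invrK.
have y0 : 0 < y by exact: lt_le_trans ltr01 y1.
rewrite xE invrK.
have ex : y ^+ n.+2 / (n.+2)`!%:R <= expR y.
  by apply: le_trans (expR_ge1Dxn n.+1 (ltW y0)); rewrite lerDr.
rewrite normrM (gtr0_norm (expR_gt0 _)) expRN ler_pdivrMr ?expR_gt0//.
apply: (le_trans (CP y y1)); rewrite -!mulrA ler_wpM2l//.
have f0 : 0 < (n.+2)`!%:R :> R by rewrite ltr0n fact_gt0.
have -> : y ^+ n = y^-1 ^+ 2 * y ^+ n.+2.
  by rewrite -(addn2 n) exprD; move: (y ^+ n) => z; field; rewrite gt_eqF.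
rewrite ler_pdivrMr// in ex.
apply: (le_trans (ler_wpM2l (sqr_ge0 y^-1) ex)).
by rewrite le_eqVlt; apply/orP; left; apply/eqP; ring.
Qed.

Lemma is_derive_flat0 (f : R -> R) (C : R) : f 0 = 0 ->
  (forall x, `|x| <= 1 -> `|f x| <= C * x ^+ 2) -> is_derive (0 : R) (1 : R) f 0.
Proof.
move=> f0 fC.
have C0 : 0 <= C.
  by have := fC 1; rewrite normr1 expr1n mulr1 => /(_ (lexx _)); apply: le_trans.
have lim : h^-1 *: ((f \o shift (0 : R)) (h *: (1 : R)) - f 0) @[h --> 0^'] --> (0 : R).
  apply/cvgr0Pnorm_le => e e0; near=> h.
  have h0 : h != 0 by near: h; exact: nbhs_dnbhs_neq.
  have hn : 0 < `|h| by rewrite normr_gt0.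
  rewrite f0 subr0 /= addr0 /GRing.scale/= mulr1 normrM normfV ler_pdivrMl//.
  have h1 : `|h| <= 1 by near: h; apply: dnbhs0_le.
  have he : `|h| <= e / (C + 1) by near: h; apply: dnbhs0_le; rewrite divr_gt0// ltr_wpDl.
  rewrite (le_trans (fC h h1))// -real_normK ?num_real// expr2 mulrCA ler_wpM2l//.
  rewrite ler_pdivlMr ?ltr_wpDl// in he.
  by rewrite (le_trans _ he)// mulrDr mulr1 mulrC lerDl.
apply: DeriveDef; first by apply/cvg_ex; exists 0; exact: lim.
by rewrite /derive; apply/cvg_lim.
Unshelve. all: by end_near. Qed.

Lemma is_derive_flat P x : is_derive x 1 (flat P) (flat (flat_deriv P) x).
Proof.
have [x0|x0|->] := ltgtP x 0.
- have -> : flat (flat_deriv P) x = 0 by rewrite /flat ltNge (ltW x0).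
  apply: (@near_eq_is_derive _ _ _ (cst (0 : R))).
  near=> y; rewrite /flat ltNge ifF//.
  by apply/negbF/ltW; near: y; exact: lt_nbhsl.
- rewrite {2}/flat x0.
  apply: (@near_eq_is_derive _ _ _ (fun y => P.[y^-1] * expR (- y^-1))).
    near=> y; rewrite /flat ifT//; near: y; exact: lt_nbhsr.
  have xn0 : x != 0 by rewrite gt_eqF.
  have dV : is_derive x 1 (fun y : R => y^-1) (- x ^- 2).
    by apply: (is_derive_eq (is_deriveV xn0 (is_derive_id x 1))); rewrite /GRing.scale/= mulr1.
  have dP : is_derive x 1 (fun y => P.[y^-1]) (P^`().[x^-1] * - x ^- 2).
    exact: (is_derive1_comp (is_derive_poly P x^-1) dV).
  have dN : is_derive x 1 (fun y : R => - y^-1) (x ^- 2).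
    by apply: (is_derive_eq (is_deriveN dV)); rewrite opprK.
  have dE : is_derive x 1 (fun y => expR (- y^-1)) (expR (- x^-1) * x ^- 2).
    exact: (@is_derive1_comp R expR (fun y => - y^-1) x _ _ (is_derive_expR _) dN).
  apply: is_derive_eq; rewrite /flat_deriv !hornerE /GRing.scale/= exprVn.
  by ring.
- have -> : flat (flat_deriv P) 0 = 0 by rewrite /flat ltxx.
  have [C _ CP] := flat_le_sqr P.
  by apply: is_derive_flat0 CP; rewrite /flat ltxx.
Unshelve. all: by end_near. Qed.

End flat.

Section test_functions.
Context {R : realType}.
Implicit Types (f g : R * R -> R) (p : R * R) (U : set (R * R)).

Lemma difference_quotient_x f p :
  (fun h : R => h^-1 *: ((f \o shift p) (h *: ((1, 0) : R * R)) - f p)) =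
  (fun h : R => h^-1 *: (((fun x => f (x, p.2)) \o shift p.1) (h *: (1 : R)) - f (p.1, p.2))).
Proof.
apply/funext => h /=; case: p => x t /=; congr (_ *: (f _ - _)).
by apply: injective_projections => //=; rewrite scaler0 add0r.
Qed.

Lemma difference_quotient_t f p :
  (fun h : R => h^-1 *: ((f \o shift p) (h *: ((0, 1) : R * R)) - f p)) =
  (fun h : R => h^-1 *: (((fun t => f (p.1, t)) \o shift p.2) (h *: (1 : R)) - f (p.1, p.2))).
Proof.
apply/funext => h /=; case: p => x t /=; congr (_ *: (f _ - _)).
by apply: injective_projections => //=; rewrite scaler0 add0r.
Qed.

Lemma partial_xE f p : partial_x f p = 'D_1 (fun x => f (x, p.2)) p.1.
Proof. by rewrite /partial_x /derive difference_quotient_x. Qed.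

Lemma partial_tE f p : partial_t f p = 'D_1 (fun t => f (p.1, t)) p.2.
Proof. by rewrite /partial_t /derive difference_quotient_t. Qed.

Lemma is_derive_partial_x f p : differentiable f p ->
  is_derive p.1 1 (fun x => f (x, p.2)) (partial_x f p).
Proof.
move=> fp; have df : derivable f p ((1, 0) : R * R) by exact: diff_derivable.
apply: DeriveDef.
  by move: df; rewrite /derivable difference_quotient_x.
by rewrite partial_xE.
Qed.

Lemma is_derive_partial_t f p : differentiable f p ->
  is_derive p.2 1 (fun t => f (p.1, t)) (partial_t f p).
Proof.
move=> fp; have df : derivable f p ((0, 1) : R * R) by exact: diff_derivable.
apply: DeriveDef.
  by move: df; rewrite /derivable difference_quotient_t.
by rewrite partial_tE.
Qed.

Lemma Cn_onW n U f : Cn_on n.+1 U f -> Cn_on n U f.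
Proof.
elim: n f => [|n IH] f.
  by move=> [df _ _] p Up; apply/differentiable_continuous/df.
move=> Hf; have [df fx ft] : [/\ forall p, U p -> differentiable f p,
  Cn_on n.+1 U (partial_x f) & Cn_on n.+1 U (partial_t f)] := Hf.
exact (And3 df (IH _ fx) (IH _ ft)).
Qed.

Lemma partial_xM f g : (forall p, differentiable f p) -> (forall p, differentiable g p) ->
  partial_x (f \* g) = (partial_x f \* g) \+ (f \* partial_x g).
Proof.
move=> df dg; apply/funext => p.
have := is_derive_partial_x (df p); have := is_derive_partial_x (dg p) => dgx dfx.
rewrite partial_xE; apply: (@derive_val _ _ _ _ _ _ _ _).
by apply: is_derive_eq; rewrite /GRing.scale/=; case: p {df dg dgx dfx} => x t /=; ring.
Qed.

Lemma partial_tM f g : (forall p, differentiable f p) -> (forall p, differentiable g p) ->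
  partial_t (f \* g) = (partial_t f \* g) \+ (f \* partial_t g).
Proof.
move=> df dg; apply/funext => p.
have := is_derive_partial_t (df p); have := is_derive_partial_t (dg p) => dgx dfx.
rewrite partial_tE; apply: (@derive_val _ _ _ _ _ _ _ _).
by apply: is_derive_eq; rewrite /GRing.scale/=; case: p {df dg dgx dfx} => x t /=; ring.
Qed.

Lemma Cn_onD n f g : Cn_on n setT f -> Cn_on n setT g -> Cn_on n setT (f \+ g).
Proof.
elim: n f g => [|n IH] f g.
  by move=> cf cg p _; apply: cvgD; [exact: cf|exact: cg].
move=> [df fx ft] [dg gx gt].
have Ex : partial_x (f \+ g) = partial_x f \+ partial_x g.
  by apply/funext => p; apply: deriveD; apply: diff_derivable; [exact: df|exact: dg].
have Et : partial_t (f \+ g) = partial_t f \+ partial_t g.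
  by apply/funext => p; apply: deriveD; apply: diff_derivable; [exact: df|exact: dg].
split; [|rewrite Ex; exact (IH _ _ fx gx)|rewrite Et; exact (IH _ _ ft gt)].
by move=> p _; apply: differentiableD; [exact: df|exact: dg].
Qed.

Lemma Cn_onM n f g : Cn_on n setT f -> Cn_on n setT g -> Cn_on n setT (f \* g).
Proof.
elim: n f g => [|n IH] f g.
  by move=> cf cg p _; apply: cvgM; [exact: cf|exact: cg].
move=> Cf Cg; have Wf := Cn_onW Cf; have Wg := Cn_onW Cg.
move: Cf Cg => [df fx ft] [dg gx gt].
have df' p : differentiable f p by exact: df.
have dg' p : differentiable g p by exact: dg.
split; [|rewrite partial_xM//|rewrite partial_tM//].
- by move=> p _; exact: differentiableM.
- exact (Cn_onD (IH _ _ fx Wg) (IH _ _ Wf gx)).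
- exact (Cn_onD (IH _ _ ft Wg) (IH _ _ Wf gt)).
Qed.

Lemma differentiable_comp1 (h : R -> R) (l : R * R -> R) p :
  derivable h (l p) 1 -> differentiable l p -> differentiable (h \o l) p.
Proof. by move=> /derivable1_diffP dh dl; exact: differentiable_comp. Qed.

Lemma differentiable_fst p : differentiable (fun q : R * R => q.1) p.
Proof.
by apply: (@linear_differentiable _ _ _ (@fst R^o R^o)) => q; exact: cvg_fst.
Qed.

Lemma differentiable_snd p : differentiable (fun q : R * R => q.2) p.
Proof.
by apply: (@linear_differentiable _ _ _ (@snd R^o R^o)) => q; exact: cvg_snd.
Qed.

(** The induction on n runs over all polynomials P at once, since the derivative
replaces P by another polynomial.  The affine argument allows both flanks of a
bump to be instances. *)
Lemma Cn_on_flat_x n (P : {poly R}) (e c : R) :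
  Cn_on n setT (fun p => flat P (e * p.1 + c)).
Proof.
have dl p : differentiable (fun p : R * R => e * p.1 + c) p.
  apply: differentiableD; last exact: differentiable_cst.
  by apply: differentiableM; [exact: differentiable_cst|exact: differentiable_fst].
have dF (Q : {poly R}) p : differentiable (fun p : R * R => flat Q (e * p.1 + c)) p.
  apply: (@differentiable_comp1 (flat Q) (fun p : R * R => e * p.1 + c)) => //.
  exact: (@ex_derive _ _ _ _ _ _ _ (is_derive_flat Q _)).
elim: n P => [|n IH] P /=; first by move=> p _; exact/differentiable_continuous.
split => //.
- have -> : partial_x (fun p => flat P (e * p.1 + c)) =
      (fun p => flat (e *: flat_deriv P) (e * p.1 + c)); last exact: IH.
  apply/funext => p; rewrite partial_xE/=.
  have dl1 : is_derive p.1 1 (fun x : R => e * x + c) e.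
    by apply: is_derive_eq; rewrite /GRing.scale/=; ring.
  have := @is_derive1_comp R (flat P) (fun x => e * x + c) p.1 _ _ (is_derive_flat P _) dl1.
  move=> /(@derive_val _ _ _ _ _ _ _) ->; rewrite /flat; case: ifP => _; rewrite ?mul0r//.
  by rewrite hornerZ; ring.
- have -> : partial_t (fun p => flat P (e * p.1 + c)) =
      (fun p => flat 0 (e * p.1 + c)); last exact: IH.
  apply/funext => p; rewrite partial_tE/= derive_cst /flat horner0 mul0r.
  by case: ifP.
Qed.

Lemma Cn_on_flat_t n (P : {poly R}) (e c : R) :
  Cn_on n setT (fun p => flat P (e * p.2 + c)).
Proof.
have dl p : differentiable (fun p : R * R => e * p.2 + c) p.
  apply: differentiableD; last exact: differentiable_cst.
  by apply: differentiableM; [exact: differentiable_cst|exact: differentiable_snd].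
have dF (Q : {poly R}) p : differentiable (fun p : R * R => flat Q (e * p.2 + c)) p.
  apply: (@differentiable_comp1 (flat Q) (fun p : R * R => e * p.2 + c)) => //.
  exact: (@ex_derive _ _ _ _ _ _ _ (is_derive_flat Q _)).
elim: n P => [|n IH] P /=; first by move=> p _; exact/differentiable_continuous.
split => //.
- have -> : partial_x (fun p => flat P (e * p.2 + c)) =
      (fun p => flat 0 (e * p.2 + c)); last exact: IH.
  apply/funext => p; rewrite partial_xE/= derive_cst /flat horner0 mul0r.
  by case: ifP.
- have -> : partial_t (fun p => flat P (e * p.2 + c)) =
      (fun p => flat (e *: flat_deriv P) (e * p.2 + c)); last exact: IH.
  apply/funext => p; rewrite partial_tE/=.
  have dl1 : is_derive p.2 1 (fun x : R => e * x + c) e.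
    by apply: is_derive_eq; rewrite /GRing.scale/=; ring.
  have := @is_derive1_comp R (flat P) (fun x => e * x + c) p.2 _ _ (is_derive_flat P _) dl1.
  move=> /(@derive_val _ _ _ _ _ _ _) ->; rewrite /flat; case: ifP => _; rewrite ?mul0r//.
  by rewrite hornerZ; ring.
Qed.

(** The factors are written in the affine form of [Cn_on_flat_x]. *)
Definition bump (l r x : R) : R := flat 1 (1 * x + - l) * flat 1 (-1 * x + r).

Definition bump_deriv (l r x : R) : R :=
  flat (flat_deriv 1) (1 * x + - l) * flat 1 (-1 * x + r) -
  flat 1 (1 * x + - l) * flat (flat_deriv 1) (-1 * x + r).

Lemma bump_ge0 (l r x : R) : 0 <= bump l r x.
Proof.
by rewrite /bump /flat !hornerE; apply: mulr_ge0; case: ifP; rewrite ?mul1r ?expR_ge0.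
Qed.

Lemma bump_gt0 (l r x : R) : l < x < r -> 0 < bump l r x.
Proof.
move=> /andP[lx xr]; rewrite /bump /flat !hornerE !ifT; [|lra..].
by rewrite ?mul1r mulr_gt0 ?expR_gt0.
Qed.

Lemma bump_out (l r x : R) : ~ (l <= x <= r) -> bump l r x = 0 /\ bump_deriv l r x = 0.
Proof.
move=> nx; suff : flat 1 (1 * x + - l) = 0 /\ flat (flat_deriv 1) (1 * x + - l) = 0 \/
   flat 1 (-1 * x + r) = 0 /\ flat (flat_deriv 1) (-1 * x + r) = 0.
  by rewrite /bump /bump_deriv => -[[-> ->]|[-> ->]]; rewrite !(mulr0, mul0r, subr0).
have [lx|lx] := ltP x l.
  by left; rewrite /flat !ifF//; apply/negbTE; rewrite -leNgt; lra.
have [xr|xr] := ltP r x.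
  by right; rewrite /flat !ifF//; apply/negbTE; rewrite -leNgt; lra.
by case: nx; rewrite lx.
Qed.

Lemma bump_endpoints (l r : R) : bump l r l = 0 /\ bump l r r = 0.
Proof.
have f0 : flat 1 (0 : R) = 0 by rewrite /flat ltxx.
rewrite /bump; split.
  by have -> : 1 * l + - l = 0 by [ring]; rewrite f0 mul0r.
by have -> : -1 * r + r = 0 by [ring]; rewrite f0 mulr0.
Qed.

Lemma is_derive_bump (l r x : R) : is_derive x 1 (bump l r) (bump_deriv l r x).
Proof.
have d1 : is_derive x 1 (fun x : R => 1 * x + - l) 1.
  by apply: is_derive_eq; rewrite /GRing.scale/=; ring.
have d2 : is_derive x 1 (fun x : R => -1 * x + r) (-1).
  by apply: is_derive_eq; rewrite /GRing.scale/=; ring.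
have h1 := @is_derive1_comp R (flat 1) (fun x => 1 * x + - l) x _ _ (is_derive_flat 1 _) d1.
have h2 := @is_derive1_comp R (flat 1) (fun x => -1 * x + r) x _ _ (is_derive_flat 1 _) d2.
rewrite /comp in h1 h2; rewrite /bump; apply: is_derive_eq.
by rewrite /bump_deriv /GRing.scale/=; ring.
Qed.

Lemma continuous_flat (P : {poly R}) : continuous (flat P).
Proof. by move=> x; exact: is_derive_continuous (is_derive_flat P x). Qed.

Lemma continuous_bump_deriv (l r : R) : continuous (bump_deriv l r).
Proof.
move=> x.
have c1 (P : {poly R}) : {for x, continuous (fun x : R => flat P (1 * x + - l))}.
  apply: (@continuous_comp _ _ _ (fun x : R => 1 * x + - l) (flat P)); last exact: continuous_flat.
  by apply: cvgD; [apply: cvgM; [exact: cvg_cst|exact: cvg_id]|exact: cvg_cst].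
have c2 (P : {poly R}) : {for x, continuous (fun x : R => flat P (-1 * x + r))}.
  apply: (@continuous_comp _ _ _ (fun x : R => -1 * x + r) (flat P)); last exact: continuous_flat.
  by apply: cvgD; [apply: cvgM; [exact: cvg_cst|exact: cvg_id]|exact: cvg_cst].
by apply: cvgB; apply: cvgM; (exact: c1 || exact: c2).
Qed.

Definition bump2 (l r l' r' : R) (p : R * R) : R := bump l r p.1 * bump l' r' p.2.

Lemma partial_x_bump2 l r l' r' p :
  partial_x (bump2 l r l' r') p = bump_deriv l r p.1 * bump l' r' p.2.
Proof.
rewrite partial_xE /bump2/=; have := is_derive_bump l r p.1 => d.
by apply: (@derive_val _ _ _ _ _ _ _ _); apply: is_derive_eq; rewrite /GRing.scale/=; ring.
Qed.

Lemma partial_t_bump2 l r l' r' p :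
  partial_t (bump2 l r l' r') p = bump l r p.1 * bump_deriv l' r' p.2.
Proof.
rewrite partial_tE /bump2/=; have := is_derive_bump l' r' p.2 => d.
by apply: (@derive_val _ _ _ _ _ _ _ _); apply: is_derive_eq; rewrite /GRing.scale/=; ring.
Qed.

Lemma test_function_bump2 U l r l' r' :
  `[l, r] `*` `[l', r'] `<=` U -> test_function U (bump2 l r l' r').
Proof.
move=> QU; split.
  move=> n; apply: (@Cn_onM n (fun p => bump l r p.1) (fun p => bump l' r' p.2)).
    by apply: (@Cn_onM n (fun p => flat 1 (1 * p.1 + - l)) (fun p => flat 1 (-1 * p.1 + r)));
      exact: Cn_on_flat_x.
  by apply: (@Cn_onM n (fun p => flat 1 (1 * p.2 + - l')) (fun p => flat 1 (-1 * p.2 + r')));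
      exact: Cn_on_flat_t.
exists (`[l, r] `*` `[l', r']); split => //.
  by apply: compact_setX; exact: segment_compact.
move=> p np; rewrite /bump2.
have [/= x|/= x] := boolP (l <= p.1 <= r); last first.
  by rewrite (bump_out (negP x)).1 mul0r.
have [/= t|/= t] := boolP (l' <= p.2 <= r'); last first.
  by rewrite (bump_out (negP t)).1 mulr0.
by case: np; split; rewrite /= in_itv.
Qed.

End test_functions.

(** * From weak to pointwise balance laws *)

Section testing.
Context {R : realType}.
Notation mu := (@lebesgue_measure R).
Implicit Types (f g : R * R -> R) (U : set (R * R)).

Lemma continuous_bump (l r : R) : continuous (bump l r).
Proof. by move=> x; exact: is_derive_continuous (is_derive_bump l r x). Qed.

Definition bump_mass (l r : R) : R := \int[mu]_(x in `[l, r]) bump l r x.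

Lemma bump_mass_gt0 (l r : R) : l < r -> 0 < bump_mass l r.
Proof.
move=> lr; pose c := (l + r) / 2.
have lc : l < c < r by rewrite /c !midf_lt.
have bc := bump_gt0 lc.
have /cvgr_gt/(_ (bump l r c / 2)) := @continuous_bump l r c.
rewrite ltr_pdivrMr// ltr_pMr// ltr1n => /(_ isT) bn.
have : \forall y \near c, [/\ bump l r c / 2 < bump l r y, l < y & y < r].
  near=> y; split; near: y => //.
  - by apply: lt_nbhsr; case/andP: lc.
  - by apply: lt_nbhsl; case/andP: lc.
move=> /nbhs_ballP[e /= e0 eP].
pose d := e / 2; have d0 : 0 < d by rewrite divr_gt0.
have nearP y : c - d <= y <= c + d -> [/\ bump l r c / 2 < bump l r y, l < y & y < r].
  by move=> yd; apply: eP; rewrite /ball/= ltr_norml; move: yd; rewrite /d; lra.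
have [_ l1 _] := nearP (c - d) ltac:(lra).
have [_ _ r1] := nearP (c + d) ltac:(lra).
have ib p q : mu.-integrable `[p, q] (EFin \o bump l r).
  by apply: integrable_continuous_at => x _; exact: continuous_bump.
apply: (@lt_le_trans _ _ (\int[mu]_(x in `[c - d, c + d]) bump l r x)).
  apply: (@lt_le_trans _ _ (\int[mu]_(x in `[c - d, c + d]) (bump l r c / 2))).
    rewrite Rintegral_cst//= lebesgue_measure_itv/= lte_fin ifT; last by lra.
    by rewrite /= mulr_gt0 ?divr_gt0//; lra.
  apply: le_Rintegral => //.
    by apply: (@integrable_continuous_at R (cst (bump l r c / 2))) => x _; exact: cvg_cst.
  by move=> x /=; rewrite in_itv/= => /nearP[/ltW].
rewrite /bump_mass /Rintegral fine_le//; try exact: integrable_fin_num.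
apply: ge0_subset_integral => //=.
- by case/integrableP: (ib l r).
- by move=> x _; rewrite lee_fin bump_ge0.
- by apply: subset_itv; rewrite bnd_simp ltW.
Unshelve. all: by end_near. Qed.

(** Only a lower bound of the derivative is kept, as this is what survives
integration in the other variable. *)
Lemma bump_by_parts (h h' : R -> R) (l r m : R) : l < r ->
    (forall y, l <= y <= r -> is_derive y 1 h (h' y)) ->
    (forall y, l <= y <= r -> {for y, continuous h'}) ->
    (forall y, l <= y <= r -> m <= h' y) ->
  \int[mu]_(y in `[l, r]) (h y * bump_deriv l r y) <= - m * bump_mass l r.
Proof.
move=> lr dh ch' mh.
have ch y : l <= y <= r -> {for y, continuous h}.
  by move=> /dh; exact: is_derive_continuous.
have cb := @continuous_bump l r; have cb' := @continuous_bump_deriv R l r.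
have c1 y : l <= y <= r -> {for y, continuous (fun y => h y * bump_deriv l r y)}.
  by move=> yl; apply: cvgM; [exact: ch|exact: cb'].
have c2 y : l <= y <= r -> {for y, continuous (fun y => m * bump l r y)}.
  by move=> yl; apply: cvgM; [exact: cvg_cst|exact: cb].
have c3 y : l <= y <= r ->
    {for y, continuous (fun y => h y * bump_deriv l r y + h' y * bump l r y)}.
  by move=> yl; apply: cvgD; [exact: c1|apply: cvgM; [exact: ch'|exact: cb]].
have d3 y : l <= y <= r -> is_derive y 1 (fun y => h y * bump l r y)
    (h y * bump_deriv l r y + h' y * bump l r y).
  move=> yl; have d1 := dh y yl; have d2 := is_derive_bump l r y.
  by apply: is_derive_eq; rewrite /GRing.scale/=; ring.
have ftc := Rintegral_derive lr c3 d3.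
rewrite (bump_endpoints l r).1 (bump_endpoints l r).2 !mulr0 subr0 in ftc.
have i1 := integrable_continuous_at c1; have i2 := integrable_continuous_at c2.
have ib : mu.-integrable `[l, r] (EFin \o bump l r).
  by apply: integrable_continuous_at => x _; exact: cb.
suff : \int[mu]_(y in `[l, r]) (h y * bump_deriv l r y) + m * bump_mass l r <= 0 by lra.
rewrite /bump_mass -RintegralZl// -RintegralD// -ftc.
apply: le_Rintegral => //.
- by apply: integrable_continuous_at => y yl; apply: cvgD; [exact: c1|exact: c2].
- exact: integrable_continuous_at.
- move=> y /=; rewrite in_itv/= => yl; rewrite lerD2l ler_wpM2r ?bump_ge0//.
  exact: mh.
Qed.

Section rectangle.
Variables (l r l' r' : R).
Hypotheses (lr : l < r) (lr' : l' < r').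
Let Q : set (R * R) := `[l, r] `*` `[l', r'].

Lemma notin_rectangle (x t : R) : ~ Q (x, t) -> ~ (l <= x <= r) \/ ~ (l' <= t <= r').
Proof.
move=> nQ; have [xlr|xlr] := boolP (l <= x <= r); last by left; exact/negP.
by right => tlr; apply: nQ; split; rewrite /= in_itv.
Qed.

Lemma integrable_rectangle (f : R * R -> R) (h k : R -> R) (C : R) :
    measurable_fun Q f -> (forall p, Q p -> `|f p| <= C) ->
    continuous h -> continuous k ->
    (forall x, ~ (l <= x <= r) -> h x = 0) ->
    (forall t, ~ (l' <= t <= r') -> k t = 0) ->
  (mu \x mu)%E.-integrable setT (EFin \o (fun p => f p * (h p.1 * k p.2))).
Proof.
move=> mf fC ch ck h0 k0.
have mQ : measurable Q by apply: measurableX.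
have [H hH] : exists H, forall x, l <= x <= r -> `|h x| <= H.
  have [|c _ cmax] := @EVT_max R (fun x => `|h x|) l r (ltW lr).
    by apply: continuous_at_within => x _; apply: cvg_norm; exact: ch.
  by exists `|h c| => x xlr; apply: cmax; rewrite in_itv.
have [K kK] : exists K, forall x, l' <= x <= r' -> `|k x| <= K.
  have [|c _ cmax] := @EVT_max R (fun x => `|k x|) l' r' (ltW lr').
    by apply: continuous_at_within => x _; apply: cvg_norm; exact: ck.
  by exists `|k c| => x xlr; apply: cmax; rewrite in_itv.
have -> : EFin \o (fun p => f p * (h p.1 * k p.2)) =
    (EFin \o (fun p => f p * (h p.1 * k p.2))) \_ Q.
  apply/funext => -[x t]; rewrite patchE; case: ifPn => //; rewrite notin_setE.
  by move=> /notin_rectangle[/h0|/k0] /= ->; rewrite !(mul0r, mulr0).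
have onQ := (@integrable_mkcond _ _ _ (mu \x mu)%E Q
  (EFin \o (fun p => f p * (h p.1 * k p.2))) mQ).1.
apply: onQ.
apply: measurable_bounded_integrable => //.
- suff : ((mu \x mu) Q < +oo)%E by [].
  have -> : ((mu \x mu) Q = mu `[l, r] * mu `[l', r'])%E by exact: product_measure1E.
  rewrite !lebesgue_measure_itv/= !lte_fin lr lr'.
  by rewrite -!EFinD -EFinM ltry.
- apply: measurable_funM => //; apply: measurable_funM; apply: measurable_funTS.
    apply: (@measurableT_comp _ _ _ _ _ _ h) => //; exact: continuous_measurable_fun.
  apply: (@measurableT_comp _ _ _ _ _ _ k) => //; exact: continuous_measurable_fun.
- exists (C * (H * K)); split; first exact: num_real.
  move=> y Cy p Qp; apply: le_trans (ltW Cy); rewrite !normrM.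
  have [/= xQ tQ] := Qp; rewrite !in_itv/= in xQ tQ.
  apply: ler_pM => //; first exact: fC.
  by apply: ler_pM => //; [exact: hH|exact: kK].
Qed.

(** Fubini's theorem with the t-integral inside, where [bump_by_parts] applies on
each vertical segment. *)
Lemma le_integral_partial_t_bump2 (f ft : R * R -> R) (C m : R) :
    measurable_fun Q f -> (forall p, Q p -> `|f p| <= C) ->
    (forall p, Q p -> is_derive p.2 1 (fun t => f (p.1, t)) (ft p)) ->
    (forall p, Q p -> {for p, continuous ft}) ->
    (forall p, Q p -> m <= ft p) ->
  (mu \x mu)%E.-integrable setT (EFin \o (fun p => f p * partial_t (bump2 l r l' r') p)) /\
  (\int[mu \x mu]_p (f p * partial_t (bump2 l r l' r') p)%:E
    <= (- m * (bump_mass l r * bump_mass l' r'))%:E)%E.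
Proof.
move=> mf fC df cft mft.
have int := integrable_rectangle mf fC (@continuous_bump l r) (@continuous_bump_deriv R l' r')
  (fun x nx => (bump_out nx).1) (fun t nt => (bump_out nt).2).
under eq_fun do rewrite partial_t_bump2.
split => //; under eq_integral do rewrite partial_t_bump2.
rewrite -(integral12_prod_meas1 int).
have -> : ((- m * (bump_mass l r * bump_mass l' r'))%:E =
    \int[mu]_(x in `[l, r]) (- m * bump_mass l' r' * bump l r x)%:E)%E.
  have ib : mu.-integrable `[l, r] (EFin \o bump l r).
    by apply: integrable_continuous_at => x _; exact: continuous_bump.
  have := @RintegralZl _ _ _ mu `[l, r]%classic _ (- m * bump_mass l' r') (measurable_itv _) ib.
  rewrite /Rintegral -/(Rintegral mu `[l, r] (bump l r)) -/(bump_mass l r).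
  have -> : - m * (bump_mass l r * bump_mass l' r') = - m * bump_mass l' r' * bump_mass l r by ring.
  move=> <-; rewrite fineK//; apply: integrable_fin_num => //.
  by apply: integrable_continuous_at => x _; apply: cvgM; [exact: cvg_cst|exact: continuous_bump].
have Fout x : ~ `[l, r]%classic x ->
    fubini_F mu (EFin \o (fun p => f p * (bump l r p.1 * bump_deriv l' r' p.2))) x = 0%E.
  rewrite /= in_itv/= => nx; rewrite /fubini_F /=; apply: integral0_eq => t _.
  by rewrite (bump_out nx).1 mul0r mulr0.
have iF := integrable_fubini_F int.
rewrite [leLHS](_ : _ = \int[mu]_(x in `[l, r])
  fubini_F mu (EFin \o (fun p => (f p * (bump l r p.1 * bump_deriv l' r' p.2))%R)) x)%E; last first.
  rewrite [RHS]integral_mkcond; apply: eq_integral => x _.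
  by rewrite patchE; case: ifPn => //; rewrite notin_setE => /Fout.
apply: le_integral => //.
- by apply: integrableS iF.
- by apply: integrable_continuous_at => x _; apply: cvgM; [exact: cvg_cst|exact: continuous_bump].
move=> x; rewrite inE/= in_itv/= => xlr.
have Qx t : l' <= t <= r' -> Q (x, t) by move=> tlr; split; rewrite /= in_itv.
have ih : mu.-integrable `[l', r'] (EFin \o (fun t => f (x, t) * bump_deriv l' r' t)).
  apply: integrable_continuous_at => t tlr; apply: cvgM; last exact: continuous_bump_deriv.
  exact: is_derive_continuous (df _ (Qx _ tlr)).
have -> : fubini_F mu (EFin \o (fun p => f p * (bump l r p.1 * bump_deriv l' r' p.2))) x =
    (bump l r x * \int[mu]_(t in `[l', r']) (f (x, t) * bump_deriv l' r' t))%:E.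
  rewrite -RintegralZl// /Rintegral fineK; last first.
    apply: integrable_fin_num => //.
    by have := @integrableZl _ _ _ mu _ (measurable_itv `[l', r']) (bump l r x) _ ih.
  rewrite /fubini_F [RHS]integral_mkcond; apply: eq_integral => t _.
  rewrite patchE /=; case: ifPn => tlr; first by congr (_%:E); ring.
  rewrite notin_setE /= in_itv/= in tlr.
  by rewrite (bump_out tlr).2 !mulr0.
rewrite lee_fin mulrC ler_wpM2r ?bump_ge0//.
apply: (bump_by_parts lr') => t tlr; last exact: mft (Qx _ tlr).
- exact: (df _ (Qx _ tlr)).
- exact: continuous_slice_t (cft _ (Qx _ tlr)).
Qed.

End rectangle.

(** The same with the order of integration exchanged. *)
Lemma le_integral_partial_x_bump2 (l r l' r' : R) (g gx : R * R -> R) (C m : R)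
    (Q : set (R * R) := `[l, r] `*` `[l', r']) : l < r -> l' < r' ->
    measurable_fun Q g -> (forall p, Q p -> `|g p| <= C) ->
    (forall p, Q p -> is_derive p.1 1 (fun x => g (x, p.2)) (gx p)) ->
    (forall p, Q p -> {for p, continuous gx}) ->
    (forall p, Q p -> m <= gx p) ->
  (mu \x mu)%E.-integrable setT (EFin \o (fun p => g p * partial_x (bump2 l r l' r') p)) /\
  (\int[mu \x mu]_p (g p * partial_x (bump2 l r l' r') p)%:E
    <= (- m * (bump_mass l r * bump_mass l' r'))%:E)%E.
Proof.
move=> lr lr' mg gC dg cgx mgx.
have int := integrable_rectangle lr lr' mg gC (@continuous_bump_deriv R l r) (@continuous_bump l' r')
  (fun x nx => (bump_out nx).2) (fun t nt => (bump_out nt).1).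
under eq_fun do rewrite partial_x_bump2.
split => //; under eq_integral do rewrite partial_x_bump2.
rewrite -(integral21_prod_meas1 int).
have -> : ((- m * (bump_mass l r * bump_mass l' r'))%:E =
    \int[mu]_(t in `[l', r']) (- m * bump_mass l r * bump l' r' t)%:E)%E.
  have ib : mu.-integrable `[l', r'] (EFin \o bump l' r').
    by apply: integrable_continuous_at => x _; exact: continuous_bump.
  have := @RintegralZl _ _ _ mu `[l', r']%classic _ (- m * bump_mass l r) (measurable_itv _) ib.
  rewrite /Rintegral -/(Rintegral mu `[l', r'] (bump l' r')) -/(bump_mass l' r').
  have -> : - m * (bump_mass l r * bump_mass l' r') = - m * bump_mass l r * bump_mass l' r' by ring.
  move=> <-; rewrite fineK//; apply: integrable_fin_num => //.
  by apply: integrable_continuous_at => x _; apply: cvgM; [exact: cvg_cst|exact: continuous_bump].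
have Gout t : ~ `[l', r']%classic t ->
    fubini_G mu (EFin \o (fun p => g p * (bump_deriv l r p.1 * bump l' r' p.2))) t = 0%E.
  rewrite /= in_itv/= => nt; rewrite /fubini_G /=; apply: integral0_eq => x _.
  by rewrite (bump_out nt).1 !mulr0.
have iG : mu.-integrable setT
    (fubini_G mu (EFin \o (fun p => g p * (bump_deriv l r p.1 * bump l' r' p.2)))).
  have mgs : measurable_fun (`[l', r'] `*` `[l, r]) (g \o unstable.swap).
    apply: (measurable_comp _ _ mg).
    - by apply: measurableX.
    - by move=> _ [[x t] [/= xl tl] <-]; split.
    - by apply: measurable_funTS; exact: measurable_swap.
  have gCs p : (`[l', r'] `*` `[l, r])%classic p -> `|(g \o unstable.swap) p| <= C.
    by case: p => x t [/= xl tl]; apply: gC; split.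
  have := integrable_fubini_F (integrable_rectangle lr' lr mgs gCs
    (@continuous_bump l' r') (@continuous_bump_deriv R l r)
    (fun t nt => (bump_out nt).1) (fun x nx => (bump_out nx).2)).
  congr (integrable _ _ _); apply/funext => t; apply: eq_integral => x _ /=.
  by congr (_%:E); ring.
rewrite [leLHS](_ : _ = \int[mu]_(t in `[l', r'])
  fubini_G mu (EFin \o (fun p => (g p * (bump_deriv l r p.1 * bump l' r' p.2))%R)) t)%E; last first.
  rewrite [RHS]integral_mkcond; apply: eq_integral => x _.
  by rewrite patchE; case: ifPn => //; rewrite notin_setE => /Gout.
apply: le_integral => //.
- by apply: integrableS iG.
- by apply: integrable_continuous_at => x _; apply: cvgM; [exact: cvg_cst|exact: continuous_bump].
move=> t; rewrite inE/= in_itv/= => tlr.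
have Qx x : l <= x <= r -> Q (x, t) by move=> xlr; split; rewrite /= in_itv.
have ih : mu.-integrable `[l, r] (EFin \o (fun x => g (x, t) * bump_deriv l r x)).
  apply: integrable_continuous_at => x xlr; apply: cvgM; last exact: continuous_bump_deriv.
  exact: is_derive_continuous (dg _ (Qx _ xlr)).
have -> : fubini_G mu (EFin \o (fun p => g p * (bump_deriv l r p.1 * bump l' r' p.2))) t =
    (bump l' r' t * \int[mu]_(x in `[l, r]) (g (x, t) * bump_deriv l r x))%:E.
  rewrite -RintegralZl// /Rintegral fineK; last first.
    apply: integrable_fin_num => //.
    by have := @integrableZl _ _ _ mu _ (measurable_itv `[l, r]) (bump l' r' t) _ ih.
  rewrite /fubini_G [RHS]integral_mkcond; apply: eq_integral => x _.
  rewrite patchE /=; case: ifPn => xlr; first by congr (_%:E); ring.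
  rewrite notin_setE /= in_itv/= in xlr.
  by rewrite (bump_out xlr).2 !(mulr0, mul0r).
rewrite lee_fin mulrC ler_wpM2r ?bump_ge0//.
apply: (bump_by_parts lr) => x xlr; last exact: mgx (Qx _ xlr).
- exact: (dg _ (Qx _ xlr)).
- exact: continuous_slice_x (cgx _ (Qx _ xlr)).
Qed.

End testing.

Section pointwise.
Context {R : realType}.
Notation mu := (@lebesgue_measure R).

(** If f_t + g_x were positive at p0, then on a small square around p0 the lower
bounds m1 of f_t and m2 of g_x would satisfy m1 + m2 > 0, and the bump
supported by the square would contradict the weak inequality. *)
Lemma pointwise_of_weak_dissipation (U : set (R * R)) (f g ft gx : R * R -> R) :
    open U -> measurable U ->
    measurable_fun U f -> measurable_fun U g ->
    (forall p, U p -> {for p, continuous f}) ->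
    (forall p, U p -> {for p, continuous g}) ->
    (forall p, U p -> {for p, continuous ft}) ->
    (forall p, U p -> {for p, continuous gx}) ->
    (forall p, U p -> is_derive p.2 1 (fun t => f (p.1, t)) (ft p)) ->
    (forall p, U p -> is_derive p.1 1 (fun x => g (x, p.2)) (gx p)) ->
    weak_dissipation U f g ->
  forall p, U p -> ft p + gx p <= 0.
Proof.
move=> oU mU mf mg cf cg cft cgx df dg diss p0 Up; rewrite leNgt; apply/negP => pos.
(* The lower bounds are ft p0 - d and gx p0 - d, whose sum is 2 d. *)
pose d := (ft p0 + gx p0) / 4; have d0 : 0 < d by rewrite divr_gt0.
have [e0 e00 U0] := nbhs_pairP (open_nbhs_nbhs (conj oU Up)).
have [e1 e10 f1] := continuous_pairP ltr01 (cf _ Up).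
have [e2 e20 g1] := continuous_pairP ltr01 (cg _ Up).
have [e3 e30 ft1] := continuous_pairP d0 (cft _ Up).
have [e4 e40 gx1] := continuous_pairP d0 (cgx _ Up).
pose e := Num.min e0 (Num.min (Num.min e1 e2) (Num.min e3 e4)) / 2.
have e_gt0 : 0 < e by rewrite divr_gt0// !lt_min e00 e10 e20 e30 e40.
have [ee0 ee1 ee2 [ee3 ee4]] : [/\ e < e0, e < e1, e < e2 & e < e3 /\ e < e4].
  have : e < Num.min e0 (Num.min (Num.min e1 e2) (Num.min e3 e4)).
    by rewrite /e ltr_pdivrMr// ltr_pMr ?ltr1n// !lt_min e00 e10 e20 e30 e40.
  by rewrite !lt_min => /andP[? /andP[/andP[? ?] /andP[? ?]]].
case: p0 => x0 t0 in Up pos d d0 U0 f1 g1 ft1 gx1 *.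
pose l := x0 - e; pose r := x0 + e; pose l' := t0 - e; pose r' := t0 + e.
have lr : l < r by rewrite /l /r; move: e_gt0; clear; lra.
have lr' : l' < r' by rewrite /l' /r'; move: e_gt0; clear; lra.
pose Q : set (R * R) := `[l, r] `*` `[l', r'].
have Qe p : Q p -> `|p.1 - x0| <= e /\ `|p.2 - t0| <= e.
  case: p => x t [/=]; rewrite !in_itv/= => xl tl; rewrite !ler_norml.
  by move: xl tl; rewrite /l /r /l' /r'; clear; split; lra.
have QU : Q `<=` U.
  move=> -[x t] /Qe[/= xe te]; apply: U0 => /=; first exact: le_lt_trans ee0.
  exact: le_lt_trans ee0.
have Qf p : Q p -> `|f p| <= `|f (x0, t0)| + 1.
  move=> Qp; have [xe te] := Qe p Qp; case: p Qp xe te => x t Qp /= xe te.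
  exact: le_normr_of_dist (f1 x t (le_lt_trans xe ee1) (le_lt_trans te ee1)).
have Qg p : Q p -> `|g p| <= `|g (x0, t0)| + 1.
  move=> Qp; have [xe te] := Qe p Qp; case: p Qp xe te => x t Qp /= xe te.
  exact: le_normr_of_dist (g1 x t (le_lt_trans xe ee2) (le_lt_trans te ee2)).
have Qft p : Q p -> ft (x0, t0) - d <= ft p.
  move=> Qp; have [xe te] := Qe p Qp; case: p Qp xe te => x t Qp /= xe te.
  have := ft1 x t (le_lt_trans xe ee3) (le_lt_trans te ee3).
  by rewrite ltr_norml => /andP[h _]; move: h; clear; lra.
have Qgx p : Q p -> gx (x0, t0) - d <= gx p.
  move=> Qp; have [xe te] := Qe p Qp; case: p Qp xe te => x t Qp /= xe te.
  have := gx1 x t (le_lt_trans xe ee4) (le_lt_trans te ee4).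
  by rewrite ltr_norml => /andP[h _]; move: h; clear; lra.
have mfQ : measurable_fun Q f by exact: measurable_funS mf.
have mgQ : measurable_fun Q g by exact: measurable_funS mg.
have [if_ lef] := le_integral_partial_t_bump2 lr lr' mfQ Qf (fun p Qp => df p (QU p Qp))
  (fun p Qp => cft p (QU p Qp)) Qft.
have [ig_ leg] := le_integral_partial_x_bump2 lr lr' mgQ Qg (fun p Qp => dg p (QU p Qp))
  (fun p Qp => cgx p (QU p Qp)) Qgx.
have := diss (bump2 l r l' r') (test_function_bump2 QU)
  (fun p => mulr_ge0 (bump_ge0 _ _ _) (bump_ge0 _ _ _)).
rewrite leNgt => /negP; apply.
pose phi := bump2 l r l' r'.
have -> : weak_pairing U f g phi =
    fine (\int[mu \x mu]_p ((f p * partial_t phi p)%:E) +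
      \int[mu \x mu]_p (g p * partial_x phi p)%:E)%E.
  rewrite -(integralD measurableT if_ ig_).
  rewrite /weak_pairing /Rintegral integral_mkcond; congr fine.
  apply: eq_integral => p _; rewrite patchE; case: ifPn => //.
  rewrite notin_setE => nU; have nQ : ~ Q p by move/QU.
  rewrite /phi /= partial_t_bump2 partial_x_bump2.
  case: p nQ {nU} => x t /notin_rectangle[/bump_out[-> ->]|/bump_out[-> ->]].
    by rewrite /= !(mul0r, mulr0) addr0.
  by rewrite /= !(mul0r, mulr0) addr0.
have BB : 0 < bump_mass l r * bump_mass l' r' by rewrite mulr_gt0// bump_mass_gt0.
have fin1 := integrable_fin_num measurableT if_.
have fin2 := integrable_fin_num measurableT ig_.
have sum_lt0 (y z : \bar R) : y \is a fin_num -> z \is a fin_num ->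
    (y <= (- (ft (x0, t0) - d) * (bump_mass l r * bump_mass l' r'))%:E)%E ->
    (z <= (- (gx (x0, t0) - d) * (bump_mass l r * bump_mass l' r'))%:E)%E ->
    fine (y + z)%E < 0.
  move: y z => [y| |] [z| |] //= _ _; rewrite !lee_fin => yl zl.
  apply: le_lt_trans (lerD yl zl) _.
  by rewrite -mulrDl pmulr_llt0// /d; move: pos; clear; lra.
exact: (sum_lt0 _ _ fin1 fin2 lef leg).
Qed.

End pointwise.

(** * Convex edges and their velocities *)

Section convex_functions.
Context {R : realType}.
Implicit Types (f : R -> R) (x y z s t : R).

Lemma convex_chord f x y t : convex_function setT (f : R -> R^o) -> 0 <= t <= 1 ->
  f (t * x + (1 - t) * y) <= t * f x + (1 - t) * f y.
Proof.
move=> cf /andP[t0 t1].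
exact: (cf (Itv01 t0 t1) x y (mem_set I) (mem_set I)).
Qed.

Lemma convex_slope f x y z : convex_function setT (f : R -> R^o) -> x < y -> y < z ->
  (f y - f x) * (z - y) <= (f z - f y) * (y - x).
Proof.
move=> cf xy yz; have xz : 0 < z - x by move: xy yz; clear; lra.
pose t := (z - y) / (z - x).
have t01 : 0 <= t <= 1.
  rewrite /t divr_ge0 ?subr_ge0 ?(ltW yz)// ?(ltW xz)//=; last by rewrite -subr_ge0 ltW.
  by rewrite ler_pdivrMr// mul1r; move: xy; clear; lra.
have := convex_chord x z cf t01.
have -> : t * x + (1 - t) * z = y by rewrite /t; field; rewrite gt_eqF.
rewrite -(ler_pM2r xz).
have -> : (t * f x + (1 - t) * f z) * (z - x) = (z - y) * f x + (y - x) * f z.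
  by rewrite /t; field; rewrite gt_eqF.
by clear; lra.
Qed.

(** On [[t1, t2]] the slopes of chords lie between those over [[t1 - 1, t1]] and
over [[t2, t2 + 1]]. *)
Lemma convex_lipschitz f (t1 t2 : R) : convex_function setT (f : R -> R^o) ->
  exists2 L, 0 <= L & forall s s', t1 <= s <= t2 -> t1 <= s' <= t2 ->
    `|f s - f s'| <= L * `|s - s'|.
Proof.
move=> cf; pose A := f (t2 + 1) - f t2; pose B := f t1 - f (t1 - 1).
exists (`|A| + `|B|); first by rewrite addr_ge0.
have up s s' : s < s' -> s' <= t2 -> f s' - f s <= A * (s' - s).
  move=> ss; rewrite le_eqVlt => /predU1P[E|s't].
    have p : s' < t2 + 1 by rewrite -E ltrDl.
    by have := convex_slope cf ss p; rewrite /A -E addrAC subrr add0r mulr1.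
  have h1 := convex_slope cf ss s't.
  have p : t2 < t2 + 1 by rewrite ltrDl.
  have h2 := convex_slope cf s't p.
  have e1 : 0 < t2 - s' by rewrite subr_gt0.
  have e2 : 0 < s' - s by rewrite subr_gt0.
  rewrite -(ler_pM2r e1) (le_trans h1)//.
  rewrite addrAC subrr add0r mulr1 in h2.
  rewrite mulrAC ler_wpM2r ?(ltW e2)//.
have down s s' : s < s' -> t1 <= s -> B * (s' - s) <= f s' - f s.
  move=> ss; rewrite le_eqVlt => /predU1P[E|ts].
    have p : t1 - 1 < s by rewrite -E ltrBlDr ltrDl.
    have := convex_slope cf p ss; rewrite /B -E.
    by have -> : t1 - (t1 - 1) = 1 by [ring]; rewrite mulr1.
  have h1 := convex_slope cf ts ss.
  have p : t1 - 1 < t1 by rewrite ltrBlDr ltrDl.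
  have h2 := convex_slope cf p ts.
  have e1 : 0 < s - t1 by rewrite subr_gt0.
  have e2 : 0 < s' - s by rewrite subr_gt0.
  rewrite -(ler_pM2r e1) (le_trans _ h1)// mulrAC ler_wpM2r ?(ltW e2)//.
  by move: h2; have -> : t1 - (t1 - 1) = 1 by [ring]; rewrite mulr1.
have main s s' : s < s' -> t1 <= s -> s' <= t2 ->
    `|f s' - f s| <= (`|A| + `|B|) * (s' - s).
  move=> ss ts st; have e : 0 <= s' - s by rewrite subr_ge0 ltW.
  have U := up s s' ss st; have D := down s s' ss ts.
  have hA := ler_wpM2r e (ler_norm A); have hB := ler_wpM2r e (ler_norm (- B)).
  have nA := mulr_ge0 (normr_ge0 A) e; have nB := mulr_ge0 (normr_ge0 B) e.
  rewrite normrN in hB; rewrite ler_norml; move: U D hA hB nA nB; clear.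
  by move: (`|A|) (`|B|) => a b; lra.
move=> s s' /andP[ts st] /andP[ts' st'].
have [ss|ss|->] := ltgtP s s'; last by rewrite !subrr !normr0 mulr0.
  rewrite distrC [`|s - s'|]distrC [`|s' - s|]gtr0_norm ?subr_gt0//.
  exact: main.
by rewrite [`|s - s'|]gtr0_norm ?subr_gt0//; exact: main.
Qed.

Lemma convex_continuous f : convex_function setT (f : R -> R^o) -> continuous f.
Proof.
move=> cf x; have [L L0 lip] := convex_lipschitz (x - 1) (x + 1) cf.
apply/cvgrPdist_lt => e e0; near=> y.
have y1 : `|x - y| < 1 by near: y; exact: (@cvgr_dist_lt _ _ _ (nbhs x) _ id x cvg_id).
have ye : `|x - y| < e / (L + 1).
  near: y; apply: (@cvgr_dist_lt _ _ _ (nbhs x) _ id x cvg_id).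
  by rewrite divr_gt0// ltr_wpDl.
have L1 : 0 < L + 1 by rewrite ltr_wpDl.
rewrite (le_lt_trans (lip x y _ _))//.
- by clear; lra.
- by move: y1; rewrite ltr_norml; clear; lra.
- rewrite ltr_pdivlMr// in ye; apply: le_lt_trans ye; rewrite mulrDr mulr1 mulrC.
  by rewrite lerDl.
Unshelve. all: by end_near. Qed.

(** The difference quotients towards y decrease to the derivative, and the quotient
at distance 1 is f y - f s. *)
Lemma convex_tangent f s : convex_function setT (f : R -> R^o) -> derivable f s 1 ->
  forall y, f s + derive1 f s * (y - s) <= f y.
Proof.
move=> cf df y; rewrite -lerBrDl; pose w := y - s.
have dg : is_derive (0 : R) (1 : R) (fun t => f (t * w + s)) (derive1 f s * w).
  have dl : is_derive (0 : R) (1 : R) (fun t : R => t * w + s) w.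
    by apply: is_derive_eq; rewrite /GRing.scale/=; ring.
  have dfs : is_derive (0 * w + s) (1 : R) f (derive1 f s).
    by rewrite mul0r add0r; apply: DeriveDef => //; rewrite derive1E.
  exact: (@is_derive1_comp R f (fun t => t * w + s) 0 _ _ dfs dl).
have [dd dE] := dg.
rewrite -dE -/w.
have := dd; rewrite /derivable => /cvg_ex[l lim].
have El : 'D_1 (fun t => f (t * w + s)) 0 = l by rewrite /derive; apply/cvg_lim.
rewrite El.
have lim' : h^-1 *: (((fun t => f (t * w + s)) \o shift (0 : R)) (h *: (1 : R)) - f (0 * w + s))
    @[h --> 0^'+] --> l.
  exact: cvg_dnbhs_at_right lim.
apply: (cvgr_to_le lim').
near=> h; have h0 : 0 < h by near: h; exact: nbhs_right_gt.
have h1 : h <= 1 by near: h; exact: nbhs_right_le.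
rewrite /GRing.scale/= mulr1 addr0 mul0r add0r mulrC ler_pdivrMr//.
have h01 : 0 <= h <= 1 by rewrite (ltW h0).
have := convex_chord y s cf h01.
have -> : h * y + (1 - h) * s = h * w + s by rewrite /w; ring.
by clear; lra.
Unshelve. all: by end_near. Qed.

Lemma convex_derive1_le f s t : convex_function setT (f : R -> R^o) ->
  derivable f s 1 -> derivable f t 1 -> s < t -> derive1 f s <= derive1 f t.
Proof.
move=> cf ds dt st; have := convex_tangent cf ds t; have := convex_tangent cf dt s.
have ts : 0 < t - s by rewrite subr_gt0.
by move=> h1 h2; rewrite -(ler_pM2r ts); move: h1 h2; clear; lra.
Qed.

(** D will be the set of times where an edge has a velocity and G a set of full
measure where this velocity is the trace of u.  The limit is taken along D,
but estimates are available on G only; monotonicity transfers them. *)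
Lemma monotone_limit_pinfty (D G : set R) (g : R -> R) (M : R) :
    (forall s t, D s -> D t -> s < t -> g s <= g t) ->
    G `<=` D -> (forall T, exists2 t, T < t & G t) -> (forall t, G t -> g t <= M) ->
  exists l, [/\ g t @[t --> within D (pinfty_nbhs R)] --> l,
    forall t, D t -> g t <= l & forall c, (forall t, G t -> g t <= c) -> l <= c].
Proof.
move=> mono GD cof gM.
have bound c : (forall t, G t -> g t <= c) -> forall t, D t -> g t <= c.
  move=> gc t Dt; have [t' tt' Gt'] := cof t.
  exact: le_trans (mono _ _ Dt (GD _ Gt') tt') (gc _ Gt').
pose S := [set g t | t in D].
have S0 : S !=set0 by have [t _ Gt] := cof 0; exists (g t), t => //; exact: GD.
have hS : has_sup S by split => //; exists M => _ [t Dt <-]; exact: bound.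
have ub t : D t -> g t <= sup S by move=> Dt; apply: (sup_upper_bound hS); exists t.
exists (sup S); split => //; last first.
  by move=> c /bound gc; apply: ge_sup => // _ [t Dt <-]; exact: gc.
apply/cvgrPdist_le => e e0.
have [_ [t0 Dt0 <-] t0e] := sup_adherent e0 hS.
rewrite near_withinE; near=> t => Dt.
have tt : t0 < t by near: t; apply: nbhs_pinfty_gt; exact: num_real.
rewrite ger0_norm ?subr_ge0 ?ub//.
by have := mono _ _ Dt0 Dt tt; move: t0e; clear; lra.
Unshelve. all: by end_near. Qed.

Lemma monotone_limit_ninfty (D G : set R) (g : R -> R) (M : R) :
    (forall s t, D s -> D t -> s < t -> g s <= g t) ->
    G `<=` D -> (forall T, exists2 t, t < T & G t) -> (forall t, G t -> M <= g t) ->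
  exists l, [/\ g t @[t --> within D (ninfty_nbhs R)] --> l,
    forall t, D t -> l <= g t & forall c, (forall t, G t -> c <= g t) -> c <= l].
Proof.
move=> mono GD cof gM.
have bound c : (forall t, G t -> c <= g t) -> forall t, D t -> c <= g t.
  move=> gc t Dt; have [t' tt' Gt'] := cof t.
  exact: le_trans (gc _ Gt') (mono _ _ (GD _ Gt') Dt tt').
pose S := [set g t | t in D].
have S0 : S !=set0 by have [t _ Gt] := cof 0; exists (g t), t => //; exact: GD.
have hS : has_inf S by split => //; exists M => _ [t Dt <-]; exact: bound.
have lb t : D t -> inf S <= g t by move=> Dt; apply: ge_inf; [case: hS|exists t].
exists (inf S); split => //; last first.
  by move=> c /bound gc; apply: lb_le_inf => // _ [t Dt <-]; exact: gc.
apply/cvgrPdist_le => e e0.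
have [_ [t0 Dt0 <-] t0e] := inf_adherent e0 hS.
rewrite near_withinE; near=> t => Dt.
have tt : t < t0 by near: t; apply: nbhs_ninfty_lt; exact: num_real.
rewrite ler0_norm ?subr_le0 ?lb//.
by have := mono _ _ Dt Dt0 tt; move: t0e; clear; lra.
Unshelve. all: by end_near. Qed.

Lemma ae_in_interval (P : set R) (x y : R) : x < y ->
  {ae @lebesgue_measure R, forall t, P t} -> exists2 t, x < t < y & P t.
Proof.
move=> xy [N [mN N0 PN]]; apply: contrapT => nP.
have sub : `]x, y[%classic `<=` N.
  move=> t; rewrite /= in_itv/= => xt; apply: PN => /= Pt; apply: nP; by exists t.
have : (lebesgue_measure (`]x, y[%classic : set R) <= lebesgue_measure N)%E.
  by apply: le_measure => //; rewrite inE.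
by rewrite N0 lebesgue_measure_itv/= lte_fin xy -EFinD lee_fin subr_le0 leNgt xy.
Qed.

End convex_functions.

(** * A smooth admissible flow solves the equations pointwise *)

Section regularity.
Context {R : realType}.
Implicit Types (f g fx gx ft gt : R * R -> R) (U : set (R * R)).

Lemma slicewise_C1_of_smooth U f : smooth_on U f -> slicewise_C1 U f (partial_x f) (partial_t f).
Proof.
move=> /(_ 2)[df [dfx _ _] [dft _ _]]; split.
- by move=> p /df /differentiable_continuous.
- by move=> p /dfx /differentiable_continuous.
- by move=> p /dft /differentiable_continuous.
- by move=> p /df; exact: is_derive_partial_x.
- by move=> p /df; exact: is_derive_partial_t.
Qed.

Lemma slicewise_C1M U f fx ft g gx gt :
  slicewise_C1 U f fx ft -> slicewise_C1 U g gx gt ->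
  slicewise_C1 U (fun p => f p * g p) (fun p => fx p * g p + f p * gx p)
    (fun p => ft p * g p + f p * gt p).
Proof.
move=> [cf cfx cft dfx dft] [cg cgx cgt dgx dgt]; split.
- by move=> p Up; apply: cvgM; [exact: cf|exact: cg].
- move=> p Up; apply: cvgD; apply: cvgM;
    by [exact: cfx|exact: cg|exact: cf|exact: cgx].
- move=> p Up; apply: cvgD; apply: cvgM;
    by [exact: cft|exact: cg|exact: cf|exact: cgt].
- move=> p Up; have d1 := dfx p Up; have d2 := dgx p Up.
  by apply: is_derive_eq; rewrite /GRing.scale/=; case: p {Up d1 d2} => x t /=; ring.
- move=> p Up; have d1 := dft p Up; have d2 := dgt p Up.
  by apply: is_derive_eq; rewrite /GRing.scale/=; case: p {Up d1 d2} => x t /=; ring.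
Qed.

Lemma slicewise_C1D U f fx ft g gx gt :
  slicewise_C1 U f fx ft -> slicewise_C1 U g gx gt ->
  slicewise_C1 U (fun p => f p + g p) (fun p => fx p + gx p) (fun p => ft p + gt p).
Proof.
move=> [cf cfx cft dfx dft] [cg cgx cgt dgx dgt]; split.
- by move=> p Up; apply: cvgD; [exact: cf|exact: cg].
- by move=> p Up; apply: cvgD; [exact: cfx|exact: cgx].
- by move=> p Up; apply: cvgD; [exact: cft|exact: cgt].
- by move=> p Up; have d1 := dfx p Up; have d2 := dgx p Up; apply: is_derive_eq.
- by move=> p Up; have d1 := dft p Up; have d2 := dgt p Up; apply: is_derive_eq.
Qed.

Lemma slicewise_C1_powR U f fx ft (c q : R) : (forall p, U p -> 0 < f p) ->
  slicewise_C1 U f fx ft ->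
  slicewise_C1 U (fun p => c * f p `^ q) (fun p => c * (q * f p `^ (q - 1)) * fx p)
    (fun p => c * (q * f p `^ (q - 1)) * ft p).
Proof.
move=> f0 [cf cfx cft dfx dft].
have cp r p : U p -> f z `^ r @[z --> p] --> f p `^ r.
  move=> Up; have h := is_derive_continuous (is_derive1_powR r (f0 p Up)).
  exact: (@continuous_comp _ _ _ f (fun y : R => y `^ r) p (cf p Up) h).
split.
- by move=> p Up; apply: cvgM; [exact: cvg_cst|exact: cp].
- move=> p Up; apply: cvgM; last exact: cfx.
  by apply: cvgM; [exact: cvg_cst|apply: cvgM; [exact: cvg_cst|exact: cp]].
- move=> p Up; apply: cvgM; last exact: cft.
  by apply: cvgM; [exact: cvg_cst|apply: cvgM; [exact: cvg_cst|exact: cp]].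
- move=> [x t] Up; have d1 := dfx _ Up.
  have d2 := @is_derive1_comp R (fun y : R => y `^ q) (fun y => f (y, t)) x _ _ (is_derive1_powR q (f0 _ Up)) d1.
  by rewrite /comp/= in d2 *; apply: is_derive_eq; rewrite /GRing.scale/=; ring.
- move=> [x t] Up; have d1 := dft _ Up.
  have d2 := @is_derive1_comp R (fun y : R => y `^ q) (fun y => f (x, y)) t _ _ (is_derive1_powR q (f0 _ Up)) d1.
  by rewrite /comp/= in d2 *; apply: is_derive_eq; rewrite /GRing.scale/=; ring.
Qed.

Lemma measurable_flow_domain (a b : R -> R) : continuous a -> continuous b ->
  measurable (flow_domain a b).
Proof.
move=> ca cb.
have m2 (f : R -> R) : continuous f -> measurable_fun setT (fun p : R * R => f p.2).
  move=> cf; apply: (@measurableT_comp _ _ _ _ _ _ f) => //.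
  exact: continuous_measurable_fun.
have -> : flow_domain a b = [set p | a p.2 < p.1] `&` [set p | p.1 < b p.2].
  by apply/seteqP; split=> p; rewrite /flow_domain/= => /andP.
apply: measurableI.
- have := measurable_fun_ltr (m2 a ca) (@measurable_fst _ _ R R).
  by move=> /(_ measurableT [set true] I); rewrite setTI; congr measurable.
- have := measurable_fun_ltr (@measurable_fst _ _ R R) (m2 b cb).
  by move=> /(_ measurableT [set true] I); rewrite setTI; congr measurable.
Qed.

(** The second part tests the law with - phi, which is again a test function. *)
Lemma weak_dissipation_of_conservation U f g :
  weak_conservation_law U f g -> weak_dissipation U f g /\
  weak_dissipation U (fun p => - f p) (fun p => - g p).
Proof.
move=> law; split => phi phiU _; first by rewrite law.
pose psi := (cst (-1 : R)) \* phi.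
have [sphi [K [cK KU K0]]] := phiU.
have Ccst n (c : R) : Cn_on n setT (fun _ : R * R => c).
  elim: n c => [|n IH] c; first by move=> p _; exact: cvg_cst.
  have Ex : partial_x (fun _ : R * R => c) = (fun=> 0).
    by apply/funext => p; exact: derive_cst.
  have Et : partial_t (fun _ : R * R => c) = (fun=> 0).
    by apply/funext => p; exact: derive_cst.
  split; [|rewrite Ex; exact (IH 0)|rewrite Et; exact (IH 0)].
  by move=> p _; exact: differentiable_cst.
have psiU : test_function U psi.
  split; first by move=> n; exact (Cn_onM (Ccst n (-1)) (sphi n)).
  by exists K; split => // p /K0 E; rewrite /psi/= E mulr0.
have dphi p : differentiable phi p by have [h _ _] := sphi 1; exact: h.
have dc p : differentiable (cst (-1 : R) : R * R -> R) p by exact: differentiable_cst.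
have -> : weak_pairing U (fun p => - f p) (fun p => - g p) phi = weak_pairing U f g psi.
  rewrite /weak_pairing; apply: eq_Rintegral => p _.
  rewrite /psi partial_xM// partial_tM//=.
  have -> : partial_x (cst (-1 : R) : R * R -> R) p = 0 by exact: derive_cst.
  have -> : partial_t (cst (-1 : R) : R * R -> R) p = 0 by exact: derive_cst.
  by ring.
by rewrite law.
Qed.

Lemma pointwise_of_conservation U f fx ft g gx gt :
    open U -> measurable U -> measurable_fun U f -> measurable_fun U g ->
    slicewise_C1 U f fx ft -> slicewise_C1 U g gx gt ->
    weak_conservation_law U f g ->
  forall p, U p -> ft p + gx p = 0.
Proof.
move=> oU mU mf mg F G law p Up.
have [d1 d2] := weak_dissipation_of_conservation law.
have h1 := pointwise_of_weak_dissipation oU mU mf mg (sc1_cont F) (sc1_cont G)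
  (sc1_contt F) (sc1_contx G) (sc1_t F) (sc1_x G) d1 Up.
have neg h hx ht : slicewise_C1 U h hx ht ->
    slicewise_C1 U (fun p => - h p) (fun p => - hx p) (fun p => - ht p).
  move=> [c cx ct dx dt]; split.
  - by move=> q Uq; apply: cvgN; exact: c.
  - by move=> q Uq; apply: cvgN; exact: cx.
  - by move=> q Uq; apply: cvgN; exact: ct.
  - by move=> q Uq; have := dx q Uq => ?; apply: is_derive_eq.
  - by move=> q Uq; have := dt q Uq => ?; apply: is_derive_eq.
have F' := neg _ _ _ F; have G' := neg _ _ _ G.
have mN (h : R * R -> R) : measurable_fun U h -> measurable_fun U (fun p => - h p).
  by move=> mh; exact: (measurableT_comp (@oppr_measurable R setT) mh).
have h2 := pointwise_of_weak_dissipation oU mU (mN _ mf) (mN _ mg) (sc1_cont F') (sc1_cont G')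
  (sc1_contt F') (sc1_contx G') (sc1_t F') (sc1_x G') d2 Up.
by apply/eqP; rewrite eq_le h1/=; move: h2; clear; lra.
Qed.

End regularity.

Section flow_of_admissible.
Context {R : realType}.

(** The momentum equation is rho times the velocity equation plus u times the mass
equation; the sound equation is the mass equation multiplied by v'(rho). *)
Lemma riemann_flow_of_admissible (A gamma : R) (a b : R -> R) (rho u : R * R -> R) :
    0 < A -> 1 < gamma -> continuous a -> continuous b ->
    (forall p, flow_domain a b p -> 0 < rho p) ->
    measurable_fun (flow_domain a b) rho -> measurable_fun (flow_domain a b) u ->
    weak_conservation_law (flow_domain a b) rho (fun p => rho p * u p) ->
    weak_conservation_law (flow_domain a b) (fun p => rho p * u p)
      (momentum_flux A gamma rho u) ->
    smooth_on (flow_domain a b) rho -> smooth_on (flow_domain a b) u ->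
  let kappa := (gamma - 1) / 2 in
  let K := Num.sqrt (gamma * A) / kappa in
  riemann_flow kappa (flow_domain a b) rho (partial_x rho) (partial_t rho)
    u (partial_x u) (partial_t u)
    (fun p => K * rho p `^ kappa)
    (fun p => K * (kappa * rho p `^ (kappa - 1)) * partial_x rho p)
    (fun p => K * (kappa * rho p `^ (kappa - 1)) * partial_t rho p).
Proof.
move=> A0 g1 ca cb rho0 mrho mu_ mass mom srho su kappa K.
have kappa0 : 0 < kappa by rewrite divr_gt0// subr_gt0.
have g0 : 0 < gamma by exact: lt_trans g1.
have K0 : 0 < K by rewrite divr_gt0// sqrtr_gt0 mulr_gt0.
have kK : (kappa * K) ^+ 2 = gamma * A.
  rewrite /K mulrCA divff ?mulr1 ?gt_eqF// sqr_sqrtr//.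
  by rewrite mulr_ge0 ?ltW.
have oU := open_flow_domain ca cb; have mU := measurable_flow_domain ca cb.
have Crho := slicewise_C1_of_smooth srho; have Cu := slicewise_C1_of_smooth su.
have Cv := slicewise_C1_powR K kappa rho0 Crho.
have Cru := slicewise_C1M Crho Cu.
have Cp := slicewise_C1_powR A gamma rho0 Crho.
have mru : measurable_fun (flow_domain a b) (fun p => rho p * u p).
  exact: measurable_funM.
have E1 := pointwise_of_conservation oU mU mrho mru Crho Cru mass.
have Cflux := slicewise_C1D (slicewise_C1M Crho (slicewise_C1M Cu Cu)) Cp.
have fluxE : momentum_flux A gamma rho u =
    (fun p => rho p * (u p * u p) + A * rho p `^ gamma).
  by apply/funext => p; rewrite /momentum_flux /pressure expr2.
rewrite fluxE in mom.
have mflux : measurable_fun (flow_domain a b)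
    (fun p => rho p * (u p * u p) + A * rho p `^ gamma).
  apply: measurable_funD.
    by apply: measurable_funM => //; exact: measurable_funM.
  apply: measurable_funM; first exact: measurable_cst.
  exact: (measurableT_comp (measurable_powR gamma) mrho).
have E2 := pointwise_of_conservation oU mU mru mflux Cru Cflux mom.
have pk p : flow_domain a b p -> rho p * rho p `^ (kappa - 1) = rho p `^ kappa.
  by move=> /rho0 r0; rewrite mulr_powRB1// ltW.
have pg p : flow_domain a b p -> rho p `^ (gamma - 1) = rho p `^ kappa * rho p `^ kappa.
  move=> /rho0 r0; rewrite -powRD; last by rewrite (gt_eqF r0) implybT.
  by congr (_ `^ _); rewrite /kappa; field.
split => //.
- by move=> p /rho0 r0; rewrite mulr_gt0// powR_gt0.
- by move=> p Up; have := E1 p Up; move: Up => _; clear; lra.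
- move=> p Up; have r0 := rho0 p Up; have e1 := E1 p Up; have e2 := E2 p Up.
  have k1 := pk p Up; have k2 := pg p Up.
  apply: (mulfI (lt0r_neq0 r0)); rewrite mulr0.
  rewrite k2 in e2.
  have -> : rho p * (partial_t u p + u p * partial_x u p +
      kappa * (K * rho p `^ kappa) * (K * (kappa * rho p `^ (kappa - 1)) * partial_x rho p)) =
    rho p * (partial_t u p + u p * partial_x u p) +
      (kappa * K) ^+ 2 * rho p `^ kappa * (rho p * rho p `^ (kappa - 1)) * partial_x rho p.
    by ring.
  rewrite k1 kK.
  have rt : partial_t rho p = - (partial_x rho p * u p + rho p * partial_x u p).
    by move: e1; clear; lra.
  rewrite rt in e2; by rewrite -[RHS]e2; ring.
- move=> p Up; have e1 := E1 p Up; have k1 := pk p Up.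
  rewrite -k1.
  have -> : partial_t rho p = - (partial_x rho p * u p + rho p * partial_x u p).
    by move: e1; clear; lra.
  by ring.
- by move=> p Up; rewrite -(pk p Up); ring.
Qed.

(** The Lipschitz and continuity conditions on the edges come from convexity, the
bound on v from the one on rho. *)
Lemma vacuum_flow_of_admissible (A gamma : R) (a b : R -> R) (rho u : R * R -> R) :
    0 < A -> 1 < gamma ->
    eternal_vacuum_flow A gamma a b rho u -> admissible A gamma a b rho u ->
    smooth_on (flow_domain a b) rho -> smooth_on (flow_domain a b) u ->
  exists v vx vt M, vacuum_flow ((gamma - 1) / 2) a b rho (partial_x rho) (partial_t rho)
    u (partial_x u) (partial_t u) v vx vt M.
Proof.
move=> A0 g1 flow adm srho su.
have cb := convex_continuous (adm_right_convex adm).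
have ca : continuous a.
  have cNa := convex_continuous (adm_left_convex adm).
  move=> t; have : - - a s @[s --> t] --> - - a t by apply: cvgN; exact: cNa.
  by under eq_fun do rewrite opprK; rewrite opprK.
have F := riemann_flow_of_admissible A0 g1 ca cb (evf_gas flow)
  (adm_measurable_rho adm) (adm_measurable_u adm) (adm_mass adm) (adm_momentum adm) srho su.
have [M0 M0P] := adm_bounded adm.
set kappa := (gamma - 1) / 2 in F *; set K := Num.sqrt (gamma * A) / kappa in F.
have kappa0 : 0 < kappa by rewrite divr_gt0// subr_gt0.
exists (fun p => K * rho p `^ kappa),
  (fun p => K * (kappa * rho p `^ (kappa - 1)) * partial_x rho p),
  (fun p => K * (kappa * rho p `^ (kappa - 1)) * partial_t rho p),
  (Num.max M0 (K * M0 `^ kappa)).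
split => //.
- exact: evf_nonempty flow.
- move=> t1 t2.
  have [La La0 lipa] := convex_lipschitz t1 t2 (adm_left_convex adm).
  have [Lb Lb0 lipb] := convex_lipschitz t1 t2 (adm_right_convex adm).
  exists (La + Lb); first exact: addr_ge0.
  move=> s s' s12 s'12; split.
    have := lipa s s' s12 s'12.
    have -> : - a s - - a s' = - (a s - a s') by ring.
    by rewrite normrN => /le_trans; apply; rewrite ler_wpM2r// lerDl.
  by apply: (le_trans (lipb s s' s12 s'12)); rewrite ler_wpM2r// lerDr.
- move=> p Up; have [rM uM] := M0P p Up.
  have r0 := evf_gas flow Up.
  have rM' : rho p <= M0 by exact: le_trans (ler_norm _) rM.
  split; rewrite le_max; [by rewrite rM'|by rewrite uM|].
  apply/orP; right; rewrite ler_wpM2l//.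
    by rewrite divr_ge0// ltW.
  by rewrite ge0_ler_powR ?nnegrE ?(ltW kappa0) ?(ltW r0)// (le_trans (ltW r0)).
- exact: adm_vacuum_left adm.
- exact: adm_vacuum_right adm.
Qed.

End flow_of_admissible.

(** * Comparison of the edge velocities *)

Section boundary_traces.
Context {R : realType}.

Lemma trace_bounds (U : set (R * R)) (u : R * R -> R) (q : R * R) (l lo hi : R) :
    u p @[p --> within U (nbhs q)] --> l ->
    (forall e, 0 < e -> exists2 x, `|x - q.1| < e & U (x, q.2)) ->
    (forall p, U p -> lo <= u p <= hi) ->
  lo <= l <= hi.
Proof.
move=> ul acc ub.
have near_point e : 0 < e -> exists2 p, U p & `|l - u p| < e.
  move=> e0; have /cvgrPdist_lt/(_ e e0) := ul.
  rewrite near_withinE => /nbhs_pairP[d d0 dP].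
  have [x xq Ux] := acc d d0; exists (x, q.2) => //.
  by apply: dP => //; rewrite subrr normr0.
apply/andP; split; apply/ler_addgt0Pr => e e0.
  have [p /ub /andP[lp _]] := near_point e e0.
  by rewrite ltr_norml => /andP[h _]; move: h lp; clear; lra.
have [p /ub /andP[_ hp]] := near_point e e0.
by rewrite ltr_norml => /andP[_ h]; move: h hp; clear; lra.
Qed.

End boundary_traces.

Theorem theorem3p1 (R : realType) (A gamma : R) (a b : R -> R)
    (rho u : R * R -> R) (A_gt0 : 0 < A) (gamma_gt1 : 1 < gamma)
    (flow : eternal_vacuum_flow A gamma a b rho u)
    (adm : admissible A gamma a b rho u)
    (smooth_rho : smooth_on (flow_domain a b) rho)
    (smooth_u : smooth_on (flow_domain a b) u) :
  exists p_plus p_minus q_plus q_minus : R,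
    [/\ velocity_limit a (pinfty_nbhs R) p_plus, velocity_limit a (ninfty_nbhs R) p_minus,
        velocity_limit b (pinfty_nbhs R) q_plus & velocity_limit b (ninfty_nbhs R) q_minus] /\
    (p_plus = q_minus /\ p_minus = q_plus).
Proof.
have [v [vx [vt [M V]]]] := vacuum_flow_of_admissible A_gt0 gamma_gt1 flow adm smooth_rho smooth_u.
have kappa0 : 0 < (gamma - 1) / 2 by rewrite divr_gt0// subr_gt0.
have cNa := adm_left_convex adm; have cb := adm_right_convex adm.
pose good t := [/\ derivable a t 1, derivable b t 1,
  u p @[p --> within (flow_domain a b) (nbhs (a t, t))] --> derive1 a t &
  u p @[p --> within (flow_domain a b) (nbhs (b t, t))] --> derive1 b t].
have ae_good : {ae @lebesgue_measure R, forall t, good t}.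
  apply: (@filterS2 _ _ (ae_filter_ringOfSetsType _) _ _ _ _ (evf_left flow) (evf_right flow)).
  by move=> t [? ?] [? ?].
have cof_p T : exists2 t, T < t & good t.
  have [|t /andP[Tt _] gt] := ae_in_interval (x := T) (y := T + 1) _ ae_good.
    by rewrite ltrDl.
  by exists t.
have cof_m T : exists2 t, t < T & good t.
  have [|t /andP[_ Tt] gt] := ae_in_interval (x := T - 1) (y := T) _ ae_good.
    by rewrite ltrBlDr ltrDl.
  by exists t.
have traces lo hi : (forall p, flow_domain a b p -> lo <= u p <= hi) ->
    forall t, good t -> lo <= derive1 a t <= hi /\ lo <= derive1 b t <= hi.
  move=> ub t [_ _ ta tb]; have ab := evf_nonempty flow t.
  split; [apply: (trace_bounds ta) => // e e0|apply: (trace_bounds tb) => // e e0].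
    exists (a t + Num.min e (b t - a t) / 2).
      rewrite addrAC subrr add0r gtr0_norm; last by rewrite divr_gt0// lt_min e0 subr_gt0.
      by rewrite ltr_pdivrMr// (@le_lt_trans _ _ e)// ?ge_min ?lexx// ltr_pMr// ltr1n.
    have m0 : 0 < Num.min e (b t - a t) by rewrite lt_min e0 subr_gt0.
    have m1 : Num.min e (b t - a t) <= b t - a t by rewrite ge_min lexx orbT.
    by rewrite /flow_domain/=; move: m0 m1 ab; clear; lra.
  exists (b t - Num.min e (b t - a t) / 2).
    rewrite addrAC subrr add0r normrN gtr0_norm; last by rewrite divr_gt0// lt_min e0 subr_gt0.
    by rewrite ltr_pdivrMr// (@le_lt_trans _ _ e)// ?ge_min ?lexx// ltr_pMr// ltr1n.
  have m0 : 0 < Num.min e (b t - a t) by rewrite lt_min e0 subr_gt0.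
  have m1 : Num.min e (b t - a t) <= b t - a t by rewrite ge_min lexx orbT.
  by rewrite /flow_domain/=; move: m0 m1 ab; clear; lra.
have uM p : flow_domain a b p -> - M <= u p <= M.
  by move=> /(vf_bounded V)[_ + _]; rewrite ler_norml.
have tracesM := traces _ _ uM.
have dNa t : derivable a t 1 ->
    derivable (fun t => - a t) t 1 /\ derive1 (fun t => - a t) t = - derive1 a t.
  by move=> da; split; [exact: derivableN|rewrite !derive1E deriveN].
have mono_b s t : derivable b s 1 -> derivable b t 1 -> s < t -> derive1 b s <= derive1 b t.
  exact: convex_derive1_le.
have mono_a s t : derivable a s 1 -> derivable a t 1 -> s < t ->
    - derive1 a s <= - derive1 a t.
  move=> /dNa[ds <-] /dNa[dt <-]; exact: convex_derive1_le.
have ga : good `<=` [set t | derivable a t 1].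
  move=> t gt; have [h _ _ _] := gt; exact h.
have gb : good `<=` [set t | derivable b t 1].
  move=> t gt; have [_ h _ _] := gt; exact h.
have [qp [lim_qp qp_ge qp_le]] := monotone_limit_pinfty mono_b gb cof_p
  (fun t gt => (andP (tracesM t gt).2).2).
have [qm [lim_qm qm_le qm_ge]] := monotone_limit_ninfty mono_b gb cof_m
  (fun t gt => (andP (tracesM t gt).2).1).
have [pp' [lim_pp pp_ge pp_le]] := monotone_limit_pinfty (M := M) mono_a ga cof_p
  (fun t gt => ltac:(have [/andP[h _] _] := tracesM t gt; move: h; clear; lra)).
have [pm' [lim_pm pm_le pm_ge]] := monotone_limit_ninfty (M := - M) mono_a ga cof_m
  (fun t gt => ltac:(have [/andP[_ h] _] := tracesM t gt; move: h; clear; lra)).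
have tan_b s y : derivable b s 1 -> b s + derive1 b s * (y - s) <= b y.
  by move=> ds; exact: convex_tangent.
have tan_a s y : derivable a s 1 -> a y <= a s + derive1 a s * (y - s).
  move=> /dNa[ds E]; have := convex_tangent cNa ds y; rewrite E; clear; lra.
(* At late times u is close to x / (1 + t), and the tangents at t to the edges,
   evaluated at time 0, confine x to [a 0 - pp' t, b 0 + qp t].  Here - pp' is
   the limit of a' at +oo. *)
have fwd p : flow_domain a b p -> - pp' <= u p <= qp.
  apply: (velocity_range kappa0 V) => e e0.
  have e2 : 0 < e / 2 by rewrite divr_gt0.
  have [T TP] := late_velocity kappa0 V (or_introl erefl : (1 : R) = 1 \/ (1 : R) = -1) e2.
  pose c := `|b 0 - qp| + `|a 0 + pp'|.
  have [t Tt [da db _ _]] := cof_p (Num.max T (Num.max 0 (c / (e / 2)))).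
  move: Tt; rewrite !gt_max => /and3P[Tt t0 ct].
  exists t => x xab; have [||uv ve] := TP t _ _ x xab; [by rewrite mul1r ltW|by rewrite mul1r ltW|].
  rewrite !mul1r in uv; split; last by move: ve e0; clear; lra.
  have d0 : 0 < 1 + t by rewrite addr_gt0.
  have bt := tan_b t 0 db; have at_ := tan_a t 0 da.
  have bq := ler_wpM2r (ltW t0) (qp_ge t db).
  have ap := ler_wpM2r (ltW t0) (pp_ge t da).
  rewrite ltr_pdivrMr// in ct.
  have c1 : x / (1 + t) <= qp + e / 2.
    rewrite ler_pdivrMr//; have := ler_norm (b 0 - qp); have := normr_ge0 (a 0 + pp').
    rewrite /c in ct; move: xab bt bq ct e2 t0; clear; lra.
  have c2 : - pp' - e / 2 <= x / (1 + t).
    rewrite ler_pdivlMr//; have := ler_norm (- (a 0 + pp')); have := normr_ge0 (b 0 - qp).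
    rewrite normrN /c in ct *; move: xab at_ ap ct e2 t0; clear; lra.
  by move: uv c1 c2; rewrite ler_norml; clear; lra.
(* The same in the past, where u is close to x / (t - 1) and x lies in
   [a 0 - pm' t, b 0 + qm t]; the division by t - 1 < 0 exchanges the ends. *)
have bwd p : flow_domain a b p -> qm <= u p <= - pm'.
  apply: (velocity_range kappa0 V) => e e0.
  have e2 : 0 < e / 2 by rewrite divr_gt0.
  have [T TP] := late_velocity kappa0 V (or_intror erefl : (-1 : R) = 1 \/ (-1 : R) = -1) e2.
  pose c := `|b 0 + qm| + `|a 0 - pm'|.
  have [t Tt [da db _ _]] := cof_m (Num.min (- T) (Num.min 0 (- (c / (e / 2))))).
  move: Tt; rewrite !lt_min => /and3P[Tt t0 ct].
  rewrite ltrNr in Tt; rewrite ltrNr in ct.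
  have t0' : 0 < - t by rewrite oppr_gt0.
  exists t => x xab; have [||uv ve] := TP t _ _ x xab; [by rewrite mulN1r ltW|by rewrite mulN1r ltW|].
  rewrite !mulN1r in uv; split; last by move: ve e0; clear; lra.
  have d0 : 0 < 1 - t by rewrite addr_gt0.
  have bt := tan_b t 0 db; have at_ := tan_a t 0 da.
  have bq := ler_wpM2r (ltW t0') (qm_le t db).
  have ap := ler_wpM2r (ltW t0') (pm_le t da).
  rewrite ltr_pdivrMr// in ct.
  have c1 : - x / (1 - t) <= - pm' + e / 2.
    rewrite ler_pdivrMr//; have := ler_norm (- (a 0 - pm')); have := normr_ge0 (b 0 + qm).
    rewrite normrN /c in ct *; move: xab at_ ap ct e2 t0; clear; lra.
  have c2 : qm - e / 2 <= - x / (1 - t).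
    rewrite ler_pdivlMr//; have := ler_norm (b 0 + qm); have := normr_ge0 (a 0 - pm').
    rewrite /c in ct; move: xab bt bq ct e2 t0; clear; lra.
  by move: uv c1 c2; rewrite ler_norml; clear; lra.
(* Both edge velocities now lie in both ranges at good times, and letting the
   time go to +oo or -oo gives the missing inequalities. *)
have tf := traces _ _ fwd; have tb := traces _ _ bwd.
exists (- pp'), (- pm'), qp, qm; split; [split|split].
- have h : - - derive1 a t @[t --> within [set t | derivable a t 1] (pinfty_nbhs R)]
      --> - pp' by exact: cvgN.
  by move: h; under eq_fun do rewrite opprK.
- have h : - - derive1 a t @[t --> within [set t | derivable a t 1] (ninfty_nbhs R)]
      --> - pm' by exact: cvgN.
  by move: h; under eq_fun do rewrite opprK.
- exact: lim_qp.
- exact: lim_qm.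
- apply/eqP; rewrite eq_le; apply/andP; split.
    by apply: qm_ge => t /tf[_ /andP[]].
  by rewrite lerNr; apply: pp_le => t /tb[/andP[h _] _]; rewrite lerN2.
- apply/eqP; rewrite eq_le; apply/andP; split.
    by rewrite lerNl; apply: pm_ge => t /tf[/andP[_ h] _]; rewrite lerN2.
  by apply: qp_le => t /tb[_ /andP[]].
Qed.
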